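(* Let $n\in\{3,4,5\}$ and let the alternating group $\mathcal{A}_n$ act on $A_n(\mathbb{F})$ via its permutation action on $x_1,\dots,x_n$ (and correspondingly on $y_1,\dots,y_n$). There is $p_0$ such that for every algebraically closed field $\mathbb{F}$ of characteristic $p>p_0$, the skew field of fractions of $A_n(\mathbb{F})^{\mathcal{A}_n}$ is isomorphic to $\mathbb{D}_{m,l}(\mathbb{F})$ for some $m,l\ge 0$.
   Context: For a field $K$, $A_n(K)$ is the $K$-algebra generated by $x_1,\dots,x_n,y_1,\dots,y_n$ with relations $[x_i,x_j]=[y_i,y_j]=0$, $[y_i,x_j]=\delta_{ij}$; $\mathbb{D}_{m,l}(K)$ is the skew field of fractions of $A_m(K(t_1,\dots,t_l))$. The permutation action of $\sigma$ is $x_i\mapsto x_{\sigma(i)}$, $y_i\mapsto y_{\sigma(i)}$, extended to algebra automorphisms. *)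

(* Defs.v *)
From HB Require Import structures.
From mathcomp Require Import all_boot all_order all_algebra all_fingroup.
From mathcomp Require Import fraction.
From mathcomp Require Import mpoly.
Set Implicit Arguments. Unset Strict Implicit. Unset Printing Implicit Defensive.
Import GRing.Theory.
Local Open Scope ring_scope.

Definition weyl_mono (K : fieldType) (n : nat) (W : algType K)
  (x y : 'I_n -> W) (ab : {ffun 'I_n -> nat} * {ffun 'I_n -> nat}) : W :=
  (\prod_(i < n) x i ^+ ab.1 i) * (\prod_(i < n) y i ^+ ab.2 i).

(* W, with distinguished elements x_1..x_n, y_1..y_n, is (a copy of) the Weyl
   algebra A_n(K): the defining relations hold and the normally ordered
   monomials x^a y^b form a K-basis of W (PBW basis).  This determines
   (W, x, y) up to a unique K-algebra isomorphism. *)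
Definition is_weyl (K : fieldType) (n : nat) (W : algType K)
  (x y : 'I_n -> W) : Prop :=
  [/\ (forall i j, x i * x j = x j * x i),
      (forall i j, y i * y j = y j * y i),
      (forall i j, y i * x j - x j * y i = (i == j)%:R),
      (forall w : W, exists s : seq ({ffun 'I_n -> nat} * {ffun 'I_n -> nat}),
          exists c : {ffun 'I_n -> nat} * {ffun 'I_n -> nat} -> K,
            w = \sum_(ab <- s) c ab *: weyl_mono x y ab) &
      (forall (s : seq ({ffun 'I_n -> nat} * {ffun 'I_n -> nat}))
              (c : {ffun 'I_n -> nat} * {ffun 'I_n -> nat} -> K),
          uniq s -> \sum_(ab <- s) c ab *: weyl_mono x y ab = 0 ->
          forall ab, ab \in s -> c ab = 0)].

Definition is_alg_endo (K : fieldType) (W : algType K) (phi : W -> W) : Prop :=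
  [/\ phi 1 = 1,
      (forall u v, phi (u + v) = phi u + phi v),
      (forall u v, phi (u * v) = phi u * phi v) &
      (forall (c : K) u, phi (c *: u) = c *: phi u)].

Definition perm_action (K : fieldType) (n : nat) (W : algType K)
  (x y : 'I_n -> W) (s : 'S_n) (phi : W -> W) : Prop :=
  is_alg_endo phi /\ (forall i, phi (x i) = x (s i) /\ phi (y i) = y (s i)).

Definition alt_invariant (K : fieldType) (n : nat) (W : algType K)
  (x y : 'I_n -> W) (w : W) : Prop :=
  forall (s : 'S_n), ~~ odd_perm s ->
    forall phi : W -> W, perm_action x y s phi -> phi w = w.

Definition is_skew_frac (R : nzRingType) (S : R -> Prop) (D : unitRingType)
  (f : R -> D) : Prop :=
  [/\ (forall d : D, d != 0 -> d \is a GRing.unit),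
      f 1 = 1,
      (forall a b, S a -> S b -> f (a + b) = f a + f b) &
      (forall a b, S a -> S b -> f (a * b) = f a * f b)] /\
  [/\ (forall a b, S a -> S b -> f a = f b -> a = b) &
      (forall d : D, exists a b, S a /\ S b /\ b != 0 /\ d = f a * (f b)^-1)].

Definition ratfun (F : fieldType) (l : nat) : fieldType :=
  {fraction {mpoly F[l]}}.

Definition ratfun_const (F : fieldType) (l : nat) (c : F) : ratfun F l :=
  tofrac (c%:MP_[l]).

(* Ring isomorphism phi : D1 -> D2 that is compatible with the F-algebra
   structures, given by c |-> f1 (c%:A) and c |-> f2 (e c %:A). *)
Definition is_F_ring_iso (F : fieldType) (D1 D2 : unitRingType)
  (c1 : F -> D1) (c2 : F -> D2) (phi : D1 -> D2) : Prop :=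
  [/\ bijective phi, phi 1 = 1,
      (forall u v, phi (u + v) = phi u + phi v),
      (forall u v, phi (u * v) = phi u * phi v) &
      (forall c : F, phi (c1 c) = c2 c)].

(* Main.v *)
(** In characteristic p the Weyl algebra W is finite over the central polynomial ring
    generated by the x_i^p and y_i^p, so its skew field of fractions D is the localization
    of W at nonzero central elements.

    Suppose that the field F(x)^{A_n} is generated over F by n elements f_1, ..., f_n.
    Since F(x) is separable over F(f), the Jacobian (df_k/dx_i) is invertible; with
    (a_ki) its inverse, the elements delta_k = sum_i a_ki y_i of D commute with each
    other, are A_n-invariant and satisfy [delta_k, f_l] = [k = l].  Hence x_i |-> f_i,
    y_i |-> delta_i extends to an injective endomorphism of D.  Its image is the fraction
    field of W^{A_n}: every element of W is a polynomial in the delta_k with coefficients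
    in F(x) on the left, and averaging over A_n moves the coefficients into F(f).  So
    Frac(W^{A_n}) is isomorphic to Frac(W), i.e. m = n and l = 0.

    It remains to see that F(x)^{A_n} = F(e_1, ..., e_n, delta), delta^2 = disc, is purely
    transcendental.  For n = 3 and n = 4 the classical formulas for the discriminant can be
    solved rationally after dehomogenizing.  For n = 5 the quintic is written in Sylvester's
    form sum_i a_i (T - r_i)^5.  Up to squares and a common factor its discriminant is
    (t1^2 - 4 t2)^2 - 128 t1 t3, where t1, t2, t3 are the elementary symmetric functions of
    c_i = (r_j - r_k)^4 N(r_j) N(r_k), N being the numerator of sum_i a_i / (T - r_i).
    After scaling t1 to 1 this is linear in t3; the r_i, and then the a_i, are recovered
    from the coefficients in r_i = A + B c_i + C c_i^2. *)

Require Import Defs.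
From HB Require Import structures.
From mathcomp Require Import all_boot all_order all_algebra all_fingroup.
From mathcomp Require Import fraction generic_quotient alt.
From mathcomp Require Import mpoly.
From mathcomp Require Import ring zify.
From Stdlib Require ClassicalEpsilon Classical_Prop.
Set Implicit Arguments. Unset Strict Implicit. Unset Printing Implicit Defensive.
Import GRing.Theory.
Local Open Scope ring_scope.

(** The obstacle is characteristic p: the p-th powers of the generators are central, so commutation
    relations alone prove neither the independence of the [delta_k] over F(x) nor the injectivity of
    the endomorphism. Independence of the [delta_k] is read off from leading symbols, on which a
    linear change of the [y_i] acts by substitution. Independence of the [f_k] uses p-th roots,
    which exist since F is perfect. Averaging divides by the order of the alternating group and the
    formulas divide by 2, 3 and 5; hence the bound 5.

    One skew field D serves both for W and for its invariants: the invariants are sent to D by the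
    inverse of the endomorphism, and the required isomorphism is then the identity. With l = 0 the
    scalars still have to come from the fraction field of the polynomials in no variables, hence a
    change of scalars.

    That the denominators of the parametrizations are nonzero is checked by evaluation at one point.
    For n = 5 its coordinates are the roots of a fixed quintic, which split off because F is
    algebraically closed. *)

(** * Monomials in commuting elements and degree bounds *)

Section CommutingMonomials.
Variables (A : nzRingType) (n : nat) (z : 'I_n -> A).
Hypothesis zC : forall i k, z i * z k = z k * z i.

Lemma mmap1_commr a m : (forall i, a * z i = z i * a) -> a * mmap1 z m = mmap1 z m * a.
Proof.
move=> h; rewrite /mmap1; elim/big_rec: _ => [|i u _ IH]; first by rewrite mulr1 mul1r.
rewrite mulrA; have -> : a * z i ^+ m i = z i ^+ m i * a.
  by apply: commrX; apply: h.
by rewrite -!mulrA IH.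
Qed.

Lemma mmap1D m1 m2 : mmap1 z (m1 + m2) = mmap1 z m1 * mmap1 z m2.
Proof.
rewrite /mmap1 (eq_bigr (fun i => z i ^+ m1 i * z i ^+ m2 i)); last first.
  by move=> i _; rewrite mnmDE exprD.
have cX i k a b : z i ^+ a * z k ^+ b = z k ^+ b * z i ^+ a.
  by apply: commrX; apply/commr_sym/commrX.
have cP (r : seq 'I_n) i a : (\prod_(k <- r) z k ^+ m1 k) * z i ^+ a
   = z i ^+ a * \prod_(k <- r) z k ^+ m1 k.
  elim: r => [|k r IH]; first by rewrite big_nil mulr1 mul1r.
  by rewrite big_cons -mulrA IH !mulrA cX.
elim: (index_enum _) => [|i r IH]; first by rewrite !big_nil mulr1.
by rewrite !big_cons IH -!mulrA; congr (_ * _); rewrite !mulrA cP.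
Qed.

Lemma mmap1S i m : mmap1 z (U_(i) + m) = z i * mmap1 z m.
Proof. by rewrite mmap1D mmap1U. Qed.

End CommutingMonomials.

Lemma mnm_ind n (P : 'X_{1..n} -> Prop) :
  P 0%MM -> (forall i m, P m -> P (U_(i) + m)%MM) -> forall m, P m.
Proof.
move=> P0 PS m; move: {2}(mdeg m) (erefl (mdeg m)) => d.
elim: d m => [|d IH] m dm; first by move/eqP: dm; rewrite mdeg_eq0 => /eqP ->.
have [i mi] : exists i, m i != 0%N.
  apply/existsP; apply: contra_eqT dm => /existsPn h.
  have -> : m = 0%MM by apply/mnmP => i; move/negPn/eqP: (h i); rewrite mnm0E.
  by rewrite mdeg0.
have e : m = (U_(i) + (m - U_(i)))%MM by rewrite addmC submK // lep1mP.
by rewrite e; apply/PS/IH; move: dm; rewrite {1}e mdegD mdeg1 => -[].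
Qed.

(** Since [msize] is the degree plus one and vanishes at zero, [msize P <= a.+1] bounds the degree
    by [a] and also covers [P = 0]. *)
Lemma msizeM_bound n (R : nzRingType) (P Q : {mpoly R[n]}) a b :
  (msize P <= a.+1)%N -> (msize Q <= b.+1)%N -> (msize (P * Q) <= (a + b).+1)%N.
Proof.
move=> sP sQ; have [->|nP] := eqVneq P 0; first by rewrite mul0r msize0.
have [->|nQ] := eqVneq Q 0; first by rewrite mulr0 msize0.
have [->|nPQ] := eqVneq (P * Q) 0; first by rewrite msize0.
move: sP sQ; rewrite -!mlead_deg // !ltnS => sP sQ.
have /lemc_mdeg := mleadM_le P Q; rewrite mdegD => /leq_trans; apply.
exact: leq_add.
Qed.

Lemma msizeD_bound n (R : nzRingType) (P Q : {mpoly R[n]}) a :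
  (msize P <= a)%N -> (msize Q <= a)%N -> (msize (P + Q) <= a)%N.
Proof. by move=> sP sQ; apply: leq_trans (msizeD_le _ _) _; rewrite geq_max sP. Qed.

Lemma msize_sum_bound n (R : nzRingType) (I : eqType) (r : seq I) (F : I -> {mpoly R[n]}) a :
  (forall i, i \in r -> (msize (F i) <= a)%N) -> (msize (\sum_(i <- r) F i) <= a)%N.
Proof.
move=> h; rewrite big_seq; elim/big_rec: _ => [|i P ir sP]; first by rewrite msize0.
by apply: msizeD_bound => //; apply: h.
Qed.

(** Carries degree bounds through the induction [mpolyind]: a monomial outside the support of [P]
    cannot be cancelled. *)
Lemma msize_monoD n (R : nzRingType) (c : R) m (P : {mpoly R[n]}) a :
  m \notin msupp P -> c != 0 -> (msize (c *: 'X_[m] + P) <= a.+1)%N ->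
  (mdeg m <= a)%N /\ (msize P <= a.+1)%N.
Proof.
move=> mP nc sP.
have sm : (mdeg m <= a)%N.
  have : m \in msupp (c *: 'X_[m] + P).
    by rewrite mcoeff_msupp mcoeffD mcoeffZ mcoeffX eqxx mulr1 (memN_msupp_eq0 mP) addr0.
  by move/msize_mdeg_lt => /leq_trans/(_ sP).
have sP' : (msize P <= a.+1)%N.
  have -> : P = (c *: 'X_[m] + P) - c *: 'X_[m] by rewrite addrAC subrr add0r.
  apply: msizeD_bound => //; rewrite msizeN; apply: leq_trans (msizeZ_le _ _) _.
  by rewrite msizeX.
by [].
Qed.

(** * Normally ordered differential operators *)

(* [mmap j z P] is the operator [\sum_m j P@_m * z^m] with its coefficients on the left. *)
Section DiffOps.
Variables (R0 : comNzRingType) (A : nzRingType) (n : nat).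
Variables (j : {rmorphism R0 -> A}) (z : 'I_n -> A) (D : 'I_n -> R0 -> R0).
Hypothesis zC : forall i k, z i * z k = z k * z i.
Hypothesis zD : forall i q, z i * j q = j q * z i + j (D i q).
Local Notation op := (mmap j z).

(** The term by which [z i] fails to act on symbols as multiplication by ['X_i]; it does not raise
    the order. *)
Definition dcoef i (P : {mpoly R0[n]}) : {mpoly R0[n]} :=
  \sum_(m <- msupp P) D i P@_m *: 'X_[m].

Lemma msize_dcoef i P : (msize (dcoef i P) <= msize P)%N.
Proof.
apply: msize_sum_bound => m mP; apply: leq_trans (msizeZ_le _ _) _.
by rewrite msizeX; apply: msize_mdeg_lt.
Qed.

Lemma op_mulz i P : z i * op P = op ('X_i * P + dcoef i P).
Proof.
have -> : 'X_i * P = \sum_(m <- msupp P) 'X_i * (P@_m *: 'X_[m]).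
  by rewrite -mulr_sumr -mpolyE.
rewrite /dcoef raddfD /= !raddf_sum /= -big_split /=.
rewrite {1}/mmap mulr_sumr; apply: eq_bigr => m _.
rewrite -scalerAr -mpolyXD !mmapZ !mmapX mmap1S // mulrA zD mulrDl; congr (_ + _).
by rewrite -!mulrA.
Qed.

Lemma op_mulj q P : j q * op P = op (q *: P).
Proof. by rewrite mmapZ. Qed.

(** The bound on [R] has no successor on purpose: the remainder has order strictly below
    [mdeg m + b]. *)
Lemma op_mono_lead m Q b : (msize Q <= b.+1)%N ->
  exists2 R, mmap1 z m * op Q = op ('X_[m] * Q + R) & (msize R <= mdeg m + b)%N.
Proof.
move=> sQ; elim/mnm_ind: m => [|i m [R eR sR]].
  by exists 0; rewrite ?msize0 // mmap11 mpolyX0 !mul1r addr0.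
exists ('X_i * R + dcoef i ('X_[m] * Q + R)).
  rewrite mmap1S // -mulrA eR op_mulz; congr (mmap _ _ _).
  by rewrite mulrDr mulrA -mpolyXD -addrA.
have s2 : (msize ('X_[m] * Q) <= (mdeg m + b).+1)%N.
  by apply: msizeM_bound => //; rewrite msizeX.
rewrite mdegD mdeg1 add1n addSn; apply: msizeD_bound.
  (* The predecessor is sound only for positive order; in order zero the bound forces [R = 0]. *)
  have := @msizeM_bound _ _ 'X_i R 1 (mdeg m + b).-1; rewrite msizeX mdeg1 => /(_ isT).
  case: (mdeg m + b)%N sR => [|k] /= sR; last by move=> /(_ sR).
  by move: sR; rewrite leqn0 msize_poly_eq0 => /eqP ->; rewrite mulr0 msize0.
apply: leq_trans (msize_dcoef _ _) _; apply: msizeD_bound => //.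
exact: leq_trans sR _.
Qed.

(* Composition of operators is multiplication of their symbols up to lower order. *)
Lemma op_lead P Q a b : (msize P <= a.+1)%N -> (msize Q <= b.+1)%N ->
  exists2 R, op P * op Q = op (P * Q + R) & (msize R <= a + b)%N.
Proof.
elim/mpolyind: P => [|c m P mP nc IH] sP sQ.
  by exists 0; rewrite ?msize0 // mul0r raddf0 addr0 mul0r raddf0.
have [sm sP'] := msize_monoD mP nc sP.
have [R1 e1 s1] := IH sP' sQ; have [R2 e2 s2] := op_mono_lead m sQ.
exists (R1 + c *: R2).
  rewrite raddfD /= !mulrDl e1 mmapZ mmapX -mulrA e2 op_mulj -raddfD /=; congr (mmap _ _ _).
  by rewrite scalerDr -scalerAl addrACA [_ + R1]addrC addrACA.
apply: msizeD_bound => //; apply: leq_trans (msizeZ_le _ _) _.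
by apply: leq_trans s2 _; rewrite leq_add2r.
Qed.

Section LinearChange.
Variable ell : n.-tuple {mpoly R0[n]}.
Hypothesis ell_lin : forall i, (msize (tnth ell i) <= 2)%N.
Let w i := op (tnth ell i).
Hypothesis wC : forall i k, w i * w k = w k * w i.

Lemma msize_comp_lin P a : (msize P <= a)%N -> (msize (P \mPo ell) <= a)%N.
Proof.
move=> sP; rewrite comp_mpolyEX; apply: msize_sum_bound => m mP.
apply: leq_trans (msizeZ_le _ _) _.
apply: leq_trans (leq_trans (msize_mdeg_lt mP) sP) => {mP}.
elim/mnm_ind: m => [|i m IH]; first by rewrite mpolyX0 comp_mpoly1 msize1.
rewrite mpolyXD rmorphM /= mdegD mdeg1 comp_mpolyXU -tnth_nth.
by apply: msizeM_bound.
Qed.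

(* A linear change of the [z_i] acts on symbols by substitution, up to lower order; unlike
   arguments by commutators this also gives freeness in characteristic p. *)
Lemma op_comp_lead P a : (msize P <= a.+1)%N ->
  exists2 R, mmap j w P = op (P \mPo ell + R) & (msize R <= a)%N.
Proof.
have mono m : exists2 R, mmap1 w m = op ('X_[m] \mPo ell + R) & (msize R <= mdeg m)%N.
  elim/mnm_ind: m => [|i m [R eR sR]].
    by exists 0; rewrite ?msize0 // mmap11 mpolyX0 comp_mpoly1 addr0 -mpolyC1 mmapC /= rmorph1.
  have sm : (msize ('X_[m] \mPo ell) <= (mdeg m).+1)%N.
    by apply: msize_comp_lin; rewrite msizeX.
  have [|R' e' s'] := @op_lead (tnth ell i) ('X_[m] \mPo ell + R) 1 (mdeg m) (ell_lin i).
    by apply: msizeD_bound => //; apply: leq_trans sR _.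
  exists (tnth ell i * R + R').
    rewrite mmap1S // eR e'; congr (mmap _ _ _).
    by rewrite mulrDr mpolyXD rmorphM /= comp_mpolyXU -tnth_nth addrA.
  rewrite mdegD mdeg1; apply: msizeD_bound => //.
  case: (mdeg m) sR => [|k] sR; last exact: (@msizeM_bound _ _ _ _ 1).
  by move: sR; rewrite leqn0 msize_poly_eq0 => /eqP ->; rewrite mulr0 msize0.
elim/mpolyind: P => [|c m P mP nc IH] sP.
  by exists 0; rewrite ?msize0 // comp_mpoly0 addr0 !raddf0.
have [sm sP'] := msize_monoD mP nc sP.
have [R1 e1 s1] := IH sP'; have [R2 e2 s2] := mono m.
exists (R1 + c *: R2).
  rewrite raddfD /= e1 mmapZ mmapX e2 op_mulj -raddfD /=; congr (mmap _ _ _).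
  rewrite comp_mpolyD comp_mpolyZ scalerDr.
  by rewrite addrACA [_ + R1]addrC addrACA.
apply: msizeD_bound => //; apply: leq_trans (msizeZ_le _ _) _.
exact: leq_trans s2 _.
Qed.

End LinearChange.
End DiffOps.

(** * Ring morphisms out of polynomial rings *)

Lemma rmorphism_of (R S : nzRingType) (f : R -> S) :
  (forall a b, f (a + b) = f a + f b) -> f 1 = 1 ->
  (forall a b, f (a * b) = f a * f b) ->
  exists g : {rmorphism R -> S}, forall a, g a = f a.
Proof.
move=> fD f1 fM.
have f0 : f 0 = 0 by apply: (addrI (f 0)); rewrite -fD !addr0.
have fB : additive f.
  by move=> a b /=; apply/eqP; rewrite eq_sym subr_eq -fD subrK.
pose m1 := GRing.isZmodMorphism.Build R S f fB.
pose m2 := GRing.isMonoidMorphism.Build R S f (f1, fM).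
pose g : {rmorphism R -> S} := HB.pack f m1 m2.
by exists g.
Qed.

(** Serves both for the [x i], giving the polynomial subring of [W], and for the p-th powers of all
    generators, giving a central subring. *)
Lemma ceval_ex (R : comNzRingType) (A : nzRingType) n (f : {rmorphism R -> A})
    (h : 'I_n -> A) :
  (forall i k, h i * h k = h k * h i) -> (forall c i, h i * f c = f c * h i) ->
  exists g : {rmorphism {mpoly R[n]} -> A}, forall P, g P = mmap f h P.
Proof.
move=> hC fC; apply: rmorphism_of => [P Q||P Q]; first exact: raddfD.
  by rewrite -mpolyC1 mmapC /= rmorph1.
have cm c m : mmap1 h m * f c = f c * mmap1 h m.
  by apply/esym/mmap1_commr => i; rewrite fC.
elim/mpolyind: P => [|c m P _ _ IH]; first by rewrite mul0r !raddf0 mul0r.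
rewrite mulrDl !raddfD /= mulrDl IH; congr (_ + _).
elim/mpolyind: Q {IH} => [|d k Q _ _ IH]; first by rewrite mulr0 !raddf0 mulr0.
rewrite mulrDr !raddfD /= mulrDr IH; congr (_ + _).
rewrite -scalerAl -scalerAr scalerA -mpolyXD !mmapZ !mmapX mmap1D // rmorphM.
by rewrite -!mulrA; congr (_ * _); rewrite !mulrA cm.
Qed.

Section WeylRelation.
Variables (F : comNzRingType) (n : nat) (A : nzRingType).
Variables (g : {rmorphism {mpoly F[n]} -> A}) (i : 'I_n) (w : A).
Hypothesis wC : forall c, w * g c%:MP = g c%:MP * w.
Hypothesis wX : forall k, w * g 'X_k = g 'X_k * w + (i == k)%:R.

(** Both sides obey the Leibniz rule in [q], so constants and variables decide. *)
Lemma weyl_commutator q : w * g q = g q * w + g q^`M(i).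
Proof.
elim/mpolyind: q => [|c m q _ _ IH]; first by rewrite mderiv0 !raddf0 mulr0 mul0r addr0.
rewrite mderivD !raddfD /= mulrDr mulrDl IH addrACA; congr (_ + _).
rewrite mderivZ -!mul_mpolyC !rmorphM /= mulrA wC -!mulrA -mulrDr; congr (_ * _).
elim/mnm_ind: m {c} => [|k m IHm].
  by rewrite mpolyX0 rmorph1 -mpolyC1 mderivC raddf0 mulr1 mul1r addr0.
rewrite mpolyXD mderivM rmorphD !rmorphM /= mulrA wX mulrDl -mulrA IHm mulrDr.
rewrite -!addrA -mulrA; congr (_ + _); rewrite addrC; congr (_ + _).
rewrite mderivX mnm1E eq_sym; case: eqVneq => [->|_]; last by rewrite mulr0n scale0r raddf0.
have -> : (U_(i) - U_(i) = 0 :> 'X_{1..n})%MM by apply/mnmP => l; rewrite mnmBE subnn mnm0E.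
by rewrite mpolyX0 mulr1n scale1r rmorph1.
Qed.
End WeylRelation.

(** * Rings of differential operators with unique normal forms *)

Section DiffOpsBasis.
Variables (R0 : idomainType) (W : nzRingType) (n : nat).
Variables (j : {rmorphism R0 -> W}) (z : 'I_n -> W) (D : 'I_n -> R0 -> R0).
Hypothesis zC : forall i k, z i * z k = z k * z i.
Hypothesis zD : forall i q, z i * j q = j q * z i + j (D i q).
Local Notation op := (mmap j z).
Hypothesis opI : forall P, op P = 0 -> P = 0.

Lemma op_inj : injective op.
Proof. by move=> P Q e; apply/eqP; rewrite -subr_eq0; apply/eqP/opI; rewrite raddfB /= e subrr. Qed.

Hypothesis opS : forall w, exists P, op P = w.

(** Symbols live in a domain, and a remainder of lower order cannot cancel the top part of the
    product of two symbols. *)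
Lemma diffop_domain (a b : W) : a * b = 0 -> a = 0 \/ b = 0.
Proof.
have [P <-] := opS a; have [Q <-] := opS b.
have [->|nP] := eqVneq P 0; first by rewrite raddf0; left.
have [->|nQ] := eqVneq Q 0; first by rewrite raddf0; right.
move: (nP) (nQ); rewrite -msize_poly_eq0 -(msize_poly_eq0 Q) => sP sQ.
have [||R -> sR] := @op_lead _ _ _ j z D zC zD P Q (msize P).-1 (msize Q).-1.
- by rewrite prednK // lt0n.
- by rewrite prednK // lt0n.
move/opI/eqP; rewrite addr_eq0 => /eqP e.
have := msizeM nP nQ; rewrite e msizeN => e2; move: sR sP sQ; rewrite e2 -!lt0n; lia.
Qed.

Lemma diffop_morph_eq (E : nzRingType) (u v : {rmorphism W -> E}) :
  (forall q, u (j q) = v (j q)) -> (forall i, u (z i) = v (z i)) -> forall w, u w = v w.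
Proof.
move=> ej ez w; have [P <-] := opS w; rewrite /mmap !rmorph_sum; apply: eq_bigr => m _.
rewrite !rmorphM ej /mmap1 !rmorph_prod; congr (_ * _).
by apply: eq_bigr => i _; rewrite !rmorphXn ez.
Qed.

Variables (A : nzRingType) (j' : {rmorphism R0 -> A}) (z' : 'I_n -> A).
Hypothesis zC' : forall i k, z' i * z' k = z' k * z' i.
Hypothesis zD' : forall i q, z' i * j' q = j' q * z' i + j' (D i q).

(** The map is defined on normal forms. For multiplicativity, left multiplication by [j q] and by
    [z i] suffices, and [op_mulz] describes it by the same formula on both sides. *)
Lemma diffop_hom : exists psi : {rmorphism W -> A},
  [/\ forall P, psi (op P) = mmap j' z' P, forall q, psi (j q) = j' q & forall i, psi (z i) = z' i].
Proof.
have ex w : exists P, op P == w by have [P <-] := opS w; exists P.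
pose inv w := xchoose (ex w).
have invE w : op (inv w) = w by apply/eqP; apply: (xchooseP (ex w)).
pose psi w := mmap j' z' (inv w).
have psiE P : psi (op P) = mmap j' z' P by congr (mmap _ _ _); apply: op_inj; rewrite invE.
have psiD a b : psi (a + b) = psi a + psi b.
  by have [P <-] := opS a; have [Q <-] := opS b; rewrite -raddfD !psiE raddfD.
have psij q : psi (j q) = j' q.
  by have := psiE q%:MP; rewrite !mmapC.
have psiz i : psi (z i) = z' i by have := psiE 'X_i; rewrite !mmapX !mmap1U.
have psijM q b : psi (j q * b) = j' q * psi b.
  by have [Q <-] := opS b; rewrite op_mulj !psiE mmapZ.
have psizM i b : psi (z i * b) = z' i * psi b.
  have [Q <-] := opS b.
  by rewrite (op_mulz zC zD) !psiE (op_mulz zC' zD').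
have psiM a b : psi (a * b) = psi a * psi b.
  have [P <-] := opS a; elim/mpolyind: P => [|c m P _ _ IH].
    by rewrite raddf0 mul0r -(raddf0 (mmap j z)) psiE !raddf0 mul0r.
  rewrite raddfD /= mulrDl !psiD IH mulrDl; congr (_ + _).
  rewrite mmapZ mmapX -mulrA !psijM -mulrA; congr (_ * _).
  elim/mnm_ind: m => [|i m IHm]; last by rewrite mmap1S // -mulrA !psizM IHm mulrA.
  by rewrite mmap11 mul1r -(rmorph1 j) psij rmorph1 mul1r.
have psi1 : psi 1 = 1 by rewrite -(rmorph1 j) psij rmorph1.
have [g gE] := rmorphism_of psiD psi1 psiM.
by exists g; split=> *; rewrite gE.
Qed.
End DiffOpsBasis.

(** * The Weyl algebra as a ring of differential operators *)

Section Weyl.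
Variables (F : fieldType) (n : nat) (W : algType F) (x y : 'I_n -> W).
Hypothesis HW : is_weyl x y.

Definition ffun_of_mnm (m : 'X_{1..n}) : {ffun 'I_n -> nat} := [ffun i => m i].
Definition mnm_of_ffun (f : {ffun 'I_n -> nat}) : 'X_{1..n} := [multinom f i | i < n].

Lemma ffun_of_mnmK : cancel ffun_of_mnm mnm_of_ffun.
Proof. by move=> m; apply/mnmP => i; rewrite mnmE ffunE. Qed.

Lemma weyl_monoE a b : weyl_mono x y (ffun_of_mnm a, ffun_of_mnm b) = mmap1 x a * mmap1 y b.
Proof.
by rewrite /weyl_mono /mmap1 /=; congr (_ * _); apply: eq_bigr => i _; rewrite ffunE.
Qed.

Lemma weyl_scalar_comm (c : F) (w : W) : w * c%:A = c%:A * w.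
Proof. by rewrite -scalerAr mulr1 -scalerAl mul1r. Qed.

(** Collecting the PBW monomials by their exponent in [y] turns the basis into normal forms whose
    coefficients are polynomials in [x]. *)
Lemma weyl_diffop : exists j : {rmorphism {mpoly F[n]} -> W},
  [/\ forall c, j c%:MP = c%:A, forall i, j 'X_i = x i,
      forall i q, y i * j q = j q * y i + j q^`M(i),
      forall P, mmap j y P = 0 -> P = 0 & forall w, exists P, mmap j y P = w].
Proof.
have [xC yC yx span indep] := HW.
have [j jE] := ceval_ex (f := in_alg W) xC (fun c i => weyl_scalar_comm c (x i)).
have jC c : j c%:MP = c%:A by rewrite jE mmapC.
have jX i : j 'X_i = x i by rewrite jE mmapX mmap1U.
have jM m : j 'X_[m] = mmap1 x m by rewrite jE mmapX.
exists j; split => //.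
- move=> i; apply: weyl_commutator => [c|k]; first by rewrite jC weyl_scalar_comm.
  by rewrite jX -yx addrC subrK.
- move=> P P0.
  pose s := [seq (ffun_of_mnm k, ffun_of_mnm m) | m <- msupp P, k <- msupp P@_m].
  pose c (ab : {ffun 'I_n -> nat} * {ffun 'I_n -> nat}) : F :=
    (P@_(mnm_of_ffun ab.2))@_(mnm_of_ffun ab.1).
  have us : uniq s.
    apply: allpairs_uniq_dep => [|m _|]; rewrite ?msupp_uniq //.
    move=> [m k] [m' k'] _ _ [] /(congr1 mnm_of_ffun); rewrite !ffun_of_mnmK => <-.
    by move/(congr1 mnm_of_ffun); rewrite !ffun_of_mnmK => <-.
  have sE : \sum_(ab <- s) c ab *: weyl_mono x y ab = 0.
    rewrite /s big_allpairs_dep /= -[RHS]P0 /mmap; apply: eq_bigr => m _.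
    rewrite {2}(mpolyE P@_m) raddf_sum mulr_suml; apply: eq_bigr => k _ /=.
    rewrite /c /= !ffun_of_mnmK weyl_monoE -mul_mpolyC rmorphM /= jC jM.
    by rewrite mulr_algl scalerAl.
  have c0 := indep s c us sE.
  apply/mpolyP => m; rewrite mcoeff0; apply/mpolyP => k; rewrite mcoeff0.
  have [mP|/memN_msupp_eq0 ->] := boolP (m \in msupp P); last by rewrite mcoeff0.
  have [kP|/memN_msupp_eq0 -> //] := boolP (k \in msupp P@_m).
  have := c0 (ffun_of_mnm k, ffun_of_mnm m); rewrite /c /= !ffun_of_mnmK; apply.
  by apply/allpairsPdep; exists m, k.
move=> w; have [s [c ->]] := span w; elim: s => [|ab s [P eP]].
  by exists 0; rewrite big_nil raddf0.
exists (((c ab)%:MP * 'X_[mnm_of_ffun ab.1]) *: 'X_[mnm_of_ffun ab.2] + P).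
rewrite raddfD /= eP big_cons; congr (_ + _).
rewrite mmapZ mmapX rmorphM /= jC jM mulr_algl -scalerAl; congr (_ *: _).
by rewrite /mmap1 /weyl_mono; congr (_ * _); apply: eq_bigr => i _; rewrite mnmE.
Qed.
End Weyl.

(** * Localization at central elements *)

Section CentralLocalization.
Local Open Scope quotient_scope.
Variables (R : nzRingType) (Z : idomainType) (ze : {rmorphism Z -> R}).
Hypothesis zeC : forall z r, ze z * r = r * ze z.
Hypothesis zeI : forall z r, ze z * r = 0 -> z != 0 -> r = 0.
Hypothesis zeD : forall r : R, r != 0 -> exists (u : R) (z : Z), [/\ z != 0, r * u = ze z & u * r = ze z].

Let zeCA z (r s : R) : r * (ze z * s) = ze z * (r * s).
Proof. by rewrite !mulrA zeC. Qed.
Let zeCZ z z' (r : R) : ze z * (ze z' * r) = ze z' * (ze z * r).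
Proof. by rewrite zeCA. Qed.

(** Central denominators allow the construction of commutative fractions: pairs up to
    cross-multiplication. *)
Definition loc_pair := {rz : R * Z | rz.2 != 0}.
Implicit Types a b c : loc_pair.
Let nm a := (val a).1.
Let dn a := (val a).2.
Let dn0 a : dn a != 0. Proof. exact: (valP a). Qed.

Definition loc_mk (r : R) (z : Z) (h : z != 0) : loc_pair := exist _ (r, z) h.
Let nmE r z h : nm (@loc_mk r z h) = r. Proof. by []. Qed.
Let dnE r z h : dn (@loc_mk r z h) = z. Proof. by []. Qed.
Definition loc_equiv a b := ze (dn b) * nm a == ze (dn a) * nm b.

Lemma loc_equivP a b : reflect (ze (dn b) * nm a = ze (dn a) * nm b) (loc_equiv a b).
Proof. exact: eqP. Qed.

Lemma ze_cancel z (r s : R) : z != 0 -> ze z * r = ze z * s -> r = s.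
Proof.
move=> nz e; apply/eqP; rewrite -subr_eq0; apply/eqP/(@zeI z) => //.
by rewrite mulrBr e subrr.
Qed.

Lemma loc_refl : reflexive loc_equiv. Proof. by move=> a; apply/loc_equivP. Qed.
Lemma loc_sym : ssrbool.symmetric loc_equiv.
Proof. by move=> a b; apply/loc_equivP/loc_equivP => ->. Qed.
Lemma loc_trans : transitive loc_equiv.
Proof.
move=> b a c /loc_equivP e1 /loc_equivP e2; apply/loc_equivP.
apply: (ze_cancel (dn0 b)).
by rewrite zeCZ e1 zeCZ e2 zeCZ.
Qed.
Canonical loc_equivalence := EquivRel loc_equiv loc_refl loc_sym loc_trans.
Definition loc := {eq_quot loc_equiv}.
HB.instance Definition _ := EqQuotient.on loc.
HB.instance Definition _ := Choice.on loc.

Let piP a b : (\pi_loc a = \pi_loc b) <-> ze (dn b) * nm a = ze (dn a) * nm b.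
Proof.
split=> [/eqmodP|] h; first by apply/loc_equivP.
by apply/eqmodP; apply/loc_equivP.
Qed.

Definition loc_addp a b : loc_pair :=
  loc_mk (ze (dn b) * nm a + ze (dn a) * nm b) (mulf_neq0 (dn0 a) (dn0 b)).
Definition loc_mulp a b : loc_pair := loc_mk (nm a * nm b) (mulf_neq0 (dn0 a) (dn0 b)).
Definition loc_oppp a : loc_pair := loc_mk (- nm a) (dn0 a).
Definition loc_inp (r : R) : loc_pair := loc_mk r (oner_neq0 Z).

Definition loc_add (u v : loc) : loc := \pi_loc (loc_addp (repr u) (repr v)).
Definition loc_mul (u v : loc) : loc := \pi_loc (loc_mulp (repr u) (repr v)).
Definition loc_opp (u : loc) : loc := \pi_loc (loc_oppp (repr u)).
Definition loc_in (r : R) : loc := \pi_loc (loc_inp r).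

Let reprE a : ze (dn a) * nm (repr (\pi_loc a)) = ze (dn (repr (\pi_loc a))) * nm a.
Proof. by apply/piP; rewrite reprK. Qed.

Let ze_swap d1 d2 e1 e2 (r : R) : d1 * d2 = e1 * e2 ->
  ze d1 * (ze d2 * r) = ze e1 * (ze e2 * r).
Proof. by move=> e; rewrite !mulrA -!rmorphM e. Qed.

Lemma pi_loc_add a b : loc_add (\pi_loc a) (\pi_loc b) = \pi_loc (loc_addp a b).
Proof.
apply/piP; have ea := reprE a; have eb := reprE b.
rewrite /loc_add /loc_addp !nmE !dnE !mulrDr; congr (_ + _).
  rewrite (@ze_swap _ _ (dn b * dn (repr (\pi_loc b))) (dn a)); last by ring.
  by rewrite ea; apply: ze_swap; ring.
rewrite (@ze_swap _ _ (dn a * dn (repr (\pi_loc a))) (dn b)); last by ring.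
by rewrite eb; apply: ze_swap; ring.
Qed.

Lemma pi_loc_mul a b : loc_mul (\pi_loc a) (\pi_loc b) = \pi_loc (loc_mulp a b).
Proof.
apply/piP; have ea := reprE a; have eb := reprE b.
rewrite /loc_mulp !nmE !dnE !rmorphM.
rewrite -!mulrA -[ze (dn b) * _]zeCA eb mulrA ea -mulrA.
by rewrite -[ze (dn (repr (\pi_loc b))) * (_ * _)]zeCA.
Qed.

Lemma pi_loc_opp a : loc_opp (\pi_loc a) = \pi_loc (loc_oppp a).
Proof.
by apply/piP; rewrite /= /nm /dn /= !mulrN; congr (- _); apply: reprE.
Qed.

Let pi_loc := (pi_loc_add, pi_loc_mul, pi_loc_opp).
Let nm_add a b : nm (loc_addp a b) = ze (dn b) * nm a + ze (dn a) * nm b. Proof. by []. Qed.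
Let dn_add a b : dn (loc_addp a b) = dn a * dn b. Proof. by []. Qed.
Let nm_mul a b : nm (loc_mulp a b) = nm a * nm b. Proof. by []. Qed.
Let dn_mul a b : dn (loc_mulp a b) = dn a * dn b. Proof. by []. Qed.
Let nm_opp a : nm (loc_oppp a) = - nm a. Proof. by []. Qed.
Let dn_opp a : dn (loc_oppp a) = dn a. Proof. by []. Qed.
Let nm_in r : nm (loc_inp r) = r. Proof. by []. Qed.
Let dn_in r : dn (loc_inp r) = 1. Proof. by []. Qed.
Let locE := (nm_add, dn_add, nm_mul, dn_mul, nm_opp, dn_opp, nm_in, dn_in, nmE, dnE).

Lemma loc_addA : associative loc_add.
Proof.
elim/quotW=> a; elim/quotW=> b; elim/quotW=> c; rewrite (pi_loc_add b c) (pi_loc_add a b) (pi_loc_add a) (pi_loc_add _ c); apply/piP.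
rewrite !locE [dn a * (_ * _)]mulrA; congr (_ * _).
rewrite !mulrDr !rmorphM -!mulrA addrA; congr (_ + _ + _); first exact: zeCZ.
exact: zeCZ.
Qed.

Lemma loc_addC : commutative loc_add.
Proof.
elim/quotW=> a; elim/quotW=> b; rewrite (pi_loc_add a b) (pi_loc_add b a); apply/piP.
by rewrite !locE mulrC addrC.
Qed.

Lemma loc_add0 : left_id (loc_in 0) loc_add.
Proof.
elim/quotW=> a; rewrite /loc_in pi_loc; apply/piP.
by rewrite !locE mulr0 add0r rmorph1 !mul1r.
Qed.

Lemma loc_addN : left_inverse (loc_in 0) loc_opp loc_add.
Proof.
elim/quotW=> a; rewrite /loc_in pi_loc_opp pi_loc_add; apply/piP.
by rewrite !locE mulrN addNr !mulr0.
Qed.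

HB.instance Definition _ := GRing.isZmodule.Build loc loc_addA loc_addC loc_add0 loc_addN.

Lemma loc_mulA : associative loc_mul.
Proof.
elim/quotW=> a; elim/quotW=> b; elim/quotW=> c; rewrite (pi_loc_mul b c) (pi_loc_mul a b) (pi_loc_mul a) (pi_loc_mul _ c); apply/piP.
by rewrite !locE !mulrA.
Qed.
Lemma loc_mul1l : left_id (loc_in 1) loc_mul.
Proof.
elim/quotW=> a; rewrite /loc_in pi_loc; apply/piP.
by rewrite !locE !mul1r.
Qed.
Lemma loc_mul1r : right_id (loc_in 1) loc_mul.
Proof.
elim/quotW=> a; rewrite /loc_in pi_loc; apply/piP.
by rewrite !locE !mulr1.
Qed.
Lemma loc_mulDl : left_distributive loc_mul loc_add.
Proof.
elim/quotW=> a; elim/quotW=> b; elim/quotW=> c; rewrite (pi_loc_add a b) (pi_loc_mul a c) (pi_loc_mul b c) (pi_loc_mul _ c) (pi_loc_add (loc_mulp a c)); apply/piP.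
rewrite !locE !rmorphM mulrDl !mulrDr; congr (_ + _);
  rewrite !mulrA -!rmorphM; congr (ze _ * _ * _); ring.
Qed.
Lemma loc_mulDr : right_distributive loc_mul loc_add.
Proof.
elim/quotW=> a; elim/quotW=> b; elim/quotW=> c; rewrite (pi_loc_add b c) (pi_loc_mul a b) (pi_loc_mul a c) (pi_loc_mul a) (pi_loc_add (loc_mulp a b)); apply/piP.
rewrite !locE [nm a * (_ + _)]mulrDr ![nm a * (ze _ * _)]zeCA !mulrDr; congr (_ + _);
  rewrite !mulrA -!rmorphM; congr (ze _ * _ * _); ring.
Qed.
Lemma loc_in_inj : injective loc_in.
Proof. by move=> r s /piP; rewrite !locE rmorph1 !mul1r. Qed.
Lemma loc_nontrivial : loc_in 1 != loc_in 0.
Proof. by apply/eqP => /loc_in_inj/eqP; rewrite oner_eq0. Qed.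

HB.instance Definition _ := GRing.Zmodule_isNzRing.Build loc
  loc_mulA loc_mul1l loc_mul1r loc_mulDl loc_mulDr loc_nontrivial.

Lemma loc_inD r s : loc_in (r + s) = loc_in r + loc_in s.
Proof.
rewrite /loc_in [RHS]pi_loc; apply/piP.
by rewrite !locE mulr1 rmorph1 !mul1r.
Qed.
Lemma loc_inM r s : loc_in (r * s) = loc_in r * loc_in s.
Proof.
rewrite /loc_in [RHS]pi_loc; apply/piP.
by rewrite !locE mulr1 rmorph1 !mul1r.
Qed.

Lemma loc_fracE (r : R) z (h : z != 0) :
  \pi_loc (loc_mk r h) * loc_in (ze z) = loc_in r.
Proof.
rewrite /loc_in [LHS]pi_loc; apply/piP.
by rewrite !locE mulr1 rmorph1 mul1r zeC.
Qed.

Lemma loc_inv_ex (u : loc) : u != 0 -> exists v, (v * u == 1) && (u * v == 1).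
Proof.
elim/quotW: u => a; have nz := dn0 a; move=> na.
have [|s [z [hz e1 e2]]] := @zeD (nm a).
  apply: contraNneq na => e; apply/eqP; apply/piP.
  by rewrite /= e /nm /dn /= !mulr0.
(* If [r * s] and [s * r] are both the central element [z'], then [r / z] has inverse [z s / z']. *)
exists (\pi_loc (loc_mk (ze (dn a) * s) hz)).
apply/andP; split; apply/eqP; rewrite [LHS]pi_loc; apply/piP.
  by rewrite !locE rmorph1 mul1r mulr1 -mulrA e2 -rmorphM mulrC.
by rewrite !locE rmorph1 mul1r mulr1 zeCA e1 -rmorphM.
Qed.

Definition loc_unit : pred loc := fun u => u != 0.
(** The default value [u] makes the inverse the identity off the units, as the ring structure
    demands. *)
Definition loc_inv (u : loc) : loc :=
  if insub u is Some v then xchoose (loc_inv_ex (valP (v : {v : loc | v != 0}))) else u.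
Lemma loc_invP u : u != 0 -> loc_inv u * u = 1 /\ u * loc_inv u = 1.
Proof.
move=> nu; rewrite /loc_inv insubT /=.
by have /andP[/eqP-> /eqP->] := xchooseP (loc_inv_ex (valP (exist _ u nu : {v : loc | v != 0}))).
Qed.
Lemma loc_mulVr : {in loc_unit, left_inverse 1 loc_inv *%R}.
Proof. by move=> u /loc_invP[]. Qed.
Lemma loc_mulrV : {in loc_unit, right_inverse 1 loc_inv *%R}.
Proof. by move=> u /loc_invP[]. Qed.
Lemma loc_unitP u v : v * u = 1 /\ u * v = 1 -> u \in loc_unit.
Proof.
move=> [_ e]; rewrite unfold_in; apply: contra_eq_neq e => ->.
by rewrite mul0r eq_sym oner_neq0.
Qed.
Lemma loc_invr0 : {in [predC loc_unit], loc_inv =1 id}.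
Proof.
move=> u; rewrite inE /= negbK => /eqP ->; rewrite /loc_inv.
by case: insubP => // v; rewrite eqxx.
Qed.
HB.instance Definition _ := GRing.NzRing_hasMulInverse.Build loc
  loc_mulVr loc_mulrV loc_unitP loc_invr0.

Lemma central_localization : exists (D : unitRingType) (i : {rmorphism R -> D}),
  [/\ injective i, forall d : D, d != 0 -> d \is a GRing.unit &
      forall d, exists r z, z != 0 /\ d = i r / i (ze z)].
Proof.
have [i iE] := rmorphism_of loc_inD (erefl : loc_in 1 = 1) loc_inM.
exists loc, i; split=> //.
  by move=> r s; rewrite !iE; apply: loc_in_inj.
elim/quotW=> a; exists (nm a), (dn a); split=> //.
have nz : i (ze (dn a)) \is a GRing.unit.
  rewrite unfold_in /= /loc_unit; apply/negP => /eqP e; have : ze (dn a) * 1 = 0.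
    by rewrite mulr1; apply: loc_in_inj; rewrite -iE e.
  by move/zeI => /(_ (dn0 a))/eqP; rewrite oner_eq0.
apply: (mulIr nz); rewrite divrK // !iE -(loc_fracE (nm a) (dn0 a)).
by congr (_ * _); apply/piP.
Qed.
End CentralLocalization.

(** * Extension of morphisms to skew fields of fractions *)

Section FracExtend.
Variables (R : nzRingType) (D E : unitRingType) (i : {rmorphism R -> D}) (psi : {rmorphism R -> E}).
Hypothesis iI : injective i.
Hypothesis psiI : injective psi.
Hypothesis Du : forall d : D, d != 0 -> d \is a GRing.unit.
Hypothesis Eu : forall e : E, e != 0 -> e \is a GRing.unit.
Hypothesis Dfrac : forall d, exists a b, [/\ forall c, b * c = c * b, b != 0 & d = i a / i b].

(** In [E] the element [psi b] of a central [b] commutes only with the image of [psi]; this is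
    enough to compare, add and multiply the fractions [psi a / psi b]. *)
Lemma frac_extend : exists psib : {rmorphism D -> E}, forall r, psib (i r) = psi r.
Proof.
have nz (S : unitRingType) (f : {rmorphism R -> S}) b : injective f ->
    (forall d : S, d != 0 -> d \is a GRing.unit) -> b != 0 -> f b \is a GRing.unit.
  by move=> fI Su nb; apply: Su; rewrite -(rmorph0 f) (inj_eq fI).
have ex d : exists e : E, exists a b, [/\ forall c, b * c = c * b, b != 0, d = i a / i b & e = psi a / psi b].
  by have [a [b [h1 h2 h3]]] := Dfrac d; exists (psi a / psi b), a, b.
have wd a b a' b' : (forall c, b * c = c * b) -> (forall c, b' * c = c * b') ->
    b != 0 -> b' != 0 -> i a / i b = i a' / i b' -> psi a / psi b = psi a' / psi b'.
  move=> cb cb' nb nb' e.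
  have e2 : a * b' = a' * b.
    apply: iI; rewrite !rmorphM -(divrK (nz _ i b iI Du nb) (i a)) e -mulrA -rmorphM cb rmorphM mulrA.
    by rewrite divrK // nz.
  have e3 : psi a * psi b' = psi a' * psi b by rewrite -!rmorphM e2.
  apply: (mulIr (nz _ psi b psiI Eu nb)); rewrite divrK ?nz //.
  apply: (mulIr (nz _ psi b' psiI Eu nb')); rewrite e3 -!mulrA; congr (_ * _).
  by rewrite -[psi b * _]rmorphM cb rmorphM mulKr // nz.

have [psib psibE] : exists psib : D -> E, forall a b, (forall c, b * c = c * b) -> b != 0 ->
    psib (i a / i b) = psi a / psi b.
  have [g gP] : exists g : D -> E, forall d, exists a b, [/\ forall c, b * c = c * b, b != 0, d = i a / i b & g d = psi a / psi b].
    exact: (ClassicalEpsilon.choice (fun d e => exists a b, [/\ forall c, b * c = c * b, b != 0, d = i a / i b & e = psi a / psi b])).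
  exists g => a b cb nb; have [a' [b' [cb' nb' e ->]]] := gP (i a / i b).
  exact: wd.
have cM (b b' : R) : (forall c, b * c = c * b) -> (forall c, b' * c = c * b') ->
   forall c, (b * b') * c = c * (b * b').
  by move=> cb cb' c; rewrite -mulrA cb' mulrA cb mulrA.
have nM (b b' : R) : (forall c, b * c = c * b) -> b != 0 -> b' != 0 -> b * b' != 0.
  move=> cb nb nb'; apply: contraNneq nb => e; apply/eqP/iI.
  by apply: (mulIr (nz _ i b' iI Du nb')); rewrite -rmorphM e !rmorph0 mul0r.
have fracD (S : unitRingType) (f : {rmorphism R -> S}) a b a' b' : injective f ->
   (forall d : S, d != 0 -> d \is a GRing.unit) -> (forall c, b * c = c * b) -> (forall c, b' * c = c * b') ->
   b != 0 -> b' != 0 -> f a / f b + f a' / f b' = f (a * b' + a' * b) / f (b * b').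
  move=> fI Su cb cb' nb nb'.
  have ub := nz _ f b fI Su nb; have ub' := nz _ f b' fI Su nb'.
  apply: (mulIr (nz _ f (b * b') fI Su (nM _ _ cb nb nb'))); rewrite divrK ?nz ?nM //.
  rewrite mulrDl !rmorphD !rmorphM; congr (_ + _); first by rewrite mulrA divrK.
  by rewrite -rmorphM cb rmorphM mulrA divrK.
have fracM (S : unitRingType) (f : {rmorphism R -> S}) a b a' b' : injective f ->
   (forall d : S, d != 0 -> d \is a GRing.unit) -> (forall c, b * c = c * b) -> (forall c, b' * c = c * b') ->
   b != 0 -> b' != 0 -> (f a / f b) * (f a' / f b') = f (a * a') / f (b * b').
  move=> fI Su cb cb' nb nb'.
  have ub := nz _ f b fI Su nb; have ub' := nz _ f b' fI Su nb'.
  apply: (mulIr (nz _ f (b * b') fI Su (nM _ _ cb nb nb'))); rewrite divrK ?nz ?nM //.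
  by rewrite [b * b']cb !rmorphM -!mulrA (mulrA (f b')^-1) mulVr // mul1r -rmorphM -cb rmorphM (mulrA (f b)^-1) mulVr // mul1r.
have [|||g gE] := @rmorphism_of _ _ psib.
- move=> d d'; have [a [b [cb nb ->]]] := Dfrac d; have [a' [b' [cb' nb' ->]]] := Dfrac d'.
  by rewrite fracD // !psibE ?fracD //; [apply: cM|apply: nM].
- by have := psibE 1 1 (fun c => etrans (mul1r c) (esym (mulr1 c))) (oner_neq0 R); rewrite !rmorph1 !divr1.
- move=> d d'; have [a [b [cb nb ->]]] := Dfrac d; have [a' [b' [cb' nb' ->]]] := Dfrac d'.
  by rewrite fracM // !psibE ?fracM //; [apply: cM|apply: nM].
exists g => r; rewrite gE.
by have := psibE r 1 (fun c => etrans (mul1r c) (esym (mulr1 c))) (oner_neq0 R); rewrite !rmorph1 !divr1.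
Qed.
End FracExtend.

Local Notation "x %:F" := (tofrac x).

Lemma frac_ex (Z : idomainType) (q : {fraction Z}) :
  exists a b, b != 0 /\ q = a%:F / b%:F.
Proof.
elim/quotW: q => q; exists (\n_q), (\d_q); split; first exact: denom_ratioP.
have nd : (\d_q)%:F != 0 by rewrite tofrac_eq0 denom_ratioP.
apply: (mulIf nd); rewrite divfK //; unlock tofrac; rewrite -[LHS]FracField.pi_mul.
apply/eqmodP; rewrite /= FracField.equivfE /FracField.mulf /=.
by rewrite !numden_Ratio ?mulf_neq0 ?oner_neq0 ?denom_ratioP // !mulr1 mulrC.
Qed.

(** A matrix with more rows than columns has a kernel vector over the fraction field; multiplying by
    the product [d] of its denominators brings it back to [Z]. *)
Lemma left_kernel_ex (Z : idomainType) (N : nat) (M : 'M[Z]_(N.+1, N)) :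
  exists2 v : 'rV[Z]_N.+1, v != 0 & v *m M = 0.
Proof.
pose Mf := map_mx (@tofrac Z) M.
have /rowV0Pn[u uK nu] : kermx Mf != 0.
  rewrite kermx_eq0 /row_free neq_ltn; apply/orP; left.
  by apply: leq_ltn_trans (rank_leq_col Mf) _.
have /fin_all_exists[ab abP] : forall k : 'I_N.+1, exists ab : Z * Z, ab.2 != 0 /\ u 0 k = ab.1%:F / ab.2%:F.
  by move=> k; have [a [b [h1 h2]]] := frac_ex (u 0 k); exists (a, b).
pose d := \prod_k (ab k).2.
have nd : d != 0 by apply/prodf_neq0 => k _; have [] := abP k.
pose v : 'rV[Z]_N.+1 := \row_k ((ab k).1 * \prod_(l | l != k) (ab l).2).
have vE : map_mx (@tofrac Z) v = d%:F *: u.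
  apply/rowP => k; rewrite !mxE; have [n2 ->] := abP k.
  have -> : d = (ab k).2 * \prod_(l | l != k) (ab l).2 by rewrite /d (bigD1 k).
  have key (K : fieldType) (a b c : K) : b != 0 -> a * c = b * c * (a / b).
    by move=> nb; field.
  by rewrite !tofracM; apply: key; rewrite tofrac_eq0.
exists v.
  apply: contraNneq nu => v0; move/eqP: vE; rewrite v0 map_mx0 eq_sym scaler_eq0.
  by rewrite tofrac_eq0 (negbTE nd).
have e : map_mx (@tofrac Z) (v *m M) = 0.
  by rewrite map_mxM vE -scalemxAl; move/sub_kermxP: uK => ->; rewrite scaler0.
apply/rowP => k; rewrite [RHS]mxE; apply/eqP.
by move/rowP/(_ k)/eqP: e; rewrite [in X in X -> _]mxE [X in _ == X]mxE tofrac_eq0.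
Qed.

(** * The skew field of fractions of the Weyl algebra in characteristic p *)

Section WeylSkewField.
Variables (F : fieldType) (p n : nat) (W : algType F) (x y : 'I_n -> W).
Hypothesis HW : is_weyl x y.
Hypothesis Fp : p \in [pchar F].

Let xC i k : x i * x k = x k * x i. Proof. by have [h _ _ _ _] := HW. Qed.
Let yC i k : y i * y k = y k * y i. Proof. by have [_ h _ _ _] := HW. Qed.
Let yx i k : y i * x k = x k * y i + (i == k)%:R.
Proof. by have [_ _ h _ _] := HW; rewrite -h addrC subrK. Qed.

Lemma weyl_span (w : W) : exists s (c : 'X_{1..n} * 'X_{1..n} -> F),
  w = \sum_(ab <- s) c ab *: (mmap1 x ab.1 * mmap1 y ab.2).
Proof.
have [_ _ _ span _] := HW; have [s [c ->]] := span w.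
exists [seq (mnm_of_ffun ab.1, mnm_of_ffun ab.2) | ab <- s].
exists (fun ab => c (ffun_of_mnm ab.1, ffun_of_mnm ab.2)); rewrite big_map.
apply: eq_bigr => -[a b] _ /=; rewrite -weyl_monoE.
have K (f : {ffun 'I_n -> nat}) : ffun_of_mnm (mnm_of_ffun f) = f.
  by apply/ffunP => i; rewrite ffunE mnmE.
by rewrite !K.
Qed.

Lemma weyl_free (s : seq ('X_{1..n} * 'X_{1..n})) (c : 'X_{1..n} * 'X_{1..n} -> F) :
  uniq s -> \sum_(ab <- s) c ab *: (mmap1 x ab.1 * mmap1 y ab.2) = 0 ->
  forall ab, ab \in s -> c ab = 0.
Proof.
move=> us e ab abs; have [_ _ _ _ indep] := HW.
pose f (ab : 'X_{1..n} * 'X_{1..n}) := (ffun_of_mnm ab.1, ffun_of_mnm ab.2).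
pose g (ab : {ffun 'I_n -> nat} * {ffun 'I_n -> nat}) := (mnm_of_ffun ab.1, mnm_of_ffun ab.2).
have fK : cancel f g by move=> [a b]; rewrite /f /g /= !ffun_of_mnmK.
have := @indep (map f s) (c \o g); rewrite (map_inj_uniq (can_inj fK)) => /(_ us).
have -> : \sum_(ab <- map f s) (c \o g) ab *: weyl_mono x y ab = 0.
  by rewrite big_map -[RHS]e; apply: eq_bigr => -[a b] _; rewrite /= weyl_monoE fK.
by move=> /(_ erefl) /(_ (f ab) (map_f f abs)); rewrite /= fK.
Qed.

Lemma weyl_central c : (forall i, c * x i = x i * c) -> (forall i, c * y i = y i * c) ->
  forall w, c * w = w * c.
Proof.
move=> cx cy w; have [s [d ->]] := weyl_span w.
rewrite mulr_sumr mulr_suml; apply: eq_bigr => ab _.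
rewrite -scalerAr -scalerAl; congr (_ *: _).
by rewrite mulrA (mmap1_commr _ cx) -mulrA (mmap1_commr _ cy) mulrA.
Qed.

Let pW : p%:R = 0 :> W.
Proof. by rewrite -[1]/(1 : W) -(rmorph1 (in_alg W)) -rmorphMn (pcharf0 Fp) rmorph0. Qed.

(** At [m = 0] the truncated exponent is harmless, its coefficient being zero; at [m = p] the
    correction vanishes, so p-th powers are central. *)
Let yXx i k m : y i ^+ m * x k = x k * y i ^+ m + (m * (i == k))%:R * y i ^+ m.-1.
Proof.
elim: m => [|m IH]; first by rewrite expr0 mul1r mulr1 mul0r addr0.
rewrite exprS -mulrA IH mulrDr mulrA yx mulrDl -!mulrA -exprS -addrA; congr (_ + _).
case: eqVneq => _; last by rewrite !muln0 !mul0r mulr0 addr0.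
rewrite !muln1 mul1r /=; case: m {IH} => [|m]; first by rewrite mul0r mulr0 addr0 mul1r.
by rewrite /= !mulr_natl mulrnAr -exprS -mulrS.
Qed.

Let yxX i k m : y i * x k ^+ m = x k ^+ m * y i + (m * (i == k))%:R * x k ^+ m.-1.
Proof.
elim: m => [|m IH]; first by rewrite expr0 mul1r mulr1 mul0r addr0.
rewrite exprSr mulrA IH mulrDl -!mulrA yx mulrDr -addrA mulrA; congr (_ + _).
case: eqVneq => _; last by rewrite !muln0 !mul0r mulr0 addr0.
rewrite !muln1 mulr1 /=; case: m {IH} => [|m]; first by rewrite mul0r addr0 mul1r.
by rewrite /= !mulr_natl -exprSr -mulrS.
Qed.

Let xp_central i w : x i ^+ p * w = w * x i ^+ p.
Proof.
apply: weyl_central => k; first by apply/commr_sym/commrX/xC.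
by rewrite yxX natrM pW mul0r mul0r addr0.
Qed.
Let yp_central i w : y i ^+ p * w = w * y i ^+ p.
Proof.
apply: weyl_central => k; last by apply/commr_sym/commrX/yC.
by rewrite yXx natrM pW mul0r mul0r addr0.
Qed.

Let h (k : 'I_(n + n)) : W := match split k with inl i => x i ^+ p | inr i => y i ^+ p end.
Let hc k w : h k * w = w * h k.
Proof. by rewrite /h; case: split => i. Qed.

Let ml (m : 'X_{1..n + n}) : 'X_{1..n} := [multinom (m (lshift n i) * p)%N | i < n].
Let mr (m : 'X_{1..n + n}) : 'X_{1..n} := [multinom (m (rshift n i) * p)%N | i < n].

Let hE m : mmap1 h m = mmap1 x (ml m) * mmap1 y (mr m).
Proof.
rewrite /mmap1 big_split_ord /=; congr (_ * _); apply: eq_bigr => i _.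
  by rewrite /h (unsplitK (inl i)) mnmE mulnC exprM.
by rewrite /h (unsplitK (inr i)) mnmE mulnC exprM.
Qed.

Let p_gt0 : (0 < p)%N. Proof. exact/prime_gt0/(pcharf_prime Fp). Qed.

(** Euclidean division of all exponents by p: the quotients give a central monomial, and the
    finitely many monomials with exponents below p generate [W] over the central polynomials.
    Multiplying exponents by p is injective, hence so is [ze]. *)
Lemma weyl_pcenter : exists ze : {rmorphism {mpoly F[n + n]} -> W},
  [/\ forall z w, ze z * w = w * ze z, forall z, ze z = 0 -> z = 0 &
   exists (I : finType) (b : I -> W), forall w, exists c : I -> {mpoly F[n + n]},
     w = \sum_k ze (c k) * b k].
Proof.
have [ze zeE] := @ceval_ex _ _ _ (in_alg W) h (fun i k => hc i _) (fun c i => weyl_scalar_comm c (h i)).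
exists ze; split.
- move=> z w; rewrite zeE /mmap mulr_sumr mulr_suml; apply: eq_bigr => m _.
  rewrite -mulrA -(@mmap1_commr _ _ h w) => [|i]; last by rewrite hc.
  by rewrite !mulrA weyl_scalar_comm.
- move=> z; rewrite zeE /mmap => e.
  pose f (m : 'X_{1..n + n}) := (ml m, mr m).
  pose g (ab : 'X_{1..n} * 'X_{1..n}) : 'X_{1..n + n} :=
    [multinom (match split k with inl i => ab.1 i | inr i => ab.2 i end %/ p)%N | k < n + n].
  have fK : cancel f g.
    move=> m; apply/mnmP => k; rewrite mnmE /f /=.
    by case: splitP => i ei; rewrite mnmE mulnK //; congr (m _); apply: val_inj.
  have := @weyl_free (map f (msupp z)) (fun ab => z@_(g ab)).
  rewrite (map_inj_uniq (can_inj fK)) msupp_uniq => /(_ isT).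
  have -> : \sum_(ab <- map f (msupp z)) z@_(g ab) *: (mmap1 x ab.1 * mmap1 y ab.2) = 0.
    by rewrite big_map -[RHS]e; apply: eq_bigr => m _; rewrite fK hE /= mulr_algl.
  move=> /(_ erefl) z0; apply/mpolyP => m; rewrite mcoeff0.
  have [mz|/memN_msupp_eq0 //] := boolP (m \in msupp z).
  by have := z0 (f m) (map_f f mz); rewrite fK.
pose I := ({ffun 'I_n -> 'I_p} * {ffun 'I_n -> 'I_p})%type.
pose mm (f : {ffun 'I_n -> 'I_p}) : 'X_{1..n} := [multinom (f i : nat) | i < n].
exists I, (fun k : I => mmap1 x (mm k.1) * mmap1 y (mm k.2)) => w.
have [s [c ->]] := weyl_span w; elim: s => [|ab s [d IH]].
  by exists (fun=> 0); rewrite big_nil big1 // => k _; rewrite rmorph0 mul0r.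
pose md (m : 'X_{1..n}) : {ffun 'I_n -> 'I_p} := [ffun i => Ordinal (ltn_pmod (m i) p_gt0)].
pose q : 'X_{1..n + n} :=
  [multinom (match split k with inl i => ab.1 i | inr i => ab.2 i end %/ p)%N | k < n + n].
exists (fun k => d k + (if k == (md ab.1, md ab.2) then c ab *: 'X_[q] else 0)).
rewrite big_cons IH addrC.
under [RHS]eq_bigr => k _ do rewrite rmorphD mulrDl.
rewrite big_split /=; congr (_ + _); rewrite (bigD1 (md ab.1, md ab.2)) //= eqxx.
rewrite big1 => [|k /negbTE ->]; last by rewrite rmorph0 mul0r.
rewrite addr0 zeE mmapZ mmapX /= mulr_algl -scalerAl; congr (_ *: _).
rewrite hE -mulrA.
have ycen w' : mmap1 y (mr q) * w' = w' * mmap1 y (mr q).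
  have -> : mmap1 y (mr q) = mmap1 (fun i => y i ^+ p) [multinom q (rshift n i) | i < n].
    by apply: eq_bigr => i _; rewrite !mnmE mulnC exprM.
  by apply/esym/mmap1_commr => i; rewrite yp_central.
rewrite (mulrA (mmap1 y (mr q))) ycen -!mulrA (mulrA (mmap1 x (ml q))).
rewrite -(mmap1D xC) -(mmap1D yC).
congr (_ * _); congr mmap1; apply/mnmP => i.
  by rewrite mnmDE !mnmE (unsplitK (inl i)) ffunE /= -divn_eq.
by rewrite mnmDE !mnmE (unsplitK (inr i)) ffunE /= -divn_eq.
Qed.

Lemma weyl_domain (a b : W) : a * b = 0 -> a = 0 \/ b = 0.
Proof.
have [j [_ _ zD opI opS]] := weyl_diffop HW.
exact: (diffop_domain yC zD opI opS).
Qed.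

Lemma weyl_skew_field : exists (D : unitRingType) (i : {rmorphism W -> D}),
  [/\ injective i, forall d : D, d != 0 -> d \is a GRing.unit &
      forall d, exists a b, [/\ forall c, b * c = c * b, b != 0 & d = i a / i b]].
Proof.
have [ze [zeC zeI [I [b bS]]]] := weyl_pcenter.
have zdom z r : ze z * r = 0 -> z != 0 -> r = 0.
  by move=> /weyl_domain[/zeI -> /eqP|->].
(* A dependence between the powers of [w] over the center exhibits, after cancelling powers
   of [w], a nonzero central multiple of [w]. *)
have poly_inv d (v : nat -> {mpoly F[n + n]}) w : w != 0 ->
    \sum_(k < d) ze (v k) * w ^+ k = 0 -> (exists2 k, (k < d)%N & v k != 0) ->
    exists u z, [/\ z != 0, w * u = ze z & u * w = ze z].
  move=> nw; elim: d v => [|d IH] v; first by move=> _ [].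
  rewrite big_ord_recl expr0 mulr1 /= => e [k kd vk].
  pose u := \sum_(i < d) ze (v i.+1) * w ^+ i.
  have uw : \sum_(i < d) ze (v (bump 0 i)) * w ^+ bump 0 i = u * w.
    by rewrite mulr_suml; apply: eq_bigr => i _; rewrite -mulrA -exprSr.
  have wu : u * w = w * u.
    rewrite mulr_sumr mulr_suml; apply: eq_bigr => i _.
    by rewrite mulrA -zeC -!mulrA -exprS exprSr.
  have [v0|v0] := eqVneq (v 0%N) 0.
    move: e; rewrite v0 rmorph0 add0r uw wu => /weyl_domain[/eqP|]; first by rewrite (negbTE nw).
    move=> /(IH (v \o succn)); apply; case: k kd vk => [|k] kd vk; first by rewrite v0 eqxx in vk.
    by exists k.
  move: e; rewrite uw => /eqP; rewrite addr_eq0 => /eqP e.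
  by exists (- u), (v 0%N); split=> //; rewrite ?mulrN ?mulNr -?wu e.
have zeD w : w != 0 -> exists u z, [/\ z != 0, w * u = ze z & u * w = ze z].
  move=> nw; pose N := #|I|.
  have /fin_all_exists[c cE] : forall k : 'I_N.+1, exists c : I -> {mpoly F[n + n]}, w ^+ k = \sum_i ze (c i) * b i.
    by move=> k; apply: bS.
  (* There are more powers [w ^+ 0], ..., [w ^+ N] than generators of [W] over the central
     polynomials. *)
  have [v nv vM] := left_kernel_ex (\matrix_(k < N.+1, l < N) c k (enum_val l)).
  apply: (@poly_inv N.+1 (fun k => v 0 (inord k)) w nw).
    under eq_bigr => k _ do rewrite inord_val cE mulr_sumr.
    rewrite exchange_big big1 //= => i _.
    under eq_bigr => k _ do rewrite mulrA -rmorphM.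
    rewrite -mulr_suml -rmorph_sum; move/rowP/(_ (enum_rank i)): vM; rewrite !mxE.
    under eq_bigr => k _ do rewrite mxE enum_rankK.
    by move=> ->; rewrite rmorph0 mul0r.
  have /existsP[k vk] : [exists k, v 0 k != 0].
    apply: contraNT nv => /existsPn v0; apply/eqP/rowP => k; rewrite mxE.
    by move/negPn/eqP: (v0 k).
  by exists k => //; rewrite inord_val.
have [D [i [iI Du Df]]] := central_localization zeC zdom zeD.
exists D, i; split=> // d; have [r [z [nz ->]]] := Df d.
exists r, (ze z); split=> // ; apply: contraNneq nz => /zeI ->; exact: eqxx.
Qed.
End WeylSkewField.

(** * From generators of the invariant field to the skew field *)

Definition subfield_closed (L : fieldType) (S : L -> Prop) : Prop :=
  [/\ S 1, forall a b, S a -> S b -> S (a - b), forall a b, S a -> S b -> S (a * b) &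
      forall a, S a -> S a^-1].

Section SubfieldClosed.
Variables (L : fieldType) (S : L -> Prop).
Hypothesis HS : subfield_closed S.
Lemma subf1 : S 1. Proof. by case: HS. Qed.
Lemma subfB a b : S a -> S b -> S (a - b). Proof. by case: HS => _ h _ _; apply: h. Qed.
Lemma subf0 : S 0. Proof. by rewrite -(subrr 1); apply: subfB; apply: subf1. Qed.
Lemma subfN a : S a -> S (- a). Proof. by rewrite -[- a]add0r => h; apply: subfB => //; apply: subf0. Qed.
Lemma subfD a b : S a -> S b -> S (a + b).
Proof. by move=> ha hb; rewrite -[b]opprK; apply: subfB => //; apply: subfN. Qed.
Lemma subfM a b : S a -> S b -> S (a * b). Proof. by case: HS => _ _ h _; apply: h. Qed.
Lemma subfV a : S a -> S a^-1. Proof. by case: HS => _ _ _ h; apply: h. Qed.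
Lemma subfX a k : S a -> S (a ^+ k).
Proof. by move=> ha; elim: k => [|k IH]; rewrite ?expr0 ?exprS; [apply: subf1|apply: subfM]. Qed.
Lemma subfn k : S k%:R.
Proof. by elim: k => [|k IH]; [apply: subf0|rewrite mulrSr; apply: subfD => //; apply: subf1]. Qed.
Lemma subf_sum (I : Type) (r : seq I) (P : pred I) (E : I -> L) :
  (forall i, P i -> S (E i)) -> S (\sum_(i <- r | P i) E i).
Proof. by move=> h; elim/big_rec: _ => [|i a Pi]; [apply: subf0|apply: subfD; apply: h]. Qed.
Lemma subf_prod (I : Type) (r : seq I) (P : pred I) (E : I -> L) :
  (forall i, P i -> S (E i)) -> S (\prod_(i <- r | P i) E i).
Proof. by move=> h; elim/big_rec: _ => [|i a Pi]; [apply: subf1|apply: subfM; apply: h]. Qed.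
End SubfieldClosed.

Section Derivations.
Variable L : fieldType.
Definition derivation (e : L -> L) : Prop :=
  (forall a b, e (a + b) = e a + e b) /\ (forall a b, e (a * b) = a * e b + e a * b).

Variable e : L -> L.
Hypothesis he : derivation e.
Lemma der0 : e 0 = 0. Proof. by case: he => h _; apply: (addrI (e 0)); rewrite -h !addr0. Qed.
Lemma derN a : e (- a) = - e a.
Proof. by apply: (addrI (e a)); rewrite -(he.1) !subrr der0. Qed.
Lemma der1 : e 1 = 0.
Proof. by apply: (addrI (e 1)); rewrite addr0 -[in RHS](mulr1 1) he.2 mul1r mulr1. Qed.

Lemma derV a : e a = 0 -> e a^-1 = 0.
Proof.
have [->|na] := eqVneq a 0; first by rewrite invr0.
move=> ea; apply: (mulfI na); rewrite mulr0.
by have := der1; rewrite -(divff na) he.2 ea mul0r addr0.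
Qed.

Lemma der_kernel_subfield : subfield_closed (fun a => e a = 0).
Proof.
split; first exact: der1.
- by move=> a b ea eb; rewrite he.1 derN ea eb subrr.
- by move=> a b ea eb; rewrite he.2 ea eb mulr0 mul0r addr0.
- exact: derV.
Qed.

Lemma der_horner (P : {poly L}) a : (forall k, e P`_k = 0) -> e P.[a] = P^`().[a] * e a.
Proof.
elim/poly_ind: P => [|P c IH] eP; first by rewrite deriv0 !horner0 der0 mul0r.
have ec : e c = 0 by have := eP 0%N; rewrite coefD coefMX coefC /= add0r.
have eP' k : e P`_k = 0 by have := eP k.+1; rewrite coefD coefMX coefC /= addr0.
rewrite hornerMXaddC he.1 he.2 IH // ec addr0 derivD derivC addr0 derivM derivX mulr1.
by rewrite hornerD hornerMX mulrDl addrC; congr (_ + _); rewrite mulrAC.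
Qed.
End Derivations.

(** The subfield generated over F by the [f i], as an intersection. The subfields it is later tested
    on, such as the kernel of a derivation or the preimage of the image of a morphism, are given as
    bare predicates. *)
Definition in_gen (F : fieldType) (n : nat) (L : fieldType) (emb : {mpoly F[n]} -> L)
    (f : 'I_n -> L) (q : L) : Prop :=
  forall S : L -> Prop, subfield_closed S -> (forall c, S (emb c%:MP)) ->
  (forall i, S (f i)) -> S q.

(** * Alternating invariants of the field of rational functions *)

Section Invariants.
Variables (F : fieldType) (n : nat) (L : fieldType) (emb : {rmorphism {mpoly F[n]} -> L}).
Hypothesis embI : injective emb.
Hypothesis embF : forall q, exists a b, b != 0 /\ q = emb a / emb b.
Variable act : 'S_n -> {rmorphism L -> L}.
Hypothesis actE : forall s q, act s (emb q) = emb (msym s q).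

Definition alt_inv (q : L) : Prop := forall s, ~~ odd_perm s -> act s q = q.

Lemma rat_morph_eq (E : nzRingType) (g h : {rmorphism L -> E}) :
  (forall c, g (emb c) = h (emb c)) -> forall q, g q = h q.
Proof.
move=> e q; have [a [b [nb ->]]] := embF q.
have nB : emb b != 0 by rewrite -(rmorph0 emb) (inj_eq embI).
have hh (f : {rmorphism L -> E}) : f (emb a / emb b) * f (emb b) = f (emb a).
  by rewrite -rmorphM divfK.
have hv (f : {rmorphism L -> E}) : f (emb b) * f (emb b)^-1 = 1.
  by rewrite -rmorphM divff // rmorph1.
have e1 : g (emb a / emb b) * g (emb b) = h (emb a / emb b) * g (emb b).
  by rewrite hh !e hh.
by have := congr1 (fun t => t * g (emb b)^-1) e1; rewrite -!mulrA hv !mulr1.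
Qed.

Lemma rat_actM s t q : act (s * t)%g q = act t (act s q).
Proof.
apply: (@rat_morph_eq _ (act (s * t)%g) (act t \o act s)) => c /=.
by rewrite !actE msymMm.
Qed.

Lemma msymXi (s : 'S_n) i : msym s 'X_i = 'X_(s i) :> {mpoly F[n]}.
Proof. by rewrite /msym mmapX mmap1U. Qed.

Definition var_poly : {poly L} := \prod_(i < n) ('X - (emb 'X_i)%:P).

Lemma act_var_poly s k : act s var_poly`_k = var_poly`_k.
Proof.
rewrite -coef_map; suff -> : map_poly (act s) var_poly = var_poly by [].
rewrite /var_poly rmorph_prod /= [RHS](reindex_inj (@perm_inj _ s)) /=; apply: eq_bigr => l _.
by rewrite rmorphB /= map_polyX map_polyC /= actE msymXi.
Qed.

Variable f : 'I_n -> L.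
Hypothesis fgen : forall q, alt_inv q -> in_gen emb f q.

(* The variables are separable over the invariants: they are the simple roots of [var_poly],
   whose coefficients are invariant. *)
Lemma rat_derivation_eq0 (e : L -> L) : derivation e -> (forall c, e (emb c%:MP) = 0) ->
  (forall i, e (f i) = 0) -> forall q, e q = 0.
Proof.
move=> he ec ef q.
have eX i : e (emb 'X_i) = 0.
  pose P := var_poly.
  have eP k : e P`_k = 0.
    apply: (fgen _ (der_kernel_subfield he) ec ef).
    by move=> s _; apply: act_var_poly.
  have P0 : P.[emb 'X_i] = 0.
    by rewrite /P /var_poly (bigD1 i) //= hornerM hornerXsubC subrr mul0r.
  have := der_horner he (emb 'X_i) eP; rewrite P0 (der0 he) => /esym/eqP.
  rewrite mulf_eq0 => /orP[|/eqP //].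
  rewrite /P /var_poly (bigD1 i) //= derivM derivXsubC mul1r hornerD hornerM hornerXsubC subrr mul0r addr0.
  rewrite horner_prod prodf_seq_eq0 => /hasP[k _ /andP[ki]].
  rewrite hornerXsubC subr_eq0 (inj_eq embI) => /eqP/(congr1 (mcoeff U_(i))).
  by rewrite !mcoeffX eqxx eq_mnm1 (negbTE ki) => /eqP; rewrite oner_eq0.
have ep c : e (emb c) = 0.
  have HS := der_kernel_subfield he.
  elim/mpolyind: c => [|c m P _ _ IH]; first by rewrite rmorph0 (der0 he).
  rewrite rmorphD /= he.1 IH addr0 -mul_mpolyC rmorphM /= he.2 ec mul0r addr0.
  suff -> : e (emb 'X_[m]) = 0 by rewrite mulr0.
  elim/mnm_ind: m => [|i m IHm]; first by rewrite mpolyX0 rmorph1 der1.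
  by rewrite mpolyXD rmorphM /= he.2 IHm eX mulr0 mul0r addr0.
have [a [b [_ ->]]] := embF q.
by rewrite he.2 (derV he (ep b)) ep mulr0 mul0r addr0.
Qed.
End Invariants.

(** * The skew field of invariants as the image of an endomorphism *)

Section SkewRational.
Variables (F : fieldType) (p n : nat).
Hypothesis Fp : p \in [pchar F].
Hypothesis np : (n < p)%N.
Hypothesis Froot : forall c : F, exists d, d ^+ p = c.
Variables (W : algType F) (x y : 'I_n -> W).
Hypothesis HW : is_weyl x y.
Variables (D : unitRingType) (io : {rmorphism W -> D}).
Hypothesis ioI : injective io.
Hypothesis Du : forall d : D, d != 0 -> d \is a GRing.unit.
Hypothesis Df : forall d, exists a b, [/\ forall c, b * c = c * b, b != 0 & d = io a / io b].
Variable jW : {rmorphism {mpoly F[n]} -> W}.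
Hypothesis jWC : forall c, jW c%:MP = c%:A.
Hypothesis jWX : forall i, jW 'X_i = x i.
Hypothesis yD : forall i q, y i * jW q = jW q * y i + jW q^`M(i).
Hypothesis opI : forall P, mmap jW y P = 0 -> P = 0.
Hypothesis opS : forall w, exists P, mmap jW y P = w.
Variables (L : fieldType) (emb : {rmorphism {mpoly F[n]} -> L}).
Hypothesis embI : injective emb.
Hypothesis embF : forall q, exists a b, b != 0 /\ q = emb a / emb b.
Variable act : 'S_n -> {rmorphism L -> L}.
Hypothesis actE : forall s q, act s (emb q) = emb (msym s q).
Variable j : {rmorphism L -> D}.
Hypothesis jE : forall q, j (emb q) = io (jW q).
Variable g : 'S_n -> {rmorphism W -> W}.
Hypothesis gj : forall s q, g s (jW q) = jW (msym s q).
Hypothesis gy : forall s i, g s (y i) = y (s i).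
Variable G : 'S_n -> {rmorphism D -> D}.
Hypothesis GE : forall s w, G s (io w) = io (g s w).
Variable f : 'I_n -> L.
Hypothesis finv : forall i, alt_inv act (f i).
Hypothesis fgen : forall q, alt_inv act q -> in_gen emb f q.

Let Y i := io (y i).
Let yC i k : y i * y k = y k * y i. Proof. by have [_ h _ _ _] := HW. Qed.
Let YC i k : Y i * Y k = Y k * Y i. Proof. by rewrite -!rmorphM yC. Qed.
Let jI : injective j. Proof. exact: fmorph_inj. Qed.

Let emb_unit a : a != 0 -> emb a != 0.
Proof. by move=> na; rewrite -(rmorph0 emb) (inj_eq embI). Qed.
Let ju q : q != 0 -> j q \is a GRing.unit.
Proof. by move=> nq; apply: Du; rewrite -(rmorph0 j) (inj_eq jI). Qed.
Let jV q : j q^-1 = (j q)^-1.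
Proof.
have [->|nq] := eqVneq q 0; first by rewrite invr0 rmorph0 invr0.
by apply: (mulIr (ju nq)); rewrite -rmorphM mulVf // rmorph1 mulVr // ju.
Qed.

Let Yd_ex i q : exists r, Y i * j q == j q * Y i + j r.
Proof.
have [a [b [nb ->]]] := embF q; have nB := emb_unit nb.
have e c : Y i * j (emb c) = j (emb c) * Y i + j (emb c^`M(i)).
  by rewrite !jE -!rmorphM -rmorphD yD.
(* The quotient rule; it extends the partial derivatives to [L]. *)
exists ((emb a^`M(i) - emb a / emb b * emb b^`M(i)) / emb b); apply/eqP.
apply: (mulIr (ju nB)); rewrite mulrDl -!mulrA -!rmorphM !divfK //.
rewrite rmorphB rmorphM e.
have -> : Y i * j (emb b) = j (emb b) * Y i + j (emb b^`M(i)) by exact: e.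
rewrite mulrDr !mulrA -!rmorphM divfK // -addrA; congr (_ + _).
by rewrite addrC subrK.
Qed.
Let d i q := xchoose (Yd_ex i q).
Let Yd i q : Y i * j q = j q * Y i + j (d i q).
Proof. exact/eqP/(xchooseP (Yd_ex i q)). Qed.

Let d_uniq i q r : Y i * j q = j q * Y i + j r -> d i q = r.
Proof. by rewrite Yd => /addrI/jI. Qed.

Let d_der i : derivation (d i).
Proof.
split=> a b; apply: d_uniq.
  by rewrite !rmorphD mulrDr mulrDl !Yd addrACA.
by rewrite rmorphD !rmorphM mulrA Yd mulrDl -!mulrA Yd mulrDr addrA.
Qed.

Let d_emb i q : d i (emb q) = emb q^`M(i).
Proof. by apply: d_uniq; rewrite !jE -!rmorphM -rmorphD yD. Qed.

Let ioop Q : io (mmap jW y Q) = mmap j Y (map_mpoly emb Q).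
Proof.
have ym m : io (mmap1 y m) = mmap1 Y m.
  by rewrite /mmap1 rmorph_prod; apply: eq_bigr => i _; rewrite rmorphXn.
elim/mpolyind: Q => [|c m Q _ _ IH]; first by rewrite !raddf0.
by rewrite !raddfD /= IH map_mpolyZ map_mpolyX !mmapZ !mmapX rmorphM /= ym jE.
Qed.

Let opYI P : mmap j Y P = 0 -> P = 0.
Proof.
(* Clearing denominators reduces freeness over [L] to freeness over the polynomials. *)
have [b [Q [nb bE]]] : exists b Q, b != 0 /\ emb b *: P = map_mpoly emb Q.
  elim/mpolyind: P => [|c m P _ _ [b [Q [nb e]]]].
    by exists 1, 0; rewrite oner_neq0 [RHS]raddf0 scaler0.
  have [a [b' [nb' ->]]] := embF c; exists (b * b'), ((b * a) *: 'X_[m] + b' *: Q); split.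
    by rewrite mulf_neq0.
  rewrite scalerDr scalerA raddfD /= !map_mpolyZ map_mpolyX -e !scalerA -!rmorphM [b' * b]mulrC.
  congr (_ *: _ + _); rewrite !rmorphM -mulrA; congr (_ * _).
  by rewrite mulrC divfK // emb_unit.
move=> e; have : io (mmap jW y Q) = 0 by rewrite ioop -bE mmapZ e mulr0.
rewrite -(rmorph0 io) => /ioI/opI Q0; move/eqP: bE; rewrite Q0 raddf0.
by rewrite mscalerI (negbTE (emb_unit nb)) => /eqP.
Qed.

Let Gj s q : G s (j q) = j (act s q).
Proof.
apply: (@rat_morph_eq _ _ _ _ embI embF _ (G s \o j) (j \o act s)) => c /=.
by rewrite jE GE gj actE jE.
Qed.
Let GY s i : G s (Y i) = Y (s i). Proof. by rewrite GE gy. Qed.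

Let J : 'M[L]_n := \matrix_(i, k) d i (f k).
Let dC i c : d i (emb c%:MP) = 0. Proof. by rewrite d_emb mderivC rmorph0. Qed.
Let dX i k : d i (emb 'X_k) = (i == k)%:R.
Proof.
rewrite d_emb mderivX mnm1E eq_sym; case: eqVneq => [->|_]; last by rewrite mulr0n scale0r raddf0.
have -> : (U_(k) - U_(k) = 0 :> 'X_{1..n})%MM by apply/mnmP => l; rewrite mnmBE subnn mnm0E.
by rewrite mpolyX0 mulr1n scale1r rmorph1.
Qed.

Let der_eq0 e : derivation e -> (forall c, e (emb c%:MP) = 0) -> (forall i, e (f i) = 0) -> forall q, e q = 0.
Proof. exact: (rat_derivation_eq0 embI embF actE fgen). Qed.

Let comb_der (c : 'I_n -> L) : derivation (fun q => \sum_i c i * d i q).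
Proof.
split=> a b.
  by rewrite -big_split; apply: eq_bigr => i _; rewrite (d_der i).1 mulrDr.
rewrite mulr_sumr mulr_suml -big_split; apply: eq_bigr => i _ /=.
by rewrite (d_der i).2 mulrDr mulrCA -[in RHS]mulrA.
Qed.

(** A row [c] killed by [J] yields the derivation [\sum_i c_i d_i], which vanishes on constants and
    on the [f k], hence everywhere; its value at the variable of index [k] is [c_k]. *)
Let J_unit : J \in unitmx.
Proof.
rewrite -row_free_unit -kermx_eq0; apply/rowV0P => c /sub_kermxP cJ.
have e0 := der_eq0 (comb_der (c 0)).
apply/rowP => k; rewrite mxE -[RHS](e0 _ _ (emb 'X_k)).
- rewrite (bigD1 k) //= dX eqxx mulr1 big1 ?addr0 // => i ik.
  by rewrite dX (negbTE ik) mulr0.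
- by move=> a; rewrite big1 // => i _; rewrite dC mulr0.
- move=> l; move/rowP/(_ l): cJ; rewrite !mxE => cJ; rewrite -[RHS]cJ.
  by apply: eq_bigr => i _; rewrite mxE.
Qed.

Let A := invmx J.
Let AJ k l : \sum_i A k i * d i (f l) = (k == l)%:R.
Proof.
have /matrixP/(_ k l) := mulVmx J_unit; rewrite !mxE => <-.
by apply: eq_bigr => i _; rewrite mxE.
Qed.
Let del k q := \sum_i A k i * d i q.
Let de k := \sum_i j (A k i) * Y i.
Let del_der k : derivation (del k). Proof. exact: comb_der. Qed.
Let del_f k l : del k (f l) = (k == l)%:R. Proof. exact: AJ. Qed.
Let del_C k c : del k (emb c%:MP) = 0.
Proof. by rewrite /del big1 // => i _; rewrite dC mulr0. Qed.

Let comb_comm (c : 'I_n -> L) q :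
  (\sum_i j (c i) * Y i) * j q = j q * (\sum_i j (c i) * Y i) + j (\sum_i c i * d i q).
Proof.
rewrite mulr_suml mulr_sumr rmorph_sum -big_split /=; apply: eq_bigr => i _.
by rewrite -mulrA Yd mulrDr !mulrA -!rmorphM [q * _]mulrC.
Qed.
Let ded k q : de k * j q = j q * de k + j (del k q).
Proof. exact: comb_comm. Qed.

Let del_x k i : del k (emb 'X_i) = A k i.
Proof.
rewrite /del (bigD1 i) //= dX eqxx mulr1 big1 ?addr0 // => l li.
by rewrite dX (negbTE li) mulr0.
Qed.

(** The commutator of two derivations is a derivation; this one kills the constants and, as
    [del k (f l)] is 0 or 1, also the [f l]. *)
Let del_comm k l q : del k (del l q) = del l (del k q).
Proof.
apply/eqP; rewrite -subr_eq0; apply/eqP; move: q.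
apply: (@der_eq0 (fun q => del k (del l q) - del l (del k q))).
- have [kD kM] := del_der k; have [lD lM] := del_der l; split=> a b.
    by rewrite lD kD kD lD opprD addrACA.
  rewrite lM kM !kD !lD !kM !lM; ring.
- by move=> c; rewrite !del_C !(der0 (del_der _)) subrr.
- have nat_d m k' : del k' m%:R = 0.
    by rewrite -(rmorph_nat emb) -mpolyC_nat del_C.
  by move=> i; rewrite !del_f !nat_d subrr.
Qed.

(** Since [A l i] is [del l] of the i-th variable, the first-order part of [de k * de l] has
    coefficients [del k (del l x_i)], symmetric in [k] and [l] by [del_comm]. The second-order part
    is symmetric because the [Y i] commute. *)
Let deC k l : de k * de l = de l * de k.
Proof.
have key k' l' : de k' * de l' = \sum_i \sum_h j (A l' i * A k' h) * (Y h * Y i) +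
   \sum_i j (del k' (del l' (emb 'X_i))) * Y i.
  rewrite {2}/de mulr_sumr -big_split /=; apply: eq_bigr => i _.
  rewrite mulrA ded mulrDl del_x; congr (_ + _).
  rewrite -mulrA /de mulr_suml mulr_sumr; apply: eq_bigr => h _.
  by rewrite rmorphM !mulrA.
rewrite !key; congr (_ + _); last by apply: eq_bigr => i _; rewrite del_comm.
rewrite exchange_big /=; apply: eq_bigr => h _; apply: eq_bigr => i _.
by rewrite YC mulrC.
Qed.

(** Applying [G s] to the commutation rules of [de k] with the invariant [f l] shows that the
    permuted coefficient matrix [B] is again a left inverse of [J], so it equals [A]. *)
Let Gde s k : ~~ odd_perm s -> G s (de k) = de k.
Proof.
move=> es.
have -> : G s (de k) = \sum_i j (act s (A k ((s^-1)%g i))) * Y i.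
  rewrite rmorph_sum (reindex_inj (@perm_inj _ s^-1%g)) /=; apply: eq_bigr => i _.
  by rewrite rmorphM /= Gj GY permKV.
apply: eq_bigr => i _; congr (j _ * _).
pose B : 'M[L]_n := \matrix_(k, i) act s (A k ((s^-1)%g i)).
suff BA : B = A by have /matrixP/(_ k i) := BA; rewrite mxE.
have BJ : B *m J = 1%:M.
  apply/matrixP => k' l; rewrite !mxE.
  have e1 := comb_comm (B k') (f l); have e2 := congr1 (G s) (ded k' (f l)).
  have e3 : G s (de k') = \sum_i j (B k' i) * Y i.
    rewrite rmorph_sum (reindex_inj (@perm_inj _ s^-1%g)) /=; apply: eq_bigr => i' _.
    by rewrite rmorphM /= Gj GY permKV mxE.
  move: e2; rewrite rmorphD !rmorphM /= !Gj finv // del_f rmorph_nat e3 e1 => /addrI/jI e4.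
  by rewrite -e4; apply: eq_bigr => i' _; rewrite !mxE.
by rewrite -[B]mulmx1 -(mulmxV J_unit) mulmxA BJ mul1mx.
Qed.
Let lin (M : 'M[L]_n) : n.-tuple {mpoly L[n]} := [tuple \sum_i M k i *: 'X_i | k < n].
Let lin_size M k : (msize (tnth (lin M) k) <= 2)%N.
Proof.
rewrite tnth_mktuple; apply: msize_sum_bound => i _; apply: leq_trans (msizeZ_le _ _) _.
by rewrite msizeX mdeg1.
Qed.
Let linK M N P : M *m N = 1%:M -> (P \mPo lin M) \mPo lin N = P.
Proof.
move=> MN; elim/mpolyind: P => [|c m P _ _ IH]; first by rewrite !comp_mpoly0.
rewrite !comp_mpolyD IH !comp_mpolyZ; congr (_ *: _ + _).
elim/mnm_ind: m => [|k m IHm]; first by rewrite mpolyX0 !comp_mpoly1.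
rewrite mpolyXD !rmorphM /= IHm; congr (_ * _).
rewrite comp_mpolyXU -tnth_nth tnth_mktuple raddf_sum /=.
transitivity (\sum_l (M *m N) k l *: 'X_l : {mpoly L[n]}).
  under [RHS]eq_bigr => l _ do rewrite mxE scaler_suml.
  rewrite [RHS]exchange_big /=; apply: eq_bigr => i _.
  rewrite comp_mpolyZ comp_mpolyXU -tnth_nth tnth_mktuple scaler_sumr.
  by apply: eq_bigr => l _; rewrite scalerA.
rewrite MN (bigD1 k) //= mxE eqxx scale1r big1 ?addr0 // => l lk.
by rewrite mxE eq_sym (negbTE lk) scale0r.
Qed.

Let op_lin k : mmap j Y (tnth (lin A) k) = de k.
Proof.
by rewrite tnth_mktuple raddf_sum /=; apply: eq_bigr => i _; rewrite mmapZ mmapX mmap1U.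
Qed.

Let opd_lead P a : (msize P <= a.+1)%N ->
  exists2 R, mmap j de P = mmap j Y (P \mPo lin A + R) & (msize R <= a)%N.
Proof.
move=> sP.
have wC i k : mmap j Y (tnth (lin A) i) * mmap j Y (tnth (lin A) k)
    = mmap j Y (tnth (lin A) k) * mmap j Y (tnth (lin A) i) by rewrite !op_lin deC.
have [R e sR] := op_comp_lead YC Yd (lin_size A) wC sP; exists R => //.
by rewrite -e; apply: eq_bigr => m _; congr (_ * _); apply: mmap1_eq => k; rewrite op_lin.
Qed.

(** If the operator vanishes, its symbol [P \mPo lin A] equals minus the remainder and has too small
    a degree. Substituting the inverse change [lin J] recovers [P], whose degree would then be below
    itself. *)
Let opdI P : mmap j de P = 0 -> P = 0.
Proof.
move=> e; apply/eqP; apply: contra_eqT e => nP.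
have sP : msize P = (msize P).-1.+1 by rewrite prednK // lt0n msize_poly_eq0.
have [|R -> sR] := @opd_lead P (msize P).-1; first by rewrite -sP.
apply/eqP => /opYI/eqP; rewrite addr_eq0 => /eqP e.
have := @msize_comp_lin _ _ (lin J) (lin_size J) (P \mPo lin A) (msize P).-1.
rewrite linK ?mulVmx // e msizeN => /(_ sR); by rewrite [in X in (X <= _)%N]sP ltnn.
Qed.

(** Subtracting the operator in the [de k] with symbol [P \mPo lin J] removes the leading part and
    leaves an operator of lower order. *)
Let opd_span a P : (msize P <= a)%N -> exists Q, mmap j Y P = mmap j de Q.
Proof.
elim: a P => [|a IH] P sP.
  by exists 0; move: sP; rewrite leqn0 msize_poly_eq0 => /eqP ->; rewrite !raddf0.
have sQ := @msize_comp_lin _ _ (lin J) (lin_size J) P a.+1 sP.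
have [R e /IH[Q eQ]] := opd_lead sQ; exists (P \mPo lin J - Q).
by rewrite raddfB /= e -eQ linK ?mulmxV // raddfD /= addrK.
Qed.

Let jf : {rmorphism {mpoly F[n]} -> L} := mmap (emb \o @mpolyC n F) f.
Let jfC c : jf c%:MP = emb c%:MP. Proof. by rewrite /jf /= mmapC. Qed.
Let jfX i : jf 'X_i = f i. Proof. by rewrite /jf /= mmapX mmap1U. Qed.

Let jfd k q : de k * j (jf q) = j (jf q) * de k + j (jf q^`M(k)).
Proof.
apply: (@weyl_commutator _ _ _ (j \o jf)) => [c|l] /=.
  by rewrite jfC ded del_C rmorph0 addr0.
by rewrite jfX ded del_f rmorph_nat.
Qed.
Let del_jf k q : del k (jf q) = jf q^`M(k).
Proof. by apply: jI; apply: (addrI (j (jf q) * de k)); rewrite -ded jfd. Qed.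

(* Jacobian criterion: a relation of minimal degree between the [f_i] has vanishing partial
   derivatives, so it is a p-th power since [F] is perfect. *)
Let jfI q : jf q = 0 -> q = 0.
Proof.
move: {2}(msize q) (leqnn (msize q)) => N; elim: N q => [|N IH] q sq q0.
  by move: sq; rewrite leqn0 msize_poly_eq0 => /eqP.
have size_le (P : {mpoly F[n]}) M : (forall m, m \in msupp P -> (mdeg m < M)%N) -> (msize P <= M)%N.
  move=> h; rewrite msizeE big_seq; elim/big_rec: _ => // m a /h hm ha; by rewrite geq_max hm.
have dq k : q^`M(k) = 0.
  apply: IH; last by rewrite -del_jf q0 (der0 (del_der k)).
  apply: size_le => m; rewrite mcoeff_msupp mcoeff_mderiv => nm.
  have /msize_mdeg_lt : (m + U_(k))%MM \in msupp q.
    by rewrite mcoeff_msupp; apply: contraNneq nm => ->; rewrite mul0rn.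
  by rewrite mdegD mdeg1 addn1 => h; rewrite -ltnS; apply: leq_trans h sq.
have pdvd m k : m \in msupp q -> (p %| m k)%N.
  rewrite mcoeff_msupp => nm; case mk : (m k) => [|a]; first exact: dvdn0.
  have := mcoeff_mderiv k q (m - U_(k))%MM; rewrite dq mcoeff0 submK ?lep1mP ?mk //.
  rewrite mnmBE mk mnm1E eqxx subn1 /= => /esym/eqP; rewrite -mulr_natr mulf_eq0 (negbTE nm) /=.
  by rewrite (dvdn_pcharf Fp).
have [s1|s1] := leqP (msize q) 1.
  have e := msize1_polyC s1; move: q0; rewrite e jfC -(rmorph0 emb) => /embI/eqP.
  by rewrite mpolyC_eq0 => /eqP ->; rewrite mpolyC0.
have rt_ex c : exists r : F, r ^+ p == c by have [r <-] := Froot c; exists r.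
pose rt c := xchoose (rt_ex c).
have rtE c : rt c ^+ p = c by apply/eqP/(xchooseP (rt_ex c)).
have p_gt1 : (1 < p)%N := prime_gt1 (pcharf_prime Fp).
pose mp (m : 'X_{1..n}) : 'X_{1..n} := [multinom (m i %/ p)%N | i < n].
have mpE m : m \in msupp q -> (mp m *+ p)%MM = m.
  by move=> mq; apply/mnmP => i; rewrite mulmnE mnmE divnK // pdvd.
pose r := \sum_(m <- msupp q) rt q@_m *: 'X_[mp m].
have Mp : p \in [pchar {mpoly F[n]}].
  by rewrite inE (pcharf_prime Fp) /= -mpolyC_nat (pcharf0 Fp) mpolyC0.
have rE : r ^+ p = q.
  rewrite -(pFrobenius_autE Mp) rmorph_sum [RHS]mpolyE !big_seq; apply: eq_bigr => m mq.
  by rewrite /= pFrobenius_autE exprZn rtE mpolyXn mpE.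
suff r0 : r = 0 by rewrite -rE r0 expr0n; case: (p) p_gt1.
apply: IH; last by apply/eqP; move/eqP: q0; rewrite -rE rmorphXn expf_eq0 => /andP[].
apply: msize_sum_bound => m mq; apply: leq_trans (msizeZ_le _ _) _; rewrite msizeX.
(* As [q] is not constant and [p > 1], dividing exponents by p strictly lowers the degree bound. *)
have dm := msize_mdeg_lt mq; have := mdegMn (mp m) p; rewrite mpE // => e.
by move: dm sq s1 p_gt1; rewrite e; case: (mdeg (mp m)) {e} => [|a]; nia.
Qed.

Let psi_ex : exists psi : {rmorphism W -> D},
  [/\ forall P, psi (mmap jW y P) = mmap (j \o jf) de P, forall q, psi (jW q) = j (jf q) &
      forall i, psi (y i) = de i].
Proof. exact: (diffop_hom yC yD opI opS (j' := j \o jf) deC jfd). Qed.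

Let skew_morph_inj (h : {rmorphism D -> D}) : injective h.
Proof.
move=> a b e; apply/eqP; rewrite -subr_eq0; apply/negPn/negP => /Du u.
have : h ((a - b) * (a - b)^-1) = 0 by rewrite rmorphM rmorphB e subrr mul0r.
by rewrite mulrV // rmorph1 => /eqP; rewrite oner_eq0.
Qed.

Let psib_ex : exists psib : {rmorphism D -> D},
  [/\ forall q, psib (io (jW q)) = j (jf q), forall i, psib (Y i) = de i &
      forall s d, ~~ odd_perm s -> G s (psib d) = psib d].
Proof.
have [psi [psiE psij psiy]] := psi_ex.
have psiI : injective psi.
  move=> a b e; apply/eqP; rewrite -subr_eq0; apply/eqP.
  have [P eP] := opS (a - b); have : psi (a - b) = 0 by rewrite rmorphB e subrr.
  rewrite -eP psiE; have -> : mmap (j \o jf) de P = mmap j de (map_mpoly jf P).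
    elim/mpolyind: P {eP} => [|c m P _ _ IH]; first by rewrite !raddf0.
    by rewrite !raddfD /= IH map_mpolyZ map_mpolyX !mmapZ !mmapX.
  move/opdI => P0; suff -> : P = 0 by rewrite raddf0.
  apply/mpolyP => m; rewrite mcoeff0; apply: jfI.
  by rewrite -mcoeff_map_mpoly P0 mcoeff0.
have [psib psibE] := frac_extend ioI psiI Du Du Df.
exists psib; split=> [q|i|s dd es]; rewrite ?psibE //.
have Gpsi w : G s (psi w) = psi w.
  have [P <-] := opS w; rewrite psiE /mmap rmorph_sum; apply: eq_bigr => m _.
  rewrite rmorphM /= Gj; congr (j _ * _).
    elim/mpolyind: P@_m => [|c k Q _ _ IH]; first by rewrite !rmorph0.
    rewrite !rmorphD /= IH -mul_mpolyC !rmorphM /= jfC actE /msym mmapC; congr (_ * _ + _).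
    elim/mnm_ind: k => [|i k IHk]; first by rewrite mpolyX0 !rmorph1.
    by rewrite mpolyXD !rmorphM /= IHk jfX finv.
  by rewrite /mmap1 rmorph_prod; apply: eq_bigr => i _; rewrite rmorphXn /= Gde.
have [a [b [_ nb ->]]] := Df dd.
have ub : io b \is a GRing.unit by apply: Du; rewrite -(rmorph0 io) (inj_eq ioI).
by rewrite !rmorphM !rmorphV ?rmorph_unit //= !psibE !Gpsi.
Qed.

Let weyl_morph_eq (E : nzRingType) (u v : {rmorphism W -> E}) :
  (forall q, u (jW q) = v (jW q)) -> (forall i, u (y i) = v (y i)) -> forall w, u w = v w.
Proof. exact: diffop_morph_eq. Qed.

Let gM s t w : g t (g s w) = g (s * t)%g w.
Proof.
apply: (@weyl_morph_eq _ (g t \o g s) (g (s * t)%g)) => [q|i] /=.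
  by rewrite !gj msymMm.
by rewrite !gy permM.
Qed.
Let g1 w : g 1%g w = w.
Proof.
apply: (@weyl_morph_eq _ (g 1%g) idfun) => [q|i] /=; first by rewrite gj msym1m.
by rewrite gy perm1.
Qed.
Let gx s i : g s (x i) = x (s i). Proof. by rewrite -!jWX gj msymXi. Qed.
Let gA s c : g s c%:A = c%:A. Proof. by rewrite -jWC gj /msym mmapC. Qed.

Let g_action s : Defs.perm_action x y s (g s).
Proof.
split; last by move=> i; rewrite gx gy.
by split=> [|u v|u v|c u]; rewrite ?rmorph1 ?rmorphD ?rmorphM // -mulr_algl rmorphM /= gA mulr_algl.
Qed.

(** An algebra endomorphism is determined on the generators, so the only [phi] realizing the action
    of [s] is [g s]. *)
Let alt_invariantE w : alt_invariant x y w <-> forall s, ~~ odd_perm s -> g s w = w.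
Proof.
split=> [h s es|h s es phi [[p1 pD pM pZ] pxy]]; first exact: h (g_action s).
have [ph phE] := rmorphism_of pD p1 pM; rewrite -phE -[RHS](h s es).
apply: weyl_morph_eq => [q|i]; last by rewrite phE gy (pxy i).2.
elim/mpolyind: q => [|c m P _ _ IH]; first by rewrite !rmorph0.
rewrite !rmorphD /= IH -mul_mpolyC !rmorphM /= jWC gA; congr (_ * _ + _).
  by rewrite phE pZ p1.
elim/mnm_ind: m => [|i m IHm]; first by rewrite mpolyX0 !rmorph1.
by rewrite mpolyXD !rmorphM /= IHm jWX gx; congr (_ * _); rewrite phE (pxy i).1.
Qed.

(* Averaging over the alternating group makes the coefficients of an invariant operator
   invariant, without using uniqueness of the expansion. *)
Let alt_image (psib : {rmorphism D -> D}) w : (forall q, psib (io (jW q)) = j (jf q)) -> (forall i, psib (Y i) = de i) ->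
  alt_invariant x y w -> exists e, psib e = io w.
Proof.
move=> psij psiY /alt_invariantE w_inv.
pose im v := exists e, psib e = v.
have imD u v : im u -> im v -> im (u + v) by move=> [a <-] [b <-]; exists (a + b); rewrite rmorphD.
have imM u v : im u -> im v -> im (u * v) by move=> [a <-] [b <-]; exists (a * b); rewrite rmorphM.
have im1 : im 1 by exists 1; rewrite rmorph1.
have imV u : im u -> im u^-1.
  move=> [a <-]; exists a^-1; have [->|na] := eqVneq a 0; first by rewrite invr0 rmorph0 invr0.
  by rewrite rmorphV // Du.
have im_gen q : alt_inv act q -> im (j q).
  move=> /fgen hq; apply: (hq (fun q => im (j q))) => [|c|i]; last by exists (io (jW 'X_i)); rewrite psij jfX.
    split; first by rewrite rmorph1.
    - move=> a b ha [e eb]; rewrite rmorphB; apply: imD => //; exists (- e); by rewrite rmorphN eb.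
    - by move=> a b ha hb; rewrite rmorphM; apply: imM.
    - by move=> a ha; rewrite jV; apply: imV.
  by exists (io (jW c%:MP)); rewrite psij jfC.
have [P0 eP0] := opS w; have := ioop P0; rewrite eP0 => wE.
have [Q QE] := opd_span (leqnn (msize (map_mpoly emb P0))); rewrite QE in wE.
pose S := [set s : 'S_n | ~~ odd_perm s].
have avg : #|S|%:R * io w = \sum_(m <- msupp Q) j (\sum_(s in S) act s Q@_m) * mmap1 de m.
  have -> : #|S|%:R * io w = \sum_(s in S) G s (io w).
    rewrite mulr_natl -sumr_const; apply: eq_bigr => s; rewrite inE => es.
    by rewrite GE w_inv.
  under eq_bigr => s _ do rewrite wE /mmap rmorph_sum.
  rewrite exchange_big /=; apply: eq_bigr => m _; rewrite rmorph_sum mulr_suml.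
  apply: eq_bigr => s; rewrite inE => es; rewrite rmorphM /= Gj; congr (_ * _).
  by rewrite /mmap1 rmorph_prod; apply: eq_bigr => i _; rewrite rmorphXn /= Gde.
(* The order of the alternating group divides [n!], which is prime to p because [n < p]. *)
have nS : #|S|%:R != 0 :> D.
  have -> : #|S| = #|Alt 'I_n| by apply: eq_card => s; rewrite inE Alt_even.
  have dv : (#|Alt 'I_n| %| n`!)%N.
    by rewrite -[n in n`!](card_ord n) -card_Sym; apply: cardSg; apply: Alt_subset.
  have nF k : (k < p)%N -> k`!%:R != 0 :> F.
    elim: k => [|k IH] kp; first by rewrite fact0 oner_neq0.
    by rewrite factS natrM mulf_neq0 ?IH ?(ltnW kp) // -(dvdn_pcharf Fp) gtnNdvd.
  have nA : #|Alt 'I_n|%:R != 0 :> F.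
    by have := nF n np; case/dvdnP: dv => k ->; rewrite natrM mulf_eq0 negb_or => /andP[].
  by rewrite -(rmorph_nat (io \o in_alg W)) fmorph_eq0.
have imS : im (#|S|%:R * io w).
  rewrite avg; elim: (msupp Q) => [|m r IH].
    by rewrite big_nil; exists 0; rewrite rmorph0.
  rewrite big_cons; apply: imD => //; apply: (imM).
    apply: im_gen => t et; rewrite rmorph_sum (reindex_inj (mulIg t^-1)%g) /=.
    rewrite (eq_bigl (mem S)) => [|s]; last by rewrite !inE odd_permM odd_permV (negbTE et) addbF.
    by apply: eq_bigr => s _; rewrite -(rat_actM embI embF actE) mulgKV.
  rewrite /mmap1; apply: (big_ind im) => [//||i _]; first exact: imM.
  by elim: (m i) => [|a IHa]; rewrite ?expr0 // exprS; apply: (imM) => //; exists (Y i).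
rewrite -(mulKr (Du nS) (io w)); apply: imM => //; apply: imV.
by exists #|S|%:R; rewrite rmorph_nat.
Qed.

(** [W] is not commutative, so reordering a product relies on its factors being central. *)
Let prod_central_rem (I : eqType) (E : I -> W) (r : seq I) k : (forall i w, E i * w = w * E i) ->
  k \in r -> \prod_(i <- r) E i = E k * \prod_(i <- rem k r) E i.
Proof.
move=> Ec; elim: r => // i r IH; rewrite inE big_cons /=.
have [->|ik] := eqVneq i k; first by [].
by move=> /= /IH ->; rewrite big_cons !mulrA Ec.
Qed.
Let prod_central_perm (I : eqType) (E : I -> W) (r s : seq I) : (forall i w, E i * w = w * E i) ->
  perm_eq r s -> \prod_(i <- r) E i = \prod_(i <- s) E i.
Proof.
move=> Ec; elim: r s => [|i r IH] s rs; first by move: rs; rewrite perm_sym => /perm_nilP ->.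
have si : i \in s by rewrite -(perm_mem rs) mem_head.
rewrite big_cons (prod_central_rem Ec si) (IH (rem i s)) //.
by rewrite -(perm_cons i) (perm_trans rs) // perm_to_rem.
Qed.

(** The denominator is replaced by its norm, the product of its conjugates under the even
    permutations. The norm is invariant, and so is the numerator, being [v] times the norm. *)
Let invariant_frac v : (forall s, ~~ odd_perm s -> G s v = v) ->
  exists a b, [/\ alt_invariant x y a, alt_invariant x y b, b != 0 & v = io a / io b].
Proof.
move=> Gv; have [a [b [bc nb vE]]] := Df v.
have gbc s w : g s b * w = w * g s b.
  have -> : w = g s (g s^-1%g w) by rewrite gM mulVg g1.
  by rewrite -!rmorphM bc.
pose r := enum [set s : 'S_n | ~~ odd_perm s].
pose N := \prod_(s <- r) g s b; pose M := \prod_(s <- rem 1%g r) g s b.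
have r1 : (1%g : 'S_n) \in r by rewrite mem_enum inE odd_perm1.
have NE : N = b * M by rewrite /N (prod_central_rem _ r1) ?g1.
have gN t : ~~ odd_perm t -> g t N = N.
  move=> et; rewrite rmorph_prod; under eq_bigr => s _ do rewrite gM.
  rewrite -(big_map (fun s => (s * t)%g) xpredT (fun s => g s b)).
  apply: prod_central_perm => //; apply: uniq_perm.
  - by rewrite map_inj_uniq ?enum_uniq //; apply: mulIg.
  - exact: enum_uniq.
  move=> s; apply/mapP/idP => [[u]|]; rewrite !mem_enum !inE => hu.
    by move=> ->; rewrite odd_permM (negbTE et) addbF.
  exists (s * t^-1)%g; last by rewrite mulgKV.
  by rewrite mem_enum inE odd_permM odd_permV (negbTE et) addbF.
have g_inj s : injective (g s).
  by move=> u w e; rewrite -(g1 u) -(g1 w) -(mulgV s) -!gM e.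
have nN : N != 0.
  rewrite /N; elim: (r) => [|s r' IH]; first by rewrite big_nil oner_neq0.
  rewrite big_cons; apply/eqP => /(weyl_domain HW)[|/eqP]; last by rewrite (negbTE IH).
  by rewrite -(rmorph0 (g s)) => /g_inj/eqP; rewrite (negbTE nb).
have uio w : w != 0 -> io w \is a GRing.unit.
  by move=> nw; apply: Du; rewrite -(rmorph0 io) (inj_eq ioI).
have aM : v * io N = io (a * M) by rewrite vE NE !rmorphM mulrA divrK // uio.
exists (a * M), N; split=> //; last by rewrite -aM mulrK // uio.
- by apply/alt_invariantE => s es; apply: ioI; rewrite -GE -aM rmorphM /= Gv // GE gN.
- by apply/alt_invariantE.
Qed.

(** On invariants [f1] is [io] followed by the inverse of [psib]. Every [d] is a fraction of values
    of [f1] because [psib d] is fixed by the even permutations, so [invariant_frac] applies to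
    it. *)
Lemma skew_rational : exists f1 : W -> D,
  is_skew_frac (alt_invariant x y) f1 /\ forall c : F, f1 c%:A = io c%:A.
Proof.
have [psib [psij psiY Gpsi]] := psib_ex; have psibI := @skew_morph_inj psib.
(* [f1] must be total on [W]; off the invariants its value is the arbitrary 0. *)
have ex w : exists e, alt_invariant x y w -> psib e = io w.
  have [w_inv|] := Classical_Prop.classic (alt_invariant x y w); last by exists 0.
  by have [e he] := alt_image psij psiY w_inv; exists e.
have [f1 f1E] := ClassicalEpsilon.choice _ ex; exists f1.
have alt_jC c : alt_invariant x y (c%:A : W) by apply/alt_invariantE => s _; rewrite gA.
have f1A c : f1 c%:A = io c%:A.
  by apply: psibI; rewrite f1E // -jWC psij jfC jE.
have alt1 : alt_invariant x y 1 by apply/alt_invariantE => s _; rewrite rmorph1.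
have f1_eq w e : alt_invariant x y w -> psib e = io w -> f1 w = e.
  by move=> /f1E h e'; apply: psibI; rewrite h e'.
split=> //; split; split=> //.
- by apply: f1_eq => //; rewrite !rmorph1.
- move=> a b ha hb; apply: f1_eq; last by rewrite !rmorphD /= !f1E.
  apply/alt_invariantE => s es; move/alt_invariantE: ha => ha; move/alt_invariantE: hb => hb.
  by rewrite rmorphD /= ha ?hb.
- move=> a b ha hb; apply: f1_eq; last by rewrite !rmorphM /= !f1E.
  apply/alt_invariantE => s es; move/alt_invariantE: ha => ha; move/alt_invariantE: hb => hb.
  by rewrite rmorphM /= ha ?hb.
- by move=> a b ha hb e; apply: ioI; rewrite -!f1E // e.
move=> dd; have [a [b [ha hb nb e]]] := @invariant_frac (psib dd) (fun s es => Gpsi s dd es).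
exists a, b; split=> //; split=> //; split=> //; apply: psibI.
have ub : f1 b \is a GRing.unit.
  apply: Du; apply: contraNneq nb => b0; apply/eqP; apply: ioI.
  by rewrite -f1E // b0 !rmorph0.
by rewrite e rmorphM rmorphV //= !f1E.
Qed.
End SkewRational.

(** * Change of scalars to the rational functions in no variables *)

Section ScalarRestriction.
Variables (F K : fieldType) (r : {rmorphism K -> F}) (W : algType F).
(* The vacuous [let] records [r] in the type, so that the scalar action can be inferred. *)
Definition scalar_restriction : Type := let _ := r in W.
Local Notation Wr := scalar_restriction.
HB.instance Definition _ := GRing.NzRing.copy Wr W.
Definition restr_scale (k : K) (w : Wr) : Wr := r k *: (w : W).
Lemma restr_scaleA a b w : restr_scale a (restr_scale b w) = restr_scale (a * b) w.
Proof. by rewrite /restr_scale scalerA -rmorphM. Qed.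
Lemma restr_scale1 : left_id 1 restr_scale.
Proof. by move=> w; rewrite /restr_scale rmorph1 scale1r. Qed.
Lemma restr_scaleDr : right_distributive restr_scale +%R.
Proof. by move=> a u v; rewrite /restr_scale; apply: scalerDr. Qed.
Lemma restr_scaleDl w : {morph restr_scale^~ w : a b / a + b}.
Proof. by move=> a b; rewrite /restr_scale rmorphD; apply: scalerDl. Qed.
HB.instance Definition _ := GRing.Zmodule_isLmodule.Build K Wr
  restr_scaleA restr_scale1 restr_scaleDr restr_scaleDl.
Lemma restr_scaleAl (a : K) (u v : Wr) : a *: (u * v) = (a *: u) * v.
Proof. exact: (@scalerAl F W). Qed.
HB.instance Definition _ := GRing.Lmodule_isLalgebra.Build K Wr restr_scaleAl.
Lemma restr_scaleAr (a : K) (u v : Wr) : a *: (u * v) = u * (a *: v).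
Proof. exact: (@scalerAr F W). Qed.
HB.instance Definition _ := GRing.Lalgebra_isAlgebra.Build K Wr restr_scaleAr.

Lemma restr_scaleE (a : K) (w : Wr) : a *: w = (r a *: (w : W)) :> W. Proof. by []. Qed.

(** Spanning lifts the coefficients along the section [rK]; independence uses that a morphism of
    fields is injective. *)
Lemma is_weyl_restriction n (x y : 'I_n -> W) (rK : F -> K) : cancel rK r ->
  is_weyl x y -> @is_weyl K n Wr x y.
Proof.
move=> rrK [h1 h2 h3 h4 h5]; split=> //.
- move=> w; have [s [c e]] := h4 w; exists s, (rK \o c); rewrite [LHS]e.
  by apply: eq_bigr => ab _; rewrite restr_scaleE /= rrK.
- move=> s c us e ab abs.
  have := h5 s (r \o c) us _ ab abs; rewrite /= => h.
  by apply/eqP; rewrite -(fmorph_eq0 r); apply/eqP/h; rewrite -[RHS]e.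
Qed.
End ScalarRestriction.

Lemma comm_frac_central (R : idomainType) (L : fieldType) (e : {rmorphism R -> L}) :
  (forall q, exists a b, b != 0 /\ q = e a / e b) ->
  forall q, exists a b, [/\ forall c, b * c = c * b, b != 0 & q = e a / e b].
Proof. by move=> h q; have [a [b [nb ->]]] := h q; exists a, b; split=> // c; rewrite mulrC. Qed.

Lemma tofrac_inj (R : idomainType) : injective (@tofrac R).
Proof. by move=> a b e; apply/eqP; rewrite -tofrac_eq e. Qed.

Lemma field_unit (L : fieldType) (a : L) : a != 0 -> a \is a GRing.unit.
Proof. by rewrite unitfE. Qed.

(** For l = 0 the prescribed scalars are a copy of [F]; evaluation at the empty point identifies the
    two and lets [W] itself be the algebra over them. *)
Lemma ratfun0_eval (F : fieldType) :
  exists r : {rmorphism ratfun F 0 -> F}, forall c, r (ratfun_const 0 c) = c.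
Proof.
pose ev : {rmorphism {mpoly F[0]} -> F} := meval (fun _ => 0).
have evI : injective ev.
  move=> a b; rewrite (nvar0_mpolyC a) (nvar0_mpolyC b) /ev /= !mevalC => e.
  by congr (_%:MP).
have [r rE] := @frac_extend _ _ _ (@tofrac {mpoly F[0]}) ev (@tofrac_inj _) evI
  (@field_unit _) (@field_unit _) (comm_frac_central (@frac_ex _)).
by exists r => c; rewrite /ratfun_const rE /ev /= mevalC.
Qed.

(* Noether's problem for [A_n]; [L] is any model of the field of rational functions. *)
Definition alt_rational (F : fieldType) (n : nat) : Prop :=
  forall (L : fieldType) (emb : {rmorphism {mpoly F[n]} -> L}), injective emb ->
  (forall q, exists a b, b != 0 /\ q = emb a / emb b) ->
  forall act : 'S_n -> {rmorphism L -> L}, (forall s q, act s (emb q) = emb (msym s q)) ->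
  exists f : 'I_n -> L, (forall i, alt_inv act (f i)) /\
    (forall q, alt_inv act q -> in_gen emb f q).

(** * From Noether's problem to the skew field of invariants *)

Section Assembly.
Variables (F : fieldType) (p n : nat).
Hypothesis Fp : p \in [pchar F].
Hypothesis np : (n < p)%N.
Hypothesis Froot : forall c : F, exists d, d ^+ p = c.
Hypothesis rat : alt_rational F n.
Variables (W : algType F) (x y : 'I_n -> W).
Hypothesis HW : is_weyl x y.

Lemma weyl_alt_skew_rational : exists m l : nat,
  exists (D1 : unitRingType) (f1 : W -> D1),
    is_skew_frac (alt_invariant x y) f1 /\
    exists (W' : algType (ratfun F l)) (x' y' : 'I_m -> W'),
      is_weyl x' y' /\
      exists (D2 : unitRingType) (f2 : W' -> D2),
        is_skew_frac (fun _ => True) f2 /\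
        exists phi : D1 -> D2,
          is_F_ring_iso (fun c : F => f1 (c%:A))
                        (fun c : F => f2 ((ratfun_const l c)%:A)) phi.
Proof.
have [D [io [ioI Du Df]]] := weyl_skew_field HW Fp.
have [jW [jWC jWX yD opI opS]] := weyl_diffop HW.
have [xC yC yx _ _] := HW.
have jWI : injective jW.
  move=> a b e; apply/eqP; rewrite -subr_eq0 -(mpolyC_eq0 n); apply/eqP/opI.
  by rewrite mmapC /= rmorphB e subrr.
pose emb : {rmorphism {mpoly F[n]} -> {fraction {mpoly F[n]}}} := @tofrac {mpoly F[n]}.
have embI : injective emb by exact: tofrac_inj.
have embF q : exists a b, b != 0 /\ q = emb a / emb b by exact: frac_ex.
have embC := comm_frac_central embF.
have act_ex (s : 'S_n) : exists a : {rmorphism {fraction {mpoly F[n]}} -> {fraction {mpoly F[n]}}},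
    forall q, a (emb q) = emb (msym s q).
  apply: (@frac_extend _ _ _ emb (emb \o msym s)) => //; try exact: field_unit.
  by apply: inj_comp => //; apply: inj_msym.
have [act actE] := fin_all_exists act_ex.
have [f [finv fgen]] := rat embI embF actE.
have [j jE] : exists j : {rmorphism {fraction {mpoly F[n]}} -> D}, forall q, j (emb q) = io (jW q).
  apply: (@frac_extend _ _ _ emb (io \o jW)) => //; try exact: field_unit.
  exact: inj_comp.
have g_ex (s : 'S_n) : exists g : {rmorphism W -> W},
    (forall q, g (jW q) = jW (msym s q)) /\ (forall i, g (y i) = y (s i)).
  have zD i q : y (s i) * jW (msym s q) = jW (msym s q) * y (s i) + jW (msym s q^`M(i)).
    apply: (@weyl_commutator _ _ _ (jW \o msym s)) => [c|k] /=.
      by rewrite /msym mmapC jWC weyl_scalar_comm.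
    by rewrite msymXi jWX -(inj_eq (@perm_inj _ s)) -yx addrC subrK.
  have [g [_ h1 h2]] := diffop_hom yC yD opI opS (j' := jW \o msym s)
    (fun i k => yC (s i) (s k)) zD.
  by exists g.
have [g gP] := fin_all_exists g_ex.
have gj s q : g s (jW q) = jW (msym s q) by have [h _] := gP s; apply: h.
have gy s i : g s (y i) = y (s i) by have [_ h] := gP s; apply: h.
have gI s : injective (g s).
  have gK w : g s^-1%g (g s w) = w.
    apply: (diffop_morph_eq opS (u := g s^-1%g \o g s) (v := idfun)) => [q|i] /=.
      by rewrite !gj -msymMm mulgV msym1m.
    by rewrite !gy permK.
  by move=> a b e; rewrite -(gK a) e gK.
have G_ex (s : 'S_n) : exists G : {rmorphism D -> D}, forall w, G (io w) = io (g s w).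
  apply: (@frac_extend _ _ _ io (io \o g s)) => //.
  exact: inj_comp.
have [G GE] := fin_all_exists G_ex.
have [f1 [f1P f1A]] := skew_rational Fp np Froot HW ioI Du Df jWC jWX yD opI opS embI embF
  actE jE gj gy GE finv fgen.
have [r rE] := ratfun0_eval F.
exists n, 0%N, D, f1; split=> //.
exists (scalar_restriction r W), x, y; split.
  by apply: (is_weyl_restriction (rK := @ratfun_const F 0)) HW.
exists D, io; split.
  split; split=> //.
  - by rewrite rmorph1.
  - by move=> a b _ _; rewrite rmorphD.
  - by move=> a b _ _; rewrite rmorphM.
  - by move=> a b _ _ /ioI.
  - by move=> d; have [a [b [_ nb e]]] := Df d; exists a, b.
(* Both skew fields are [D], with different embeddings that agree on scalars. *)
exists id; split=> //; first by exists id.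
by move=> c; rewrite f1A; congr (io _); rewrite restr_scaleE rE.
Qed.
End Assembly.

(** * Noether's problem for the alternating groups of degree 3, 4 and 5 *)

Section AltInvariants.
Variables (F : fieldType) (n : nat) (L : fieldType) (emb : {rmorphism {mpoly F[n]} -> L}).
Hypothesis embI : injective emb.
Hypothesis embF : forall q, exists a b, b != 0 /\ q = emb a / emb b.
Variable act : 'S_n -> {rmorphism L -> L}.
Hypothesis actE : forall s q, act s (emb q) = emb (msym s q).
Hypothesis n_gt1 : (1 < n)%N.
Hypothesis two_neq0 : 2%:R != 0 :> L.

(** A square root of the discriminant: the Vandermonde determinant of the variables. *)
Definition var_disc : L := \prod_(i < n) \prod_(k < n | (i < k)%N) (emb 'X_k - emb 'X_i).

Let actX s i : act s (emb 'X_i) = emb 'X_(s i). Proof. by rewrite actE msymXi. Qed.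

(** A permutation of the variables permutes the columns of the Vandermonde matrix. *)
Lemma act_var_disc s : act s var_disc = (-1) ^+ s * var_disc.
Proof.
pose V := Vandermonde n (\row_i emb 'X_i) : 'M[L]_n.
have dE : var_disc = \det V.
  by rewrite det_Vandermonde; apply: eq_bigr => i _; apply: eq_bigr => k _; rewrite !mxE.
rewrite dE -det_map_mx.
have -> : map_mx (act s) V = V *m perm_mx s^-1%g.
  by rewrite -col_permE; apply/matrixP => i k; rewrite !mxE rmorphXn actX.
by rewrite det_mulmx det_perm odd_permV mulrC.
Qed.

Lemma alt_inv_subfield : subfield_closed (alt_inv act).
Proof.
split=> [s _|a b ha hb s es|a b ha hb s es|a ha s es]; first by rewrite rmorph1.
- by rewrite rmorphB ha ?hb.
- by rewrite rmorphM ha ?hb.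
- by rewrite fmorphV ha.
Qed.

Lemma alt_inv_coef k : alt_inv act (var_poly emb)`_k.
Proof. by move=> s _; rewrite (act_var_poly actE). Qed.
Lemma alt_inv_disc : alt_inv act var_disc.
Proof. by move=> s es; rewrite act_var_disc (negbTE es) mul1r. Qed.

Lemma var_disc_neq0 : var_disc != 0.
Proof.
apply/prodf_neq0 => i _; apply/prodf_neq0 => k ik; rewrite subr_eq0 (inj_eq embI).
apply/eqP => /(congr1 (mcoeff U_(k))); rewrite !mcoeffX eqxx eq_mnm1.
have /negbTE -> : i != k by rewrite neq_ltn ik.
by move/eqP; rewrite oner_eq0.
Qed.

Variable S : L -> Prop.
Hypothesis HS : subfield_closed S.
Hypothesis Sc : forall c, S (emb c%:MP).
Hypothesis Sp : forall k, S (var_poly emb)`_k.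
Hypothesis Sd : S var_disc.

Lemma sub_mesym k : (k <= n)%N -> S (emb (mesym n F k)).
Proof.
move=> kn; have := @mroots_coeff L n [tuple emb 'X_i | i < n] (Ordinal (kn : k < n.+1)%N).
have -> : \prod_(c <- [tuple emb 'X_i | i < n]) ('X - c%:P) = var_poly emb.
  by rewrite big_tuple; apply: eq_bigr => i _; rewrite tnth_mktuple.
have -> : (mesym n L k).@[tnth [tuple emb 'X_i | i < n]] = emb (mesym n F k).
  rewrite /mesym !rmorph_sum /=; apply: eq_bigr => h _; rewrite !rmorph_prod /=.
  by apply: eq_bigr => i _; rewrite mevalXU tnth_mktuple.
move=> /= e.
have -> : emb (mesym n F k) = (-1) ^+ k * (var_poly emb)`_(n - k) by rewrite e signrMK.
by apply: subfM => //; apply: subfX => //; apply: subfN => //; apply: subf1.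
Qed.

Lemma sub_sym_poly (a : {mpoly F[n]}) : a \is symmetric -> S (emb a).
Proof.
move=> /sym_fundamental[t [<- _]]; rewrite comp_mpolyEX rmorph_sum /=.
apply: subf_sum => // m _; rewrite -mul_mpolyC rmorphM /=; apply: subfM => //.
rewrite comp_mpolyX rmorph_prod /=; apply: subf_prod => // i _.
by rewrite rmorphXn /=; apply: subfX => //; rewrite tnth_mktuple; apply: sub_mesym.
Qed.

(** Multiplying the denominator by its other conjugates makes it symmetric; the numerator is then
    symmetric too, and the fundamental theorem on symmetric polynomials applies to both. *)
Lemma sub_sym_inv q : (forall s, act s q = q) -> S q.
Proof.
move=> qi; have [a [b [nb qE]]] := embF q.
pose N := \prod_(s : 'S_n) msym s b; pose M := \prod_(s : 'S_n | s != 1%g) msym s b.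
have NE : N = b * M by rewrite /N (bigD1 1%g) //= msym1m.
have nN : emb N != 0.
  rewrite -(rmorph0 emb) (inj_eq embI); apply/prodf_neq0 => s _.
  by rewrite -(rmorph0 (msym s)) (inj_eq (@inj_msym _ _ s)).
have nB : emb b != 0 by rewrite -(rmorph0 emb) (inj_eq embI).
have qN : q * emb N = emb (a * M) by rewrite qE NE !rmorphM mulrA divfK.
have Ns : N \is symmetric.
  apply/issymP => t; rewrite rmorph_prod /= [RHS](reindex_inj (mulIg t)) /=.
  by apply: eq_bigr => s _; rewrite msymMm.
have As : a * M \is symmetric.
  apply/issymP => t; apply: embI; rewrite -actE -qN rmorphM /= qi actE.
  by move/issymP: Ns => ->.
by rewrite -(mulfK nN q) qN; apply: subfM => //; [|apply: subfV => //]; apply: sub_sym_poly.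
Qed.

(** With [t] a transposition, [q] is half of [q + t q] plus half of [q - t q]. The first is
    symmetric, and the second becomes symmetric after division by [var_disc], as both change sign
    under odd permutations. *)
Lemma sub_alt_inv q : alt_inv act q -> S q.
Proof.
move=> qi.
pose t : 'S_n := tperm (Ordinal (ltnW n_gt1)) (Ordinal n_gt1).
have ot : odd_perm t by rewrite odd_tperm.
have aq s : act s q = if odd_perm s then act t q else q.
  case: ifP => os; last by rewrite qi // os.
  by rewrite -{1}(mulgKV t s) (rat_actM embI embF actE) qi // odd_permM odd_permV os ot.
have at_ s : act s (act t q) = if odd_perm s then q else act t q.
  by rewrite -(rat_actM embI embF actE) aq odd_permM ot; case: odd_perm.
have nd := var_disc_neq0.
have e : q = (q + act t q) / 2%:R + var_disc * ((q - act t q) / var_disc / 2%:R).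
  have key (a b d : L) : d != 0 -> a = (a + b) / 2%:R + d * ((a - b) / d / 2%:R).
    by move=> h; field; rewrite h two_neq0.
  exact: key.
have S2 : S 2%:R^-1 by apply: subfV => //; apply: subfn.
rewrite e; apply: subfD => //; first apply: subfM => //.
  by apply: sub_sym_inv => s; rewrite rmorphD /= (aq s) at_; case: odd_perm; rewrite // addrC.
apply: subfM => //; apply: subfM => //; apply: sub_sym_inv => s.
rewrite rmorphM rmorphB fmorphV /= act_var_disc (aq s) at_; case: odd_perm => /=.
  by rewrite expr1 mulN1r invrN mulrN -mulNr opprB.
by rewrite expr0 mul1r.
Qed.
End AltInvariants.

(** * Values of rational functions at a point *)

Section Specialisation.
Variables (F : fieldType) (n : nat) (L : fieldType) (emb : {rmorphism {mpoly F[n]} -> L}).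
Hypothesis embI : injective emb.
Variable pt : 'I_n -> F.

(* [q] is defined at [pt] with value [v]; used to show that denominators do not vanish. *)
Definition spec (q : L) (v : F) : Prop :=
  exists a b, [/\ b.@[pt] != 0, q = emb a / emb b & v = a.@[pt] / b.@[pt]].

Let nz b : b.@[pt] != 0 -> emb b != 0.
Proof.
by move=> h; rewrite -(rmorph0 emb) (inj_eq embI); apply: contraNneq h => ->; rewrite meval0.
Qed.

Lemma spec_neq0 q v : spec q v -> v != 0 -> q != 0.
Proof.
move=> [a [b [nb -> ->]]]; apply: contraNneq => e; rewrite mulf_eq0; apply/orP; left.
have : emb a = 0 by rewrite -(divfK (nz nb) (emb a)) e mul0r.
by rewrite -(rmorph0 emb) => /embI ->; rewrite meval0.
Qed.
Lemma spec_eq q u v : spec q u -> u = v -> spec q v. Proof. by move=> h <-. Qed.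
Lemma specP a : spec (emb a) a.@[pt].
Proof. by exists a, 1; rewrite meval1 rmorph1 !divr1 oner_neq0. Qed.
Lemma specX i : spec (emb 'X_i) (pt i).
Proof. by have := specP 'X_i; rewrite mevalXU. Qed.
Lemma spec_nat k : spec k%:R k%:R.
Proof. by have := specP k%:R; rewrite !rmorph_nat. Qed.
Lemma spec1 : spec 1 1. Proof. exact: (spec_nat 1). Qed.
Lemma specD q r u v : spec q u -> spec r v -> spec (q + r) (u + v).
Proof.
move=> [a [b [nb -> ->]]] [c [d [nd -> ->]]]; exists (a * d + c * b), (b * d).
rewrite mevalM mulf_neq0 //; split=> //; first by rewrite rmorphD !rmorphM addf_div ?nz.
by rewrite mevalD !mevalM addf_div.
Qed.
Lemma specM q r u v : spec q u -> spec r v -> spec (q * r) (u * v).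
Proof.
move=> [a [b [nb -> ->]]] [c [d [nd -> ->]]]; exists (a * c), (b * d).
by rewrite !mevalM mulf_neq0 // !rmorphM !mulf_div.
Qed.
Lemma specN q u : spec q u -> spec (- q) (- u).
Proof. by move=> [a [b [nb -> ->]]]; exists (- a), b; rewrite mevalN rmorphN !mulNr. Qed.
Lemma specXn q u k : spec q u -> spec (q ^+ k) (u ^+ k).
Proof. by move=> h; elim: k => [|k IH]; [apply: spec1|rewrite !exprS; apply: specM]. Qed.
Lemma specV q u : spec q u -> u != 0 -> spec q^-1 u^-1.
Proof.
move=> [a [b [nb qE uE]]] nu; exists b, a.
have na : a.@[pt] != 0 by apply: contraNneq nu => a0; rewrite uE a0 mul0r.
by rewrite na qE uE !invf_div.
Qed.
End Specialisation.

Ltac subfield HS :=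
  repeat first [ assumption | exact: (subfn HS) | exact: (subf1 HS) | exact: (subf0 HS)
    | apply: (subfD HS) | apply: (subfN HS) | apply: (subfM HS) | apply: (subfV HS)
    | apply: (subfX HS) ].

Ltac spec_eval embI :=
  repeat first [ eassumption | exact: spec_nat | exact: spec1
    | eapply (specD embI) | eapply specN | eapply specM | eapply specXn | eapply specV ].

Lemma Poly3E (L : comNzRingType) (a b c : L) :
  ('X - a%:P) * (('X - b%:P) * ('X - c%:P)) =
  Poly [:: - (a * b * c); a * b + a * c + b * c; - (a + b + c); 1].
Proof. by rewrite /= !cons_poly_def; ring. Qed.

Lemma pchar_nat_neq0 (F : fieldType) p k : p \in [pchar F] -> (0 < k < p)%N -> k%:R != 0 :> F.
Proof. by move=> Fp /andP[k0 kp]; rewrite -(dvdn_pcharf Fp) gtnNdvd. Qed.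

Lemma emb_nat_neq0 (F L : fieldType) n (emb : {rmorphism {mpoly F[n]} -> L}) p k :
  p \in [pchar F] -> (0 < k < p)%N -> k%:R != 0 :> L.
Proof.
by move=> Fp kp; rewrite -(rmorph_nat (emb \o @mpolyC n F)) fmorph_eq0 (pchar_nat_neq0 Fp).
Qed.

(** * Degree 3 *)

Section Cubic.
Variable L : fieldType.
Variables a b c : L.
Hypothesis n2 : 2%:R != 0 :> L.
Hypothesis n3 : 3%:R != 0 :> L.
Definition cubic_e1 := a + b + c.
Definition cubic_e2 := a * b + a * c + b * c.
Definition cubic_e3 := a * b * c.
Definition cubic_dl := (b - a) * (c - a) * (c - b).
(** The variables minus their mean are the roots of [T^3 + cubic_p T - cubic_q]. *)
Definition cubic_p := cubic_e2 - cubic_e1 ^+ 2 / 3%:R.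
Definition cubic_q := cubic_e3 - cubic_e1 * cubic_e2 / 3%:R + 2%:R * cubic_e1 ^+ 3 / 3%:R ^+ 3.
Hypothesis np : cubic_p != 0.

Let n27 : 27%:R != 0 :> L.
Proof. by rewrite (_ : 27%:R = 3%:R ^+ 3); [rewrite expf_neq0|ring]. Qed.
Let n4 : 4%:R != 0 :> L.
Proof. by rewrite (_ : 4%:R = 2%:R ^+ 2); [rewrite expf_neq0|ring]. Qed.

Lemma cubic_disc : cubic_dl ^+ 2 = - 4%:R * cubic_p ^+ 3 - 27%:R * cubic_q ^+ 2.
Proof. by rewrite /cubic_dl /cubic_q /cubic_p /cubic_e1 /cubic_e2 /cubic_e3; field; rewrite n27 n3. Qed.

(** Divided by [cubic_p ^+ 2], the discriminant formula becomes linear in [cubic_p], with the two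
    ratios as data. *)
Lemma cubic_pE : cubic_p = - ((cubic_dl / cubic_p) ^+ 2 + 27%:R * (cubic_q / cubic_p) ^+ 2) / 2%:R ^+ 2.
Proof.
rewrite exprMn cubic_disc; move: np; move: cubic_p cubic_q => P Q nP; field.
by rewrite nP n4.
Qed.

Variable S : L -> Prop.
Hypothesis HS : subfield_closed S.
Hypothesis S1 : S cubic_e1.
Hypothesis S2 : S (cubic_q / cubic_p).
Hypothesis S3 : S (cubic_dl / cubic_p).
Lemma cubic_rational : [/\ S cubic_e2, S cubic_e3 & S cubic_dl].
Proof.
have Sp : S cubic_p by rewrite cubic_pE; subfield HS.
have Sq : S cubic_q by rewrite -(divfK np cubic_q); subfield HS.
have S2' : S cubic_e2.
  have -> : cubic_e2 = cubic_p + cubic_e1 ^+ 2 / 3%:R by rewrite /cubic_p subrK.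
  by subfield HS.
split=> //; last by rewrite -(divfK np cubic_dl); subfield HS.
have -> : cubic_e3 = cubic_q + cubic_e1 * cubic_e2 / 3%:R - 2%:R * cubic_e1 ^+ 3 / 3%:R ^+ 3.
  by rewrite /cubic_q; ring.
by subfield HS.
Qed.
End Cubic.

Lemma alt_rational3 (F : fieldType) p : p \in [pchar F] -> (5 < p)%N -> alt_rational F 3.
Proof.
move=> Fp p5 L emb embI embF act actE.
have n2 : 2%:R != 0 :> L by apply: (emb_nat_neq0 emb Fp); lia.
have n3 : 3%:R != 0 :> L by apply: (emb_nat_neq0 emb Fp); lia.
have x3 : 3%:R != 0 :> F by apply: (pchar_nat_neq0 Fp); lia.
pose a := emb 'X_ord0; pose b := emb 'X_(lift ord0 ord0); pose c := emb 'X_(lift ord0 (lift ord0 ord0)).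
have VP : var_poly emb = Poly [:: - cubic_e3 a b c; cubic_e2 a b c; - cubic_e1 a b c; 1].
  by rewrite /var_poly !big_ord_recl big_ord0 mulr1 Poly3E.
have VD : var_disc emb = cubic_dl a b c.
  rewrite /var_disc; under eq_bigr => i _ do rewrite big_mkcond.
  by rewrite !big_ord_recl !big_ord0 /= !mul1r !mulr1.
have np : cubic_p a b c != 0.
  (* The point (0, 1, -1) gives [T^3 - T], where [cubic_p] is -1. *)
  pose pt (i : 'I_3) : F := if i == 0 :> nat then 0 else if i == 1 :> nat then 1 else -1.
  have sa : spec emb pt a 0 by apply: specX.
  have sb : spec emb pt b 1 by apply: specX.
  have sc : spec emb pt c (-1) by apply: specX.
  have : spec emb pt (cubic_p a b c) (-1).
    apply: spec_eq; first by rewrite /cubic_p /cubic_e1 /cubic_e2; spec_eval embI.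
    by field.
  by move/(spec_neq0 embI); apply; rewrite oppr_eq0 oner_neq0.
exists (fun i => nth 0 [:: cubic_e1 a b c; cubic_q a b c / cubic_p a b c; cubic_dl a b c / cubic_p a b c] i).
split.
  have HS := alt_inv_subfield act.
  have S1 : alt_inv act (cubic_e1 a b c).
    by rewrite -[cubic_e1 _ _ _]opprK; apply: (subfN HS); have := alt_inv_coef actE 2; rewrite VP coef_Poly.
  have S2 : alt_inv act (cubic_e2 a b c) by have := alt_inv_coef actE 1; rewrite VP coef_Poly.
  have S3 : alt_inv act (cubic_e3 a b c).
    by rewrite -[cubic_e3 _ _ _]opprK; apply: (subfN HS); have := alt_inv_coef actE 0; rewrite VP coef_Poly.
  have Sd : alt_inv act (cubic_dl a b c) by rewrite -VD; apply: alt_inv_disc.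
  by case=> [[|[|[|//]]] /= _] //; rewrite /cubic_p /cubic_q; subfield HS.
move=> q qi S HS Sc Sf.
have S1 : S (cubic_e1 a b c) := Sf ord0.
have S2 : S (cubic_q a b c / cubic_p a b c) := Sf (lift ord0 ord0).
have S3 : S (cubic_dl a b c / cubic_p a b c) := Sf (lift ord0 (lift ord0 ord0)).
have [Se2 Se3 Sdl] := cubic_rational n2 n3 np HS S1 S2 S3.
apply: (sub_alt_inv embI embF actE _ n2 HS Sc) qi => //; last by rewrite VD.
by move=> k; rewrite VP coef_Poly; case: k => [|[|[|[|k]]]] /=; rewrite ?nth_nil; subfield HS.
Qed.

(** * Degree 4 *)

Lemma Poly4E (L : comNzRingType) (a b c d : L) :
  ('X - a%:P) * (('X - b%:P) * (('X - c%:P) * ('X - d%:P))) =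
  Poly [:: a * b * c * d; - (a * b * c + a * b * d + a * c * d + b * c * d);
    a * b + a * c + a * d + b * c + b * d + c * d; - (a + b + c + d); 1].
Proof. by rewrite /= !cons_poly_def; ring. Qed.

Section Quartic.
Variable L : fieldType.
Variables a b c d : L.
Hypothesis n2 : 2%:R != 0 :> L.
Hypothesis n3 : 3%:R != 0 :> L.
Definition quartic_e1 := a + b + c + d.
Definition quartic_e2 := a * b + a * c + a * d + b * c + b * d + c * d.
Definition quartic_e3 := a * b * c + a * b * d + a * c * d + b * c * d.
Definition quartic_e4 := a * b * c * d.
Definition quartic_dl := (b - a) * (c - a) * (d - a) * (c - b) * (d - b) * (d - c).
Let h := quartic_e1 / 4%:R.
(** The variables minus their mean [h] are the roots of [T^4 + p T^2 + q T + r] with these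
    coefficients. *)
Definition quartic_p := quartic_e2 - 3%:R * h * quartic_e1 + 6%:R * h ^+ 2.
Definition quartic_q :=
  - (quartic_e3 - 2%:R * h * quartic_e2 + 3%:R * h ^+ 2 * quartic_e1 - 4%:R * h ^+ 3).
Definition quartic_r :=
  quartic_e4 - h * quartic_e3 + h ^+ 2 * quartic_e2 - h ^+ 3 * quartic_e1 + h ^+ 4.
(** With [quartic_J], the classical invariants of degrees two and three of a binary quartic, up to
    sign. *)
Definition quartic_I := quartic_p ^+ 2 + 12%:R * quartic_r.
Definition quartic_J :=
  2%:R * quartic_p ^+ 3 - 72%:R * quartic_p * quartic_r + 27%:R * quartic_q ^+ 2.
Hypothesis np : quartic_p != 0.
Hypothesis nq : quartic_q != 0.
Hypothesis nI : quartic_I != 0.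

Let n4 : 4%:R != 0 :> L.
Proof. by rewrite (_ : 4%:R = 2%:R ^+ 2); [rewrite expf_neq0|ring]. Qed.
Let n27 : 27%:R != 0 :> L.
Proof. by rewrite (_ : 27%:R = 3%:R ^+ 3); [rewrite expf_neq0|ring]. Qed.

Lemma quartic_disc : 27%:R * quartic_dl ^+ 2 = 4%:R * quartic_I ^+ 3 - quartic_J ^+ 2.
Proof.
(* In centred coordinates, the last of them eliminated, the shift [h] cancels from the identity. *)
pose z0 := a - h; pose z1 := b - h; pose z2 := c - h.
have [ea eb ec] : [/\ a = z0 + h, b = z1 + h & c = z2 + h] by rewrite /z0 /z1 /z2 !subrK.
have ed : d = - (z0 + z1 + z2) + h.
  by rewrite /z0 /z1 /z2 /h /quartic_e1; field; rewrite n4.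
have hE : quartic_e1 = 4%:R * h by rewrite /h; field; rewrite n4.
rewrite /quartic_J /quartic_I /quartic_r /quartic_q /quartic_p hE.
rewrite /quartic_dl /quartic_e2 /quartic_e3 /quartic_e4; move: h ea eb ec ed => h' -> -> -> ->.
by ring.
Qed.

Let U := quartic_J / (quartic_I * quartic_p).
Let V := quartic_dl / (quartic_I * quartic_p).
Let M := (27%:R * V ^+ 2 + U ^+ 2) / 4%:R.

(** Dividing [27 dl^2 + J^2 = 4 I^3] by [(I p)^2] leaves a relation linear in [I]. *)
Lemma quartic_IE : quartic_I = quartic_p ^+ 2 * M.
Proof.
rewrite /M /U /V !expr_div_n [27%:R * (_ / _)]mulrA quartic_disc; move: np nI.
by move: quartic_p quartic_I quartic_J => P I' J' nP' nI'; field; rewrite nP' nI' n4.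
Qed.

(** Here [I = p^2 M] and [J = p^3 U M]. Eliminating [r] from [I] and [J] gives
    [27 q^2 = p^3 (U M + 6 M - 8)], and division by [p^2] makes this linear in [p]. *)
Lemma quartic_pE :
  quartic_p = 27%:R * (quartic_q / quartic_p) ^+ 2 / (U * M + 6%:R * M - 8%:R).
Proof.
have e : 27%:R * quartic_q ^+ 2 = quartic_p ^+ 3 * (U * M + 6%:R * M - 8%:R).
  have -> : M = quartic_I / quartic_p ^+ 2.
    by rewrite quartic_IE mulrAC divff ?mul1r // expf_neq0.
  have -> : 27%:R * quartic_q ^+ 2 = quartic_J - 8%:R * quartic_p ^+ 3 + 6%:R * quartic_p * quartic_I.
    by rewrite /quartic_J /quartic_I; ring.
  rewrite /U; move: np nI; move: quartic_p quartic_I quartic_J => P I' J' nP' nI'.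
  by field; rewrite nP' nI'.
have nD : U * M + 6%:R * M - 8%:R != 0.
  have : 27%:R * quartic_q ^+ 2 != 0 by rewrite mulf_neq0 // expf_neq0.
  by rewrite e mulf_eq0 negb_or => /andP[].
rewrite expr_div_n mulrA e; move: nD np; move: (U * M + _ - _) quartic_p => D P nD nP'.
by field; rewrite nD nP'.
Qed.

Variable S : L -> Prop.
Hypothesis HS : subfield_closed S.
Hypothesis S1 : S quartic_e1.
Hypothesis S2 : S (quartic_q / quartic_p).
Hypothesis S3 : S (quartic_J / (quartic_I * quartic_p)).
Hypothesis S4 : S (quartic_dl / (quartic_I * quartic_p)).
Lemma quartic_rational : [/\ S quartic_e2, S quartic_e3, S quartic_e4 & S quartic_dl].
Proof.
have SM : S M by rewrite /M /U /V; subfield HS.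
have Sp : S quartic_p by rewrite quartic_pE /U; subfield HS.
have Sq : S quartic_q by rewrite -(divfK np quartic_q); subfield HS.
have SI : S quartic_I by rewrite quartic_IE; subfield HS.
have n12 : 12%:R != 0 :> L.
  by rewrite (_ : 12%:R = 2%:R ^+ 2 * 3%:R); [rewrite mulf_neq0 ?expf_neq0|ring].
have Sr : S quartic_r.
  have -> : quartic_r = (quartic_I - quartic_p ^+ 2) / 12%:R.
    by rewrite /quartic_I; move: quartic_p quartic_r => P R'; field; rewrite n12.
  by subfield HS.
have Sh : S h by rewrite /h; subfield HS.
have Se2 : S quartic_e2.
  have -> : quartic_e2 = quartic_p + 3%:R * h * quartic_e1 - 6%:R * h ^+ 2 by rewrite /quartic_p; ring.
  by subfield HS.
have Se3 : S quartic_e3.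
  have -> : quartic_e3 = - quartic_q + 2%:R * h * quartic_e2 - 3%:R * h ^+ 2 * quartic_e1 + 4%:R * h ^+ 3.
    by rewrite /quartic_q; ring.
  by subfield HS.
split=> //.
  have -> : quartic_e4 = quartic_r + h * quartic_e3 - h ^+ 2 * quartic_e2 + h ^+ 3 * quartic_e1 - h ^+ 4.
    by rewrite /quartic_r; ring.
  by subfield HS.
by rewrite -(divfK (mulf_neq0 nI np) quartic_dl); subfield HS.
Qed.
End Quartic.

Lemma alt_rational4 (F : fieldType) p : p \in [pchar F] -> (5 < p)%N -> alt_rational F 4.
Proof.
move=> Fp p5 L emb embI embF act actE.
have n2 : 2%:R != 0 :> L by apply: (emb_nat_neq0 emb Fp); lia.
have n3 : 3%:R != 0 :> L by apply: (emb_nat_neq0 emb Fp); lia.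
have x2 : 2%:R != 0 :> F by apply: (pchar_nat_neq0 Fp); lia.
have x3 : 3%:R != 0 :> F by apply: (pchar_nat_neq0 Fp); lia.
have x4 : 4%:R != 0 :> F by apply: (pchar_nat_neq0 Fp); lia.
pose a := emb 'X_ord0; pose b := emb 'X_(lift ord0 ord0); pose c := emb 'X_(lift ord0 (lift ord0 ord0)).
pose d := emb 'X_(lift ord0 (lift ord0 (lift ord0 ord0))).
pose e1 := quartic_e1 a b c d; pose e2 := quartic_e2 a b c d.
pose e3 := quartic_e3 a b c d; pose e4 := quartic_e4 a b c d; pose dl := quartic_dl a b c d.
pose P := quartic_p a b c d; pose Q := quartic_q a b c d.
pose I := quartic_I a b c d; pose J := quartic_J a b c d.
have VP : var_poly emb = Poly [:: e4; - e3; e2; - e1; 1].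
  by rewrite /var_poly !big_ord_recl big_ord0 mulr1 Poly4E.
have VD : var_disc emb = dl.
  rewrite /var_disc; under eq_bigr => i _ do rewrite big_mkcond.
  by rewrite !big_ord_recl !big_ord0 /= !mul1r !mulr1 !mulrA.
(* The quartic [T^4 - 3 T^2 + 2 T]; its double root is harmless, since only [P], [Q] and [I] have to
   be nonzero. *)
pose pt (i : 'I_4) : F := nth 0 [:: 0; 1; 1; - 2%:R] i.
have sa : spec emb pt a 0 by apply: specX.
have sb : spec emb pt b 1 by apply: specX.
have sc : spec emb pt c 1 by apply: specX.
have sd : spec emb pt d (- 2%:R) by apply: specX.
have s1 : spec emb pt e1 0.
  by apply: spec_eq; [rewrite /e1 /quartic_e1; spec_eval embI|ring].
have s2 : spec emb pt e2 (- 3%:R).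
  by apply: spec_eq; [rewrite /e2 /quartic_e2; spec_eval embI|ring].
have s3 : spec emb pt e3 (- 2%:R).
  by apply: spec_eq; [rewrite /e3 /quartic_e3; spec_eval embI|ring].
have s4 : spec emb pt e4 0.
  by apply: spec_eq; [rewrite /e4 /quartic_e4; spec_eval embI|ring].
have sp : spec emb pt P (- 3%:R).
  by apply: spec_eq; [rewrite /P /quartic_p -/e1 -/e2; spec_eval embI|field].
have sq : spec emb pt Q 2%:R.
  by apply: spec_eq; [rewrite /Q /quartic_q -/e1 -/e2 -/e3; spec_eval embI|field].
have sr : spec emb pt (quartic_r a b c d) 0.
  by apply: spec_eq; [rewrite /quartic_r -/e1 -/e2 -/e3 -/e4; spec_eval embI|field].
have sI : spec emb pt I (3%:R ^+ 2).
  by apply: spec_eq; [rewrite /I /quartic_I -/P; spec_eval embI|ring].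
have np : P != 0 by apply: (spec_neq0 embI sp); rewrite oppr_eq0.
have nq : Q != 0 by apply: (spec_neq0 embI sq).
have nI : I != 0 by apply: (spec_neq0 embI sI); rewrite expf_neq0.
exists (fun i => nth 0 [:: e1; Q / P; J / (I * P); dl / (I * P)] i).
split.
  have HS := alt_inv_subfield act.
  have S1 : alt_inv act e1.
    by rewrite -[e1]opprK; apply: (subfN HS); have := alt_inv_coef actE 3; rewrite VP coef_Poly.
  have S2 : alt_inv act e2 by have := alt_inv_coef actE 2; rewrite VP coef_Poly.
  have S3 : alt_inv act e3.
    by rewrite -[e3]opprK; apply: (subfN HS); have := alt_inv_coef actE 1; rewrite VP coef_Poly.
  have S4 : alt_inv act e4 by have := alt_inv_coef actE 0; rewrite VP coef_Poly.
  have Sd : alt_inv act dl by rewrite -VD; apply: alt_inv_disc.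
  have SP : alt_inv act P by rewrite /P /quartic_p -/e1 -/e2; subfield HS.
  have SQ : alt_inv act Q by rewrite /Q /quartic_q -/e1 -/e2 -/e3; subfield HS.
  have SR : alt_inv act (quartic_r a b c d).
    by rewrite /quartic_r -/e1 -/e2 -/e3 -/e4; subfield HS.
  have SI : alt_inv act I by rewrite /I /quartic_I -/P; subfield HS.
  have SJ : alt_inv act J by rewrite /J /quartic_J -/P -/Q; subfield HS.
  by case=> [[|[|[|[|//]]]] /= _] //; subfield HS.
move=> q qi S HS Sc Sf.
have S1 : S e1 := Sf ord0.
have S2 : S (Q / P) := Sf (lift ord0 ord0).
have S3 : S (J / (I * P)) := Sf (lift ord0 (lift ord0 ord0)).
have S4 : S (dl / (I * P)) := Sf (lift ord0 (lift ord0 (lift ord0 ord0))).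
have [Se2 Se3 Se4 Sdl] := quartic_rational n2 n3 np nq nI HS S1 S2 S3 S4.
apply: (sub_alt_inv embI embF actE _ n2 HS Sc) qi => //; last by rewrite VD.
by move=> k; rewrite VP coef_Poly; case: k => [|[|[|[|[|k]]]]] /=; rewrite ?nth_nil; subfield HS.
Qed.

(* For a root [r] of [T^3 + a T + b] and [c = k0 + k1 r + k2 r^2]: [cub_t1], [cub_t2],
   [cub_t3] are the elementary symmetric functions of the conjugates of [c], and
   [r = A + cub_B c + cub_C c^2] for some [A]. *)
Section CubicAlgebra.
Variable L : fieldType.
Variables a b k0 k1 k2 : L.
(** The determinant of [1, c, c^2] over the basis [1, r, r^2]; if it is nonzero, [r] is a polynomial
    in [c]. *)
Definition cub_index := k1 ^+ 3 + a * k1 * k2 ^+ 2 + b * k2 ^+ 3.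
Definition cub_s1 := - 2 * a * k2.
Definition cub_s2 := a * k1 ^+ 2 + 3 * b * k1 * k2 + a ^+ 2 * k2 ^+ 2.
Definition cub_s3 := - b * k1 ^+ 3 - a * b * k1 * k2 ^+ 2 + b ^+ 2 * k2 ^+ 3.
Definition cub_t1 := 3 * k0 + cub_s1.
Definition cub_t2 := 3 * k0 ^+ 2 + 2 * k0 * cub_s1 + cub_s2.
Definition cub_t3 := k0 ^+ 3 + k0 ^+ 2 * cub_s1 + k0 * cub_s2 + cub_s3.
Definition cub_B := (2 * k0 * k2 + k1 ^+ 2 - a * k2 ^+ 2) / cub_index.
Definition cub_C := - k2 / cub_index.
End CubicAlgebra.
(* Conversely, for a root [c] of [T^3 - t1 T^2 + t2 T - t3], the element
   [r = inv_A + B c + C c^2] has trace zero and is a root of [T^3 + inv_a T + inv_b], and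
   [inv_g1], [inv_g2] are the coefficients of [c] and [c^2] in [r^2]. *)
Section CubicRecover.
Variable L : fieldType.
Variables t1 t2 t3 B C : L.
Definition inv_E1 := B * t1 + C * (t1 ^+ 2 - 2 * t2).
Definition inv_A := - inv_E1 / 3.
Definition inv_E2 := B ^+ 2 * t2 + B * C * (t1 * t2 - 3 * t3) + C ^+ 2 * (t2 ^+ 2 - 2 * t1 * t3).
Definition inv_E3 := t3 * (B ^+ 3 + B ^+ 2 * C * t1 + B * C ^+ 2 * t2 + C ^+ 3 * t3).
Definition inv_a := 3 * inv_A ^+ 2 + 2 * inv_A * inv_E1 + inv_E2.
Definition inv_b := - (inv_A ^+ 3 + inv_A ^+ 2 * inv_E1 + inv_A * inv_E2 + inv_E3).
Definition inv_g2 := 2 * inv_A * C + B ^+ 2 + 2 * B * C * t1 + C ^+ 2 * (t1 ^+ 2 - t2).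
Definition inv_g1 := 2 * inv_A * B - 2 * B * C * t2 + C ^+ 2 * (t3 - t1 * t2).
(** The determinant of [1, r, r^2] over [1, c, c^2], the inverse of [cub_index]. *)
Definition inv_d := B * inv_g2 - C * inv_g1.
End CubicRecover.
Section CubicInverse.
Variable L : fieldType.
Variables a b k0 k1 k2 : L.
Hypothesis n3 : 3%:R != 0 :> L.
Let d := cub_index a b k1 k2.
Hypothesis nd : cub_index a b k1 k2 != 0.
Let t1 := cub_t1 a k0 k2.
Let t2 := cub_t2 a b k0 k1 k2.
Let t3 := cub_t3 a b k0 k1 k2.
Let B := cub_B a b k0 k1 k2.
Let C := cub_C a b k1 k2.
Ltac unf := rewrite /t1 /t2 /t3 /B /C /inv_d /inv_g1 /inv_g2 /inv_a /inv_b /inv_E3 /inv_E2 /inv_A /inv_E1 /cub_t1 /cub_t2 /cub_t3 /cub_B /cub_C /cub_s1 /cub_s2 /cub_s3 /cub_index.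
Lemma inv_aE : inv_a t1 t2 t3 B C = a.
Proof. by unf; field; rewrite nd n3. Qed.
Lemma inv_bE : inv_b t1 t2 t3 B C = b.
Proof. by unf; field; rewrite nd n3. Qed.
Lemma inv_dE : inv_d t1 t2 t3 B C = d^-1.
Proof. rewrite /d. by unf; field; rewrite nd n3. Qed.
(** The two base changes are inverse matrices, so an entry of one is a cofactor of the other divided
    by the determinant. *)
Lemma inv_g2E : inv_g2 t1 t2 B C = k1 / d.
Proof. rewrite /d. by unf; field; rewrite nd n3. Qed.

End CubicInverse.
(* Sylvester's form [\sum_i a_i (T - r_i)^5], [\sum_i a_i = 1], of a quintic without T^4 term.
   In the coordinate centered at the mean [- n1] of the [r_i], these are the roots of
   [T^3 + a T + b], the numerator of [\sum_i a_i / (T - r_i)] is [T^2 + n1 T + n0], and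
   [syl_M]k is the moment [\sum_i a_i r_i^k]; [syl_P]k is the same moment about the origin.
   With [r = r_i], [syl_m] represents [N(r_j) N(r_k)], [syl_v] represents [(r_j - r_k)^4], and
   [syl_q] their product, as polynomials of degree 2 in [r]. *)
Section Sylvester.
Variable L : fieldType.
Variables a b n0 n1 : L.
Definition syl_m2 := a - n0 + n1 ^+ 2.
Definition syl_m1 := - (b + n0 * n1).
Definition syl_m0 := a ^+ 2 + n1 * b - 2 * a * n0 + a * n1 ^+ 2 + n0 ^+ 2.
(** The product of [N] over the three [r_i], as the constant coefficient of [N(r)] times the
    polynomial of [syl_m]. *)
Definition syl_norm := syl_m0 * n0 - b * (syl_m1 + syl_m2 * n1).
Definition syl_v2 := 15 * a.
Definition syl_v1 := - 9 * b.
Definition syl_v0 := 16 * a ^+ 2.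
Definition syl_w3 := syl_v1 * syl_m2 + syl_v2 * syl_m1.
Definition syl_w4 := syl_v2 * syl_m2.
Definition syl_q0 := syl_v0 * syl_m0 - b * syl_w3.
Definition syl_q1 := syl_v0 * syl_m1 + syl_v1 * syl_m0 - a * syl_w3 - b * syl_w4.
Definition syl_q2 := syl_v0 * syl_m2 + syl_v1 * syl_m1 + syl_v2 * syl_m0 - a * syl_w4.
Definition syl_M1 := n1.
Definition syl_M2 := n0 - a.
Definition syl_M3 := - a * syl_M1 - b.
Definition syl_M4 := - a * syl_M2 - b * syl_M1.
Definition syl_M5 := - a * syl_M3 - b * syl_M2.
Let r := - n1.
Definition syl_P2 := syl_M2 + 2 * r * syl_M1 + r ^+ 2.
Definition syl_P3 := syl_M3 + 3 * r * syl_M2 + 3 * r ^+ 2 * syl_M1 + r ^+ 3.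
Definition syl_P4 := syl_M4 + 4 * r * syl_M3 + 6 * r ^+ 2 * syl_M2 + 4 * r ^+ 3 * syl_M1 + r ^+ 4.
Definition syl_P5 := syl_M5 + 5 * r * syl_M4 + 10 * r ^+ 2 * syl_M3 + 10 * r ^+ 3 * syl_M2 + 5 * r ^+ 4 * syl_M1 + r ^+ 5.
(* The discriminant of [T^5 + p T^3 + q T^2 + r T + s]. *)
Definition disc5 (p q r s : L) :=
 108 * p^+5 * s^+2 - 72 * p^+4 * q * r * s + 16 * p^+4 * r^+3 + 16 * p^+3 * q^+3 * s - 4 * p^+3 * q^+2 * r^+2 - 900 * p^+3 * r * s^+2 + 825 * p^+2 * q^+2 * s^+2 + 560 * p^+2 * q * r^+2 * s - 128 * p^+2 * r^+4 - 630 * p * q^+3 * r * s + 144 * p * q^+2 * r^+3 - 3750 * p * q * s^+3 + 2000 * p * r^+2 * s^+2 + 108 * q^+5 * s - 27 * q^+4 * r^+2 + 2250 * q^+2 * r * s^+2 - 1600 * q * r^+3 * s + 256 * r^+5 + 3125 * s^+4.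
Definition syl_t1 := cub_t1 a syl_q0 syl_q2.
Definition syl_t2 := cub_t2 a b syl_q0 syl_q1 syl_q2.
Definition syl_t3 := cub_t3 a b syl_q0 syl_q1 syl_q2.
Lemma syl_disc : 3125 * ((syl_t1 ^+ 2 - 4 * syl_t2) ^+ 2 - 128 * syl_t1 * syl_t3) =
  disc5 (10 * syl_P2) (- 10 * syl_P3) (5 * syl_P4) (- syl_P5) * (- 4 * a ^+ 3 - 27 * b ^+ 2) ^+ 2.
Proof.
rewrite /disc5 /syl_t1 /syl_t2 /syl_t3 /cub_t1 /cub_t2 /cub_t3 /cub_s1 /cub_s2 /cub_s3.
rewrite /syl_q0 /syl_q1 /syl_q2 /syl_w3 /syl_w4 /syl_v0 /syl_v1 /syl_v2 /syl_m0 /syl_m1 /syl_m2.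
rewrite /syl_P2 /syl_P3 /syl_P4 /syl_P5 /syl_M5 /syl_M4 /syl_M3 /syl_M2 /syl_M1 /r.
by ring. Qed.
End Sylvester.

(** * Degree 5: recovering the parameters of Sylvester's form *)

Section Recover.
Variable L : fieldType.
Variables a b n0 n1 dl : L.
Hypothesis n2 : 2%:R != 0 :> L.
Hypothesis n3 : 3%:R != 0 :> L.
Hypothesis n5 : 5%:R != 0 :> L.
Let t1 := syl_t1 a b n0 n1.
Let dg := - 4%:R * a ^+ 3 - 27%:R * b ^+ 2.
(** The coefficients of [c] after scaling its trace [t1] to 1. *)
Definition syl_k0 := syl_q0 a b n0 n1 / t1.
Definition syl_k1 := syl_q1 a b n0 n1 / t1.
Definition syl_k2 := syl_q2 a b n0 n1 / t1.
Local Notation k0 := syl_k0.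
Local Notation k1 := syl_k1.
Local Notation k2 := syl_k2.
Definition syl_T2 := cub_t2 a b k0 k1 k2.
Definition syl_B := cub_B a b k0 k1 k2.
Definition syl_C := cub_C a b k1 k2.
Definition syl_w := dl * dg / t1 ^+ 2.
Definition syl_det :=
  k1 * (k1 * (- 16%:R * a ^+ 2) - 9%:R * b * k0)
  - k2 * ((k0 - a * k2) * (- 16%:R * a ^+ 2) - 9%:R * b * (- b * k2))
  - 15%:R * a * ((k0 - a * k2) * k0 - k1 * (- b * k2)).
Hypothesis nt1 : t1 != 0.
Hypothesis ndg : dg != 0.
Hypothesis nd : cub_index a b k1 k2 != 0.
Hypothesis ndet : syl_det != 0.
Hypothesis dl2 : dl ^+ 2 =
  disc5 (10%:R * syl_P2 a n0 n1) (- 10%:R * syl_P3 a b n0 n1) (5%:R * syl_P4 a b n0 n1)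
    (- syl_P5 a b n0 n1).

Let T3 := cub_t3 a b k0 k1 k2.

Let t1_1 : cub_t1 a k0 k2 = 1.
Proof.
rewrite /cub_t1 /cub_s1 /syl_k0 /syl_k2.
rewrite (_ : _ + _ = (3%:R * syl_q0 a b n0 n1 + - 2%:R * a * syl_q2 a b n0 n1) / t1); last by ring.
exact: divff.
Qed.

Let n3125 : 3125%:R != 0 :> L.
Proof. by rewrite (_ : 3125%:R = 5%:R ^+ 5); [rewrite expf_neq0|ring]. Qed.
Let n128 : 128%:R != 0 :> L.
Proof. by rewrite (_ : 128%:R = 2%:R ^+ 7); [rewrite expf_neq0|ring]. Qed.

(** This is [syl_disc] divided by [t1 ^+ 4] and solved for the scaled third symmetric function, in
    which it is linear. *)
Let T3E : T3 = ((1 - 4%:R * syl_T2) ^+ 2 - syl_w ^+ 2 / 3125%:R) / 128%:R.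
Proof.
have e := syl_disc a b n0 n1; rewrite -dl2 -/t1 -/dg in e.
have -> : syl_w ^+ 2 = 3125%:R * ((t1 ^+ 2 - 4%:R * syl_t2 a b n0 n1) ^+ 2
    - 128%:R * t1 * syl_t3 a b n0 n1) / t1 ^+ 4.
  rewrite e /syl_w; move: nt1; move: dg t1 => g' t nt; field; by rewrite nt.
have -> : syl_T2 = syl_t2 a b n0 n1 / t1 ^+ 2.
  rewrite /syl_T2 /syl_t2 /syl_k0 /syl_k1 /syl_k2 /cub_t2 /cub_s2 /cub_s1; move: nt1.
  move: (syl_q0 _ _ _ _) (syl_q1 _ _ _ _) (syl_q2 _ _ _ _) t1 => q0 q1 q2 t nt.
  by field; rewrite nt.
have -> : T3 = syl_t3 a b n0 n1 / t1 ^+ 3.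
  rewrite /T3 /syl_t3 /syl_k0 /syl_k1 /syl_k2 /cub_t3 /cub_s3 /cub_s2 /cub_s1; move: nt1.
  move: (syl_q0 _ _ _ _) (syl_q1 _ _ _ _) (syl_q2 _ _ _ _) t1 => q0 q1 q2 t nt.
  by field; rewrite nt.
move: nt1 n3125 n128; move: (syl_t2 _ _ _ _) (syl_t3 _ _ _ _) t1 => u v t nt h1 h2.
by field; rewrite nt h1 h2.
Qed.

(* [N(r) c / t1 = kap (r_j - r_k)^4], compared coefficientwise in powers of [r], is a linear
   system for [n1], [n0] and [kap]; [syl_det] is its determinant. *)
Let kap := syl_norm a b n0 n1 / t1.
Let lin1 : k1 * n1 + k2 * n0 - 15%:R * a * kap = - (k0 - a * k2).
Proof.
rewrite /kap /syl_k0 /syl_k1 /syl_k2; move: nt1; move: t1 => t nt.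
rewrite /syl_norm /syl_q0 /syl_q1 /syl_q2 /syl_w3 /syl_w4 /syl_v0 /syl_v1 /syl_v2.
by rewrite /syl_m0 /syl_m1 /syl_m2; field; rewrite nt.
Qed.
Let lin2 : (k0 - a * k2) * n1 + k1 * n0 + 9%:R * b * kap = a * k1 + b * k2.
Proof.
rewrite /kap /syl_k0 /syl_k1 /syl_k2; move: nt1; move: t1 => t nt.
rewrite /syl_norm /syl_q0 /syl_q1 /syl_q2 /syl_w3 /syl_w4 /syl_v0 /syl_v1 /syl_v2.
by rewrite /syl_m0 /syl_m1 /syl_m2; field; rewrite nt.
Qed.
Let lin3 : - b * k2 * n1 + k0 * n0 - 16%:R * a ^+ 2 * kap = b * k1.
Proof.
rewrite /kap /syl_k0 /syl_k1 /syl_k2; move: nt1; move: t1 => t nt.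
rewrite /syl_norm /syl_q0 /syl_q1 /syl_q2 /syl_w3 /syl_w4 /syl_v0 /syl_v1 /syl_v2.
by rewrite /syl_m0 /syl_m1 /syl_m2; field; rewrite nt.
Qed.

Variable S : L -> Prop.
Hypothesis HS : subfield_closed S.
Hypothesis ST2 : S syl_T2.
Hypothesis Sw : S syl_w.
Hypothesis SB : S syl_B.
Hypothesis SC : S syl_C.

Lemma sylvester_rational : [/\ S a, S b, S n0, S n1 & S dl].
Proof.
have ST3 : S T3 by rewrite T3E; subfield HS.
have E1 : S (inv_E1 1 syl_T2 syl_B syl_C) by rewrite /inv_E1; subfield HS.
have EA : S (inv_A 1 syl_T2 syl_B syl_C) by rewrite /inv_A; subfield HS.
have E2 : S (inv_E2 1 syl_T2 T3 syl_B syl_C) by rewrite /inv_E2; subfield HS.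
have E3 : S (inv_E3 1 syl_T2 T3 syl_B syl_C) by rewrite /inv_E3; subfield HS.
have Sa : S a.
  by rewrite -(inv_aE k0 n3 nd) t1_1 -/syl_T2 -/T3 -/syl_B -/syl_C /inv_a; subfield HS.
have Sb : S b.
  by rewrite -(inv_bE k0 n3 nd) t1_1 -/syl_T2 -/T3 -/syl_B -/syl_C /inv_b; subfield HS.
have Sd : S (cub_index a b k1 k2).
  rewrite -[cub_index _ _ _ _]invrK -(inv_dE k0 n3 nd) t1_1 -/syl_T2 -/T3 -/syl_B -/syl_C.
  by rewrite /inv_d /inv_g1 /inv_g2; subfield HS.
have Sk1 : S k1.
  rewrite -(divfK nd k1) -(inv_g2E k0 n3 nd) t1_1 -/syl_T2 -/syl_B -/syl_C.
  by rewrite /inv_g2; subfield HS.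
have Sk2 : S k2.
  have -> : k2 = - (syl_C * cub_index a b k1 k2) by rewrite /syl_C /cub_C divfK // opprK.
  by subfield HS.
have Sk0 : S k0.
  have -> : k0 = (cub_t1 a k0 k2 + 2%:R * a * k2) / 3%:R.
    by rewrite /cub_t1 /cub_s1; field; rewrite n3.
  by rewrite t1_1; subfield HS.
have SD : S syl_det by rewrite /syl_det; subfield HS.
have Sn1 : S n1.
  (* Cramer's rule for the system [lin1], [lin2], [lin3]; likewise for [n0] below. *)
  have -> : n1 = (- (k0 - a * k2) * (k1 * (- 16%:R * a ^+ 2) - 9%:R * b * k0)
    - k2 * ((a * k1 + b * k2) * (- 16%:R * a ^+ 2) - 9%:R * b * (b * k1))
    - 15%:R * a * ((a * k1 + b * k2) * k0 - k1 * (b * k1))) / syl_det.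
    apply: (mulIf ndet); rewrite divfK // -lin1 -lin2 -lin3 /syl_det; ring.
  by subfield HS.
have Sn0 : S n0.
  have -> : n0 = (k1 * ((a * k1 + b * k2) * (- 16%:R * a ^+ 2) - 9%:R * b * (b * k1))
    + (k0 - a * k2) * ((k0 - a * k2) * (- 16%:R * a ^+ 2) - 9%:R * b * (- b * k2))
    - 15%:R * a * ((k0 - a * k2) * (b * k1) - (a * k1 + b * k2) * (- b * k2))) / syl_det.
    apply: (mulIf ndet); rewrite divfK // -[X in _ + X * _ - _]opprK -lin1 -lin2 -lin3 /syl_det; ring.
  by subfield HS.
split=> //.
have St : S t1.
  rewrite /t1 /syl_t1 /cub_t1 /cub_s1 /syl_q0 /syl_q2 /syl_w3 /syl_w4 /syl_v0 /syl_v1 /syl_v2.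
  by rewrite /syl_m0 /syl_m1 /syl_m2; subfield HS.
have Sg : S dg by rewrite /dg; subfield HS.
have -> : dl = syl_w * t1 ^+ 2 / dg.
  by rewrite /syl_w divfK ?expf_neq0 // mulfK.
by subfield HS.
Qed.
End Recover.

(* The [r_i] are the roots of [T^3 - s1 T^2 + s2 T - s3], the recurrence satisfied by the
   moments [1, 0, P2, P3, P4, P5]; [syl_H] is the determinant of the linear system for s1, s2, s3. *)
Section SylvesterCoordinates.
Variable L : fieldType.
Variables P2 P3 P4 P5 : L.
Hypothesis n3 : 3%:R != 0 :> L.
Definition syl_H := P2 * P4 - P3 ^+ 2 - P2 ^+ 3.
Definition syl_s1 := (P2 * P5 - P3 * P4 - P2 ^+ 2 * P3) / syl_H.
Definition syl_s2 := (P2 ^+ 2 * P4 - P2 * P3 ^+ 2 + P3 * P5 - P4 ^+ 2) / syl_H.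
Definition syl_s3 := P3 - syl_s1 * P2.
Definition syl_a := syl_s2 - syl_s1 ^+ 2 / 3%:R.
Definition syl_b := - 2%:R * (syl_s1 / 3%:R) ^+ 3 + syl_s2 * (syl_s1 / 3%:R) - syl_s3.
Definition syl_n1 := - (syl_s1 / 3%:R).
(** The mean of the [r_i] is [syl_s1 / 3]. Moving the moments 1, 0, [P2] there gives a second moment
    [P2 + (syl_s1 / 3)^2], which in Sylvester's form is [n0 - a]. *)
Definition syl_n0 := P2 + (syl_s1 / 3%:R) ^+ 2 + syl_a.
Hypothesis nH : syl_H != 0.

Lemma sylvester_coords : [/\ syl_P2 syl_a syl_n0 syl_n1 = P2,
  syl_P3 syl_a syl_b syl_n0 syl_n1 = P3, syl_P4 syl_a syl_b syl_n0 syl_n1 = P4 &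
  syl_P5 syl_a syl_b syl_n0 syl_n1 = P5].
Proof.
have e4 : syl_s1 * P3 - syl_s2 * P2 = P4.
  by rewrite /syl_s1 /syl_s2; move: nH; rewrite /syl_H => nH'; field; rewrite nH'.
have e5 : syl_s1 * P4 - syl_s2 * P3 + syl_s3 * P2 = P5.
  by rewrite /syl_s3 /syl_s1 /syl_s2; move: nH; rewrite /syl_H => nH'; field; rewrite nH'.
have n9 : 9%:R != 0 :> L by rewrite (_ : 9%:R = 3%:R ^+ 2); [rewrite expf_neq0|ring].
have n27 : 27%:R != 0 :> L by rewrite (_ : 27%:R = 3%:R ^+ 3); [rewrite expf_neq0|ring].
have e3 : syl_s1 * P2 + syl_s3 = P3 by rewrite /syl_s3; ring.
rewrite /syl_P2 /syl_P3 /syl_P4 /syl_P5 /syl_M5 /syl_M4 /syl_M3 /syl_M2 /syl_M1.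
rewrite /syl_n0 /syl_b /syl_a /syl_n1; split.
- by ring.
- by rewrite -[RHS]e3; move: syl_s1 syl_s2 syl_s3 n3 => s1 s2 s3 n3'; field; rewrite n3' ?n9 ?n27.
- rewrite -[RHS]e4 -e3; move: syl_s1 syl_s2 syl_s3 n3 => s1 s2 s3 n3'; field; by rewrite n3' ?n9 ?n27.
- rewrite -[RHS]e5 -e4 -e3; move: syl_s1 syl_s2 syl_s3 n3 => s1 s2 s3 n3'; field; by rewrite n3' ?n9 ?n27.
Qed.
End SylvesterCoordinates.

(** * Degree 5: the general quintic *)

Lemma Poly5E (L : comNzRingType) (a b c d e : L) :
  ('X - a%:P) * (('X - b%:P) * (('X - c%:P) * (('X - d%:P) * ('X - e%:P)))) =
  Poly [:: - (a * b * c * d * e);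
    a * b * c * d + a * b * c * e + a * b * d * e + a * c * d * e + b * c * d * e;
    - (a * b * c + a * b * d + a * b * e + a * c * d + a * c * e + a * d * e
       + b * c * d + b * c * e + b * d * e + c * d * e);
    a * b + a * c + a * d + a * e + b * c + b * d + b * e + c * d + c * e + d * e;
    - (a + b + c + d + e); 1].
Proof. by rewrite /= !cons_poly_def; ring. Qed.

Section Quintic.
Variable L : fieldType.
Variables a b c d e : L.
Hypothesis n2 : 2%:R != 0 :> L.
Hypothesis n3 : 3%:R != 0 :> L.
Hypothesis n5 : 5%:R != 0 :> L.
Definition quintic_e1 := a + b + c + d + e.
Definition quintic_e2 :=
  a * b + a * c + a * d + a * e + b * c + b * d + b * e + c * d + c * e + d * e.
Definition quintic_e3 :=
  a * b * c + a * b * d + a * b * e + a * c * d + a * c * e + a * d * e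
  + b * c * d + b * c * e + b * d * e + c * d * e.
Definition quintic_e4 :=
  a * b * c * d + a * b * c * e + a * b * d * e + a * c * d * e + b * c * d * e.
Definition quintic_e5 := a * b * c * d * e.
Definition quintic_dl :=
  (b - a) * (c - a) * (d - a) * (e - a) * (c - b) * (d - b) * (e - b) * (d - c) * (e - c) * (e - d).
Let h := quintic_e1 / 5%:R.
(** The coefficients of the centred quintic divided by signed binomial coefficients, so that in
    Sylvester's form they are the moments [\sum_i a_i r_i^k]. *)
Definition quintic_P2 := (quintic_e2 - 4%:R * h * quintic_e1 + 10%:R * h ^+ 2) / 10%:R.
Definition quintic_P3 :=
  (quintic_e3 - 3%:R * h * quintic_e2 + 6%:R * h ^+ 2 * quintic_e1 - 10%:R * h ^+ 3) / 10%:R.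
Definition quintic_P4 := (quintic_e4 - 2%:R * h * quintic_e3 + 3%:R * h ^+ 2 * quintic_e2
  - 4%:R * h ^+ 3 * quintic_e1 + 5%:R * h ^+ 4) / 5%:R.
Definition quintic_P5 := quintic_e5 - h * quintic_e4 + h ^+ 2 * quintic_e3 - h ^+ 3 * quintic_e2
  + h ^+ 4 * quintic_e1 - h ^+ 5.

Let n10 : 10%:R != 0 :> L.
Proof. by rewrite (_ : 10%:R = 2%:R * 5%:R); [rewrite mulf_neq0|ring]. Qed.

Lemma quintic_disc : quintic_dl ^+ 2 =
  disc5 (10%:R * quintic_P2) (- 10%:R * quintic_P3) (5%:R * quintic_P4) (- quintic_P5).
Proof.
pose z1 := a - h; pose z2 := b - h; pose z3 := c - h; pose z4 := d - h.
pose z5 := - (z1 + z2 + z3 + z4).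
have [ea eb ec ed] : [/\ a = z1 + h, b = z2 + h, c = z3 + h & d = z4 + h].
  by rewrite /z1 /z2 /z3 /z4 !subrK.
have ee : e = z5 + h.
  by rewrite /z5 /z1 /z2 /z3 /z4 /h /quintic_e1; field; rewrite n5.
have hE : quintic_e1 = 5%:R * h by rewrite /h; field; rewrite n5.
have -> : quintic_dl = (z1-z2)*(z1-z3)*(z1-z4)*(z1-z5)*(z2-z3)*(z2-z4)*(z2-z5)*(z3-z4)*(z3-z5)*(z4-z5).
  by rewrite /quintic_dl ee ea eb ec ed; move: h => h'; ring.
have -> : 10%:R * quintic_P2 = z1*z2+z1*z3+z1*z4+z1*z5+z2*z3+z2*z4+z2*z5+z3*z4+z3*z5+z4*z5.
  rewrite /quintic_P2 mulrC divfK // hE /quintic_e2; move: ea eb ec ed ee.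
  by rewrite /z5 {z5}; move: h z1 z2 z3 z4 => h' y1 y2 y3 y4 -> -> -> -> ->; ring.
have -> : - 10%:R * quintic_P3 = -(z1*z2*z3+z1*z2*z4+z1*z2*z5+z1*z3*z4+z1*z3*z5+z1*z4*z5+z2*z3*z4+z2*z3*z5+z2*z4*z5+z3*z4*z5).
  rewrite /quintic_P3 mulNr mulrC divfK // hE /quintic_e3 /quintic_e2; move: ea eb ec ed ee.
  by rewrite /z5 {z5}; move: h z1 z2 z3 z4 => h' y1 y2 y3 y4 -> -> -> -> ->; ring.
have -> : 5%:R * quintic_P4 = z1*z2*z3*z4+z1*z2*z3*z5+z1*z2*z4*z5+z1*z3*z4*z5+z2*z3*z4*z5.
  rewrite /quintic_P4 mulrC divfK // hE /quintic_e4 /quintic_e3 /quintic_e2; move: ea eb ec ed ee.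
  by rewrite /z5 {z5}; move: h z1 z2 z3 z4 => h' y1 y2 y3 y4 -> -> -> -> ->; ring.
have -> : quintic_P5 = z1*z2*z3*z4*z5.
  rewrite /quintic_P5 hE /quintic_e5 /quintic_e4 /quintic_e3 /quintic_e2; move: ea eb ec ed ee.
  by rewrite /z5 {z5}; move: h z1 z2 z3 z4 => h' y1 y2 y3 y4 -> -> -> -> ->; ring.
by rewrite /disc5 /z5; move: z1 z2 z3 z4 {ea eb ec ed ee z5} => y1 y2 y3 y4; ring.
Qed.

Variable S : L -> Prop.
Hypothesis HS : subfield_closed S.
Hypothesis S1 : S quintic_e1.

Lemma quintic_shift : S quintic_P2 -> S quintic_P3 -> S quintic_P4 -> S quintic_P5 ->
  [/\ S quintic_e2, S quintic_e3, S quintic_e4 & S quintic_e5].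
Proof.
move=> SP2 SP3 SP4 SP5; have Sh : S h by rewrite /h; subfield HS.
have Se2 : S quintic_e2.
  have -> : quintic_e2 = 10%:R * quintic_P2 + 4%:R * h * quintic_e1 - 10%:R * h ^+ 2.
    by rewrite /quintic_P2 mulrC divfK //; ring.
  by subfield HS.
have Se3 : S quintic_e3.
  have -> : quintic_e3 = 10%:R * quintic_P3 + 3%:R * h * quintic_e2 - 6%:R * h ^+ 2 * quintic_e1
    + 10%:R * h ^+ 3 by rewrite /quintic_P3 mulrC divfK //; ring.
  by subfield HS.
have Se4 : S quintic_e4.
  have -> : quintic_e4 = 5%:R * quintic_P4 + 2%:R * h * quintic_e3 - 3%:R * h ^+ 2 * quintic_e2
    + 4%:R * h ^+ 3 * quintic_e1 - 5%:R * h ^+ 4 by rewrite /quintic_P4 mulrC divfK //; ring.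
  by subfield HS.
split=> //.
have -> : quintic_e5 = quintic_P5 + h * quintic_e4 - h ^+ 2 * quintic_e3 + h ^+ 3 * quintic_e2
  - h ^+ 4 * quintic_e1 + h ^+ 5 by rewrite /quintic_P5; ring.
by subfield HS.
Qed.
End Quintic.

(* The roots of [T^5 - 10 T^3 + 30 T^2 - 30 T + 9], whose Sylvester coordinates are
   [a = 0], [b = 1], [n0 = 0], [n1 = -1]. *)
Lemma quintic_point (F : closedFieldType) : exists a b c d e : F,
  [/\ quintic_e1 a b c d e = 0, quintic_e2 a b c d e = - 10%:R, quintic_e3 a b c d e = - 30%:R,
      quintic_e4 a b c d e = - 30%:R & quintic_e5 a b c d e = - 9%:R].
Proof.
pose s : seq F := [:: 9%:R; - 30%:R; 30%:R; - 10%:R; 0; 1].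
have sP : Poly s = s :> seq F by rewrite (@PolyK _ 0) //= oner_neq0.
have [r e] := closed_field_poly_normal (Poly s).
have lc : lead_coef (Poly s) = 1 by rewrite /lead_coef sP.
rewrite lc scale1r in e.
have : size r = 5%N.
  by have := congr1 (fun q : {poly F} => size q) e; rewrite sP size_prod_XsubC => -[].
case: r e => [|a [|b [|c [|d [|f [|//]]]]]] // e _; exists a, b, c, d, f.
rewrite !big_cons big_nil mulr1 Poly5E in e.
have ck k := congr1 (fun q : {poly F} => q`_k) e.
split; apply: oppr_inj.
- by have := ck 4%N; rewrite !coef_Poly /= oppr0 => ->.
- by rewrite opprK; have := ck 3%N; rewrite !coef_Poly /= => /(congr1 -%R); rewrite opprK => ->.
- by rewrite opprK; have := ck 2%N; rewrite !coef_Poly /= => ->.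
- by rewrite opprK; have := ck 1%N; rewrite !coef_Poly /= => /(congr1 -%R); rewrite opprK => ->.
- by rewrite opprK; have := ck 0%N; rewrite !coef_Poly /= => ->.
Qed.

Lemma alt_rational5 (F : closedFieldType) p : p \in [pchar F] -> (5 < p)%N -> alt_rational F 5.
Proof.
move=> Fp p5 L emb embI embF act actE.
have n2 : 2%:R != 0 :> L by apply: (emb_nat_neq0 emb Fp); lia.
have n3 : 3%:R != 0 :> L by apply: (emb_nat_neq0 emb Fp); lia.
have n5 : 5%:R != 0 :> L by apply: (emb_nat_neq0 emb Fp); lia.
have x2 : 2%:R != 0 :> F by apply: (pchar_nat_neq0 Fp); lia.
have x3 : 3%:R != 0 :> F by apply: (pchar_nat_neq0 Fp); lia.
have x5 : 5%:R != 0 :> F by apply: (pchar_nat_neq0 Fp); lia.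
have x10 : 10%:R != 0 :> F by rewrite (_ : 10%:R = 2%:R * 5%:R); [rewrite mulf_neq0|ring].
have x27 : 27%:R != 0 :> F by rewrite (_ : 27%:R = 3%:R ^+ 3); [rewrite expf_neq0|ring].
pose a := emb 'X_ord0; pose b := emb 'X_(lift ord0 ord0); pose c := emb 'X_(lift ord0 (lift ord0 ord0)).
pose d := emb 'X_(lift ord0 (lift ord0 (lift ord0 ord0))).
pose e := emb 'X_(lift ord0 (lift ord0 (lift ord0 (lift ord0 ord0)))).
pose e1 := quintic_e1 a b c d e; pose e2 := quintic_e2 a b c d e.
pose e3 := quintic_e3 a b c d e; pose e4 := quintic_e4 a b c d e.
pose e5 := quintic_e5 a b c d e; pose dl := quintic_dl a b c d e.
pose P2 := quintic_P2 a b c d e; pose P3 := quintic_P3 a b c d e.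
pose P4 := quintic_P4 a b c d e; pose P5 := quintic_P5 a b c d e.
have VP : var_poly emb = Poly [:: - e5; e4; - e3; e2; - e1; 1].
  by rewrite /var_poly !big_ord_recl big_ord0 mulr1 Poly5E.
have VD : var_disc emb = dl.
  rewrite /var_disc; under eq_bigr => i _ do rewrite big_mkcond.
  by rewrite !big_ord_recl !big_ord0 /= !mul1r !mulr1 !mulrA.
pose H := syl_H P2 P3 P4; pose s1 := syl_s1 P2 P3 P4 P5; pose s2 := syl_s2 P2 P3 P4 P5.
pose s3 := syl_s3 P2 P3 P4 P5.
pose al := syl_a P2 P3 P4 P5; pose be := syl_b P2 P3 P4 P5.
pose N0 := syl_n0 P2 P3 P4 P5; pose N1 := syl_n1 P2 P3 P4 P5.
pose q0 := syl_q0 al be N0 N1; pose q1 := syl_q1 al be N0 N1; pose q2 := syl_q2 al be N0 N1.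
pose t1 := syl_t1 al be N0 N1.
pose k0 := syl_k0 al be N0 N1; pose k1 := syl_k1 al be N0 N1; pose k2 := syl_k2 al be N0 N1.
have [ra [rb [rc [rd [re [v1 v2 v3 v4 v5]]]]]] := quintic_point F.
(* Every denominator is a function of [e1], ..., [e5], whose values at this point are known, so the
   roots themselves can stay unspecified. *)
pose pt (i : 'I_5) : F := nth 0 [:: ra; rb; rc; rd; re] i.
have sa : spec emb pt a ra by apply: specX.
have sb : spec emb pt b rb by apply: specX.
have sc : spec emb pt c rc by apply: specX.
have sd : spec emb pt d rd by apply: specX.
have se : spec emb pt e re by apply: specX.
have w1 : spec emb pt e1 0 by rewrite -v1 /e1 /quintic_e1; spec_eval embI.
have w2 : spec emb pt e2 (- 10%:R) by rewrite -v2 /e2 /quintic_e2; spec_eval embI.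
have w3 : spec emb pt e3 (- 30%:R) by rewrite -v3 /e3 /quintic_e3; spec_eval embI.
have w4 : spec emb pt e4 (- 30%:R) by rewrite -v4 /e4 /quintic_e4; spec_eval embI.
have w5 : spec emb pt e5 (- 9%:R) by rewrite -v5 /e5 /quintic_e5; spec_eval embI.
have wP2 : spec emb pt P2 (-1).
  by apply: spec_eq; [rewrite /P2 /quintic_P2 -/e1 -/e2; spec_eval embI|field; rewrite ?x5 ?x10].
have wP3 : spec emb pt P3 (- 3%:R).
  by apply: spec_eq; [rewrite /P3 /quintic_P3 -/e1 -/e2 -/e3; spec_eval embI|field; rewrite ?x5 ?x10].
have wP4 : spec emb pt P4 (- 6%:R).
  by apply: spec_eq; [rewrite /P4 /quintic_P4 -/e1 -/e2 -/e3 -/e4; spec_eval embI|field; rewrite ?x5 ?x10].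
have wP5 : spec emb pt P5 (- 9%:R).
  by apply: spec_eq; [rewrite /P5 /quintic_P5 -/e1 -/e2 -/e3 -/e4 -/e5; spec_eval embI|field; rewrite ?x5 ?x10].
have x2' : - 2%:R != 0 :> F by rewrite oppr_eq0.
have wH : spec emb pt H (- 2%:R) by apply: spec_eq; [rewrite /H /syl_H; spec_eval embI|ring].
have ws1 : spec emb pt s1 3%:R.
  by apply: spec_eq; [rewrite /s1 /syl_s1 -/H; spec_eval embI|field; rewrite ?x2].
have ws2 : spec emb pt s2 3%:R.
  by apply: spec_eq; [rewrite /s2 /syl_s2 -/H; spec_eval embI|field; rewrite ?x2].
have ws3 : spec emb pt s3 0.
  by apply: spec_eq; [rewrite /s3 /syl_s3 -/s1; spec_eval embI|ring].
have wa : spec emb pt al 0.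
  by apply: spec_eq; [rewrite /al /syl_a -/s1 -/s2; spec_eval embI|field; rewrite ?x3].
have wb : spec emb pt be 1.
  by apply: spec_eq; [rewrite /be /syl_b -/s1 -/s2 -/s3; spec_eval embI|field; rewrite ?x3 ?x27].
have wn1 : spec emb pt N1 (-1).
  by apply: spec_eq; [rewrite /N1 /syl_n1 -/s1; spec_eval embI|field; rewrite ?x3].
have wn0 : spec emb pt N0 0.
  by apply: spec_eq; [rewrite /N0 /syl_n0 -/s1 -/al; spec_eval embI|field; rewrite ?x3].
have wq0 : spec emb pt q0 9%:R.
  apply: spec_eq; last first; last rewrite /q0 /syl_q0 /syl_w3 /syl_v0 /syl_v1 /syl_v2
    /syl_m0 /syl_m1 /syl_m2; last by spec_eval embI. by ring.
have wq1 : spec emb pt q1 9%:R.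
  apply: spec_eq; last first; last rewrite /q1 /syl_q1 /syl_w3 /syl_w4 /syl_v0 /syl_v1 /syl_v2
    /syl_m0 /syl_m1 /syl_m2; last by spec_eval embI. by ring.
have wq2 : spec emb pt q2 9%:R.
  apply: spec_eq; last first; last rewrite /q2 /syl_q2 /syl_w4 /syl_v0 /syl_v1 /syl_v2
    /syl_m0 /syl_m1 /syl_m2; last by spec_eval embI. by ring.
have wt1 : spec emb pt t1 27%:R.
  by apply: spec_eq; [rewrite /t1 /syl_t1 /cub_t1 /cub_s1 -/q0 -/q2; spec_eval embI|ring].
have wk0 : spec emb pt k0 3%:R^-1.
  by apply: spec_eq; [rewrite /k0 /syl_k0 -/q0 -/t1; spec_eval embI|field; rewrite ?x3 ?x27].
have wk1 : spec emb pt k1 3%:R^-1.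
  by apply: spec_eq; [rewrite /k1 /syl_k1 -/q1 -/t1; spec_eval embI|field; rewrite ?x3 ?x27].
have wk2 : spec emb pt k2 3%:R^-1.
  by apply: spec_eq; [rewrite /k2 /syl_k2 -/q2 -/t1; spec_eval embI|field; rewrite ?x3 ?x27].
have nH : H != 0 by apply: (spec_neq0 embI wH).
have nt1 : t1 != 0 by apply: (spec_neq0 embI wt1).
have ndg : - 4%:R * al ^+ 3 - 27%:R * be ^+ 2 != 0.
  have : spec emb pt (- 4%:R * al ^+ 3 - 27%:R * be ^+ 2) (- 27%:R).
    by apply: spec_eq; [spec_eval embI|ring].
  by move/(spec_neq0 embI); apply; rewrite oppr_eq0.
have nd : cub_index al be k1 k2 != 0.
  have : spec emb pt (cub_index al be k1 k2) (2%:R / 27%:R).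
    by apply: spec_eq; [rewrite /cub_index; spec_eval embI|field; rewrite ?x3 ?x27].
  by move/(spec_neq0 embI); apply; rewrite mulf_neq0 ?invr_eq0.
have ndet : syl_det al be N0 N1 != 0.
  have : spec emb pt (syl_det al be N0 N1) (- 2%:R).
    by apply: spec_eq; [rewrite /syl_det -/k0 -/k1 -/k2; spec_eval embI|field; rewrite ?x3].
  by move/(spec_neq0 embI); apply.
have [pe2 pe3 pe4 pe5] := sylvester_coords P5 n3 nH.
have dl2 : dl ^+ 2 = disc5 (10%:R * syl_P2 al N0 N1) (- 10%:R * syl_P3 al be N0 N1)
    (5%:R * syl_P4 al be N0 N1) (- syl_P5 al be N0 N1).
  by rewrite pe2 pe3 pe4 pe5; apply: quintic_disc.
(* [e1] accounts for translations, [syl_T2] and [syl_w] are homogeneous of degree zero, and [syl_B],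
   [syl_C] carry the scale. *)
exists (fun i => nth 0 [:: e1; syl_T2 al be N0 N1; syl_w al be N0 N1 dl;
  syl_B al be N0 N1; syl_C al be N0 N1] i).
split.
  have HS := alt_inv_subfield act.
  have S1 : alt_inv act e1.
    by rewrite -[e1]opprK; apply: (subfN HS); have := alt_inv_coef actE 4; rewrite VP coef_Poly.
  have S2 : alt_inv act e2 by have := alt_inv_coef actE 3; rewrite VP coef_Poly.
  have S3 : alt_inv act e3.
    by rewrite -[e3]opprK; apply: (subfN HS); have := alt_inv_coef actE 2; rewrite VP coef_Poly.
  have S4 : alt_inv act e4 by have := alt_inv_coef actE 1; rewrite VP coef_Poly.
  have S5 : alt_inv act e5.
    by rewrite -[e5]opprK; apply: (subfN HS); have := alt_inv_coef actE 0; rewrite VP coef_Poly.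
  have Sd : alt_inv act dl by rewrite -VD; apply: alt_inv_disc.
  have SP2 : alt_inv act P2 by rewrite /P2 /quintic_P2 -/e1 -/e2; subfield HS.
  have SP3 : alt_inv act P3 by rewrite /P3 /quintic_P3 -/e1 -/e2 -/e3; subfield HS.
  have SP4 : alt_inv act P4 by rewrite /P4 /quintic_P4 -/e1 -/e2 -/e3 -/e4; subfield HS.
  have SP5 : alt_inv act P5 by rewrite /P5 /quintic_P5 -/e1 -/e2 -/e3 -/e4 -/e5; subfield HS.
  have SH : alt_inv act H by rewrite /H /syl_H; subfield HS.
  have Ss1 : alt_inv act s1 by rewrite /s1 /syl_s1 -/H; subfield HS.
  have Ss2 : alt_inv act s2 by rewrite /s2 /syl_s2 -/H; subfield HS.
  have Ss3 : alt_inv act s3 by rewrite /s3 /syl_s3 -/s1; subfield HS.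
  have Sal : alt_inv act al by rewrite /al /syl_a -/s1 -/s2; subfield HS.
  have Sbe : alt_inv act be by rewrite /be /syl_b -/s1 -/s2 -/s3; subfield HS.
  have SN1 : alt_inv act N1 by rewrite /N1 /syl_n1 -/s1; subfield HS.
  have SN0 : alt_inv act N0 by rewrite /N0 /syl_n0 -/s1 -/al; subfield HS.
  have Sq0 : alt_inv act q0.
    rewrite /q0 /syl_q0 /syl_w3 /syl_v0 /syl_v1 /syl_v2 /syl_m0 /syl_m1 /syl_m2; subfield HS.
  have Sq1 : alt_inv act q1.
    rewrite /q1 /syl_q1 /syl_w3 /syl_w4 /syl_v0 /syl_v1 /syl_v2 /syl_m0 /syl_m1 /syl_m2; subfield HS.
  have Sq2 : alt_inv act q2.
    rewrite /q2 /syl_q2 /syl_w4 /syl_v0 /syl_v1 /syl_v2 /syl_m0 /syl_m1 /syl_m2; subfield HS.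
  have St1 : alt_inv act t1 by rewrite /t1 /syl_t1 /cub_t1 /cub_s1 -/q0 -/q2; subfield HS.
  have Sk0 : alt_inv act k0 by rewrite /k0 /syl_k0 -/q0 -/t1; subfield HS.
  have Sk1 : alt_inv act k1 by rewrite /k1 /syl_k1 -/q1 -/t1; subfield HS.
  have Sk2 : alt_inv act k2 by rewrite /k2 /syl_k2 -/q2 -/t1; subfield HS.
  have Si : alt_inv act (cub_index al be k1 k2) by rewrite /cub_index; subfield HS.
  case=> [[|[|[|[|[|//]]]]] /= _] //.
  - by rewrite /syl_T2 /cub_t2 /cub_s2 /cub_s1 -/k0 -/k1 -/k2; subfield HS.
  - by rewrite /syl_w -/t1; subfield HS.
  - by rewrite /syl_B /cub_B -/k0 -/k1 -/k2; subfield HS.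
  - by rewrite /syl_C /cub_C -/k0 -/k1 -/k2; subfield HS.
move=> q qi S HS Sc Sf.
have S1 : S e1 := Sf ord0.
have S2 : S (syl_T2 al be N0 N1) := Sf (lift ord0 ord0).
have S3 : S (syl_w al be N0 N1 dl) := Sf (lift ord0 (lift ord0 ord0)).
have S4 : S (syl_B al be N0 N1) := Sf (lift ord0 (lift ord0 (lift ord0 ord0))).
have S5 : S (syl_C al be N0 N1) := Sf (lift ord0 (lift ord0 (lift ord0 (lift ord0 ord0)))).
have [Sa Sb Sn0 Sn1 Sdl] := sylvester_rational n2 n3 n5 nt1 ndg nd ndet dl2 HS S2 S3 S4 S5.
have SP2 : S P2 by rewrite -pe2 /syl_P2 /syl_M2 /syl_M1; subfield HS.
have SP3 : S P3 by rewrite -pe3 /syl_P3 /syl_M3 /syl_M2 /syl_M1; subfield HS.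
have SP4 : S P4 by rewrite -pe4 /syl_P4 /syl_M4 /syl_M3 /syl_M2 /syl_M1; subfield HS.
have SP5 : S P5 by rewrite -pe5 /syl_P5 /syl_M5 /syl_M4 /syl_M3 /syl_M2 /syl_M1; subfield HS.
have [Se2 Se3 Se4 Se5] := quintic_shift n2 n5 HS S1 SP2 SP3 SP4 SP5.
apply: (sub_alt_inv embI embF actE _ n2 HS Sc) qi => //; last by rewrite VD.
by move=> k; rewrite VP coef_Poly; case: k => [|[|[|[|[|[|k]]]]]] /=; rewrite ?nth_nil; subfield HS.
Qed.

Theorem mainTheorem4 (n : nat) (hn : (3 <= n <= 5)%N) :
  exists p0 : nat,
  forall (F : closedFieldType) (p : nat), p \in [pchar F] -> (p0 < p)%N ->
  forall (W : algType F) (x y : 'I_n -> W), is_weyl x y ->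
  exists m l : nat,
  exists (D1 : unitRingType) (f1 : W -> D1),
    is_skew_frac (alt_invariant x y) f1 /\
    exists (W' : algType (ratfun F l)) (x' y' : 'I_m -> W'),
      is_weyl x' y' /\
      exists (D2 : unitRingType) (f2 : W' -> D2),
        is_skew_frac (fun _ => True) f2 /\
        exists phi : D1 -> D2,
          is_F_ring_iso (fun c : F => f1 (c%:A))
                        (fun c : F => f2 ((ratfun_const l c)%:A)) phi.
Proof.
(* Above 5, the numbers 2, 3, 5 and the order of the alternating group are all invertible. *)
exists 5%N => F p Fp p5 W x y HW.
apply: (weyl_alt_skew_rational Fp _ _ _ HW); first by lia.
- move=> c; have p_gt0 := prime_gt0 (pcharf_prime Fp).
  (* [F] is perfect: a root of [X^p - c] is a p-th root of [c]. *)
  have /closed_rootP[r] : size ('X^p - c%:P) != 1%N by rewrite size_XnsubC // eqSS -lt0n.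
  by rewrite rootE !hornerE subr_eq0 => /eqP <-; exists r.
- move: n hn {HW x y} => [|[|[|[|[|[|//]]]]]] // _.
  + exact: alt_rational3 Fp p5.
  + exact: alt_rational4 Fp p5.
  + exact: alt_rational5 Fp p5.
Qed.
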